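(* Let $$\mathcal{F}(s)=\pi^{-s/2}\,\Gamma\!\left(\frac{s}{2}\right)\int_{0\swarrow 1}\frac{e^{i\pi u^2}u^{-s}}{e^{i\pi u}-e^{-i\pi u}}\,du .$$ Then, for all $s\in\mathbb{C}$ (as identities between meromorphic functions of $s$), $$\mathcal{F}(s)=2^{s/2}\,\Gamma\!\left(\frac{s}{2}\right)e^{-i\pi(1-s)/4}\int_{-\frac12\searrow\frac12}\frac{e^{-i\pi u^2/2+i\pi u}}{2i\cos \pi u}\;U\!\left(s-\tfrac12,\sqrt{2\pi}\,e^{i\pi/4}u\right)du$$ and $$\overline{\mathcal{F}(1-\overline{s})}=2^{(1-s)/2}\,\Gamma\!\left(\frac{1-s}{2}\right)e^{i\pi s/4}\int_{-\frac12\swarrow\frac12}\frac{e^{i\pi u^2/2-i\pi u}}{2i\cos \pi u}\;U\!\left(\tfrac12-s,\sqrt{2\pi}\,e^{-i\pi/4}u\right)du .$$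
   Context: Path notation: for real $p<q$, an integral sign with subscript $p\swarrow q$, $p\searrow q$, $p\nearrow q$ or $p\nwarrow q$ denotes integration along a straight line of slope $1$ (for $\swarrow,\nearrow$) or slope $-1$ (for $\searrow,\nwarrow$), from $\infty$ to $\infty$ in the direction of the arrow, crossing the real axis at a point strictly between $p$ and $q$. For example, $0\swarrow 1$ runs from the upper right to the lower left along a line of slope $1$ crossing the real axis between $0$ and $1$; $-\frac12\searrow\frac12$ runs from the upper left to the lower right along a line of slope $-1$ crossing the real axis between $-\frac12$ and $\frac12$. Powers $u^{-s}$ are taken with the principal branch of the logarithm ($|\arg u|<\pi$). $U(a,z)$ is the parabolic cylinder function, an entire function of both $a$ and $z$, defined for $a,z\in\mathbb{C}$ by $$U(a,z)=\frac{\Gamma(1/2-a)}{2\pi i}\,e^{-z^2/4}\int_C e^{-w^2/2+zw}\,w^{a-1/2}\,dw,$$ where the path $C$ comes from $\infty$ in the third quadrant parallel to the (negative) real axis, circles the origin once in the positive direction, and returns to $\infty$ in the second quadrant parallel to the real axis, with $w^{a-1/2}$ the principal branch ($|\arg w|<\pi$); at the values $a=1/2,3/2,5/2,\dots$, where $\Gamma(1/2-a)$ has poles, $U(a,z)$ is given by analytic continuation in $a$. *)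

(* Defs.v *)
From Stdlib Require Import Reals ClassicalEpsilon.
From Coquelicot Require Import Coquelicot.
Open Scope R_scope.
Open Scope C_scope.

Definition Cexp (z : C) : C :=
  (exp (fst z) * cos (snd z), exp (fst z) * sin (snd z))%R.

Definition Ccos (z : C) : C := (Cexp (Ci * z) + Cexp (- (Ci * z))) / 2.

(* tan (theta / 2) = sin theta / (1 + cos theta), so this is the argument in
   (-PI, PI) for z off the half-line (-oo, 0]; the values on that half-line are
   meaningless. *)
Definition Carg (z : C) : R := (2 * atan (snd z / (Cmod z + fst z)))%R.

Definition Clog (z : C) : C := (ln (Cmod z), Carg z).

Definition Cpower (z a : C) : C := Cexp (a * Clog z).

Definition CRInt_gen (f : R -> C) (Fa Fb : (R -> Prop) -> Prop) : C :=
  @RInt_gen C_R_CompleteNormedModule f Fa Fb.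

Definition dir_NE : C := Cexp (Ci * PI / 4).
Definition dir_SW : C := - dir_NE.
Definition dir_SE : C := Cexp (- (Ci * PI / 4)).

Definition line_integrand (p : R) (dir : C) (f : C -> C) (t : R) : C :=
  f (p + t * dir) * dir.

(* Integral along the whole straight line through the real point p, run through
   in the direction dir. *)
Definition line_int (p : R) (dir : C) (f : C -> C) : C :=
  CRInt_gen (line_integrand p dir f) (Rbar_locally m_infty) (Rbar_locally p_infty).

Definition line_int_converges (p : R) (dir : C) (f : C -> C) : Prop :=
  @ex_RInt_gen C_R_NormedModule (line_integrand p dir f)
    (Rbar_locally m_infty) (Rbar_locally p_infty).

(* The path from -oo - i r along a horizontal half-line to -i r, along the
   half-circle |w| = r, Re w >= 0, to i r, and back to -oo + i r.  By Cauchy's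
   theorem the choice of r > 0 is immaterial for integrands that are
   holomorphic off (-oo, 0] and decay at infinity. *)
Definition hankel_int (r : R) (f : C -> C) : C :=
  CRInt_gen (fun t : R => f (t - Ci * r)) (Rbar_locally m_infty) (at_point 0%R)
  + @RInt C_R_CompleteNormedModule
      (fun th : R => f (r * Cexp (Ci * th)) * (Ci * r * Cexp (Ci * th)))
      (- PI / 2)%R (PI / 2)%R
  - CRInt_gen (fun t : R => f (t + Ci * r)) (Rbar_locally m_infty) (at_point 0%R).

Definition Gamma_pole (z : C) : Prop := exists n : nat, z = - INR n.

Definition Euler_int (z : C) : C :=
  CRInt_gen (fun t : R => Cpower t (z - 1) * Cexp (- t))
    (at_right 0%R) (Rbar_locally p_infty).

Fixpoint rising (z : C) (n : nat) : C :=
  match n with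
  | O => 1
  | S m => rising z m * (z + INR m)
  end.

(* The least n with Re z + n > 0. *)
Definition Gamma_shift (z : C) : nat := Z.to_nat (up (- fst z)).

(* Euler's integral, which is used as it stands when Re z > 0 (the shift is
   then 0), extended by Gamma (z + n) = z (z + 1) ... (z + n - 1) Gamma z.
   The values at the poles are meaningless. *)
Definition Gamma (z : C) : C :=
  Euler_int (z + INR (Gamma_shift z)) / rising z (Gamma_shift z).

Definition holomorphic_near (g : C -> C) (z : C) : Prop :=
  locally z (fun w : C => @ex_derive C_AbsRing C_NormedModule g w).

(* [g] continues [f] analytically across the isolated point [z]. *)
Definition continues_across (f : C -> C) (z : C) (g : C -> C) : Prop :=
  holomorphic_near g z /\ locally' z (fun w : C => g w = f w).

Definition analytic_value (f : C -> C) (z : C) : C :=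
  epsilon (inhabits f) (continues_across f z) z.

Definition pcfU_contour (r : R) (a z : C) : C :=
  Gamma (1 / 2 - a) / (2 * PI * Ci) * Cexp (- (z ^ 2 / 4))
  * hankel_int r
      (fun w : C => Cexp (- (w ^ 2 / 2) + z * w) * Cpower w (a - 1 / 2)).

(* U(a, z); r > 0 only serves to fix the contour. *)
Definition pcfU (r : R) (a z : C) : C :=
  if excluded_middle_informative (Gamma_pole (1 / 2 - a))
  then analytic_value (fun b : C => pcfU_contour r b z) a
  else pcfU_contour r a z.

(* The values of f at its singularities are irrelevant. *)
Definition meromorphic (f : C -> C) : Prop :=
  forall z : C, exists (n : nat) (g : C -> C),
    holomorphic_near g z /\ locally' z (fun w : C => f w = g w / (w - z) ^ n).

Definition F_integrand (s u : C) : C :=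
  Cexp (Ci * PI * u ^ 2) * Cpower u (- s)
  / (Cexp (Ci * PI * u) - Cexp (- (Ci * PI * u))).

(* c in (0, 1) is the crossing point of the line of integration. *)
Definition calF (c : R) (s : C) : C :=
  Cpower PI (- (s / 2)) * Gamma (s / 2) * line_int c dir_SW (F_integrand s).

Definition U_integrand1 (r : R) (s u : C) : C :=
  Cexp (- (Ci * PI * u ^ 2 / 2) + Ci * PI * u) / (2 * Ci * Ccos (PI * u))
  * pcfU r (s - 1 / 2) (sqrt (2 * PI)%R * Cexp (Ci * PI / 4) * u).

Definition U_integrand2 (r : R) (s u : C) : C :=
  Cexp (Ci * PI * u ^ 2 / 2 - Ci * PI * u) / (2 * Ci * Ccos (PI * u))
  * pcfU r (1 / 2 - s) (sqrt (2 * PI)%R * Cexp (- (Ci * PI / 4)) * u).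

Definition rhs1 (r d : R) (s : C) : C :=
  Cpower 2 (s / 2) * Gamma (s / 2) * Cexp (- (Ci * PI * (1 - s) / 4))
  * line_int d dir_SE (U_integrand1 r s).

Definition rhs2 (r d : R) (s : C) : C :=
  Cpower 2 ((1 - s) / 2) * Gamma ((1 - s) / 2) * Cexp (Ci * PI * s / 4)
  * line_int d dir_SW (U_integrand2 r s).

(* Main.v *)
From Stdlib Require Import Reals Lra Lia Psatz ClassicalEpsilon FunctionalExtensionality ZArith.
From Coquelicot Require Import Coquelicot.
Require Import Defs.
Open Scope R_scope.
Open Scope C_scope.

(** The two integrals in the theorem are iterated integrals over one and the same family of Mordell
    integrals, taken in the two orders.

    Deform the loop in the definition of U to the parabola w = p^2, Re p = rho, with rho > 0
    small.  The same deformation of Hankel's loop integral for 1 / Gamma shows that one kernel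
    k_s(p), which is Gamma (1 - s) p^(2 s - 1) up to a constant, represents
      v^(- s) = int k_s(p) e^(v p^2) dp                                 for Re v > 0,
      U(s - 1/2, z) = e^(- z^2 / 4) int k_s(p) e^(- p^4 / 2 + z p^2) dp  for all z
    ([common_kernel]).  At s = 1, 2, ... Gamma (1 - s) has a pole, both integrals of p^(2 s - 1)
    vanish, and k_s is the limit of the products, which contains log p.

    Put v = sqrt (2 pi) e^(i pi / 4) u in the integral of F, put the same value for z in the
    integral of U, and exchange the integrations ([F_double_dom2], [U_double_dom2], [Int_fubini]).
    With W = - sqrt (2 pi) e^(i pi / 4) p^2 the inner integrals are now
      Phi(W) = int e^(i pi u^2 - u W) / (2 i sin (pi u)) du             over 0 SW 1,
    and, with the factor e^(- p^4 / 2),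
      Psi(W) = int e^(- i pi u^2 + i pi u - u W) / (2 i cos (pi u)) du  over -1/2 SE 1/2.
    Mordell's relation Phi(W) = e^(- i pi / 4) e^(i W^2 / (4 pi)) Psi(W), which is [mordell], is what
    remains, since i W^2 / (4 pi) = - p^4 / 2.  It holds because Phi satisfies two functional
    equations.  Changing W by 2 pi i changes Phi by a Gaussian integral; translating the line of
    integration by 1 amounts to the same change of W, and changes Phi by the residue at 1.  Together
    they give Phi in closed form, as a multiple of the Gaussian integral, which is real
    ([phi_closed]).  The reflection u -> conj u - 1/2 expresses Psi by the conjugate of Phi, and the
    two closed forms agree.

    The second identity is the complex conjugate of the first at 1 - conj s, because U is real for
    real arguments ([pcfU_conj]).  The integral of F is an entire function of s, so that both sides
    are meromorphic as Gamma is.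

    Hankel's formula itself ([hankel_gamma]) is reduced to the integral of p^(2 s - 1) / (1 - p^2)
    over the line Re p = rho by inserting Euler's integral; for Re s <= - 1/2 it is evaluated by the
    residue at 1, and the functional equation of Gamma gives the other s.  Cauchy's theorem is used in
    the form of primitives on star-shaped domains ([star_primitive]). *)

Lemma C_eq (a b : C) : fst a = fst b -> snd a = snd b -> a = b.
Proof. destruct a, b; simpl; congruence. Qed.

Lemma im_le_Cmod (z : C) : Rabs (snd z) <= Cmod z.
Proof. eapply Rle_trans; [apply Rmax_r | apply Rmax_Cmod]. Qed.

Lemma fst_le_Cmod (z : C) : Rabs (fst z) <= Cmod z.
Proof. eapply Rle_trans; [apply Rmax_l | apply Rmax_Cmod]. Qed.

Lemma Cmod_le_sum (z : C) : Cmod z <= Rabs (fst z) + Rabs (snd z).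
Proof.
  unfold Cmod. apply Rsqr_incr_0_var.
  - rewrite Rsqr_sqrt. unfold Rsqr.
    + assert (H1 := Rabs_pos (fst z)). assert (H2 := Rabs_pos (snd z)).
      rewrite <- (pow2_abs (fst z)), <- (pow2_abs (snd z)). nra.
    + nra.
  - assert (H1 := Rabs_pos (fst z)). assert (H2 := Rabs_pos (snd z)). lra.
Qed.

Lemma Cmod_sqr (z : C) : (Cmod z * Cmod z = fst z * fst z + snd z * snd z)%R.
Proof. unfold Cmod. rewrite sqrt_sqrt; nra. Qed.

Lemma C_eq_eps (a b : C) : (forall e, (0 < e)%R -> (Cmod (a - b) <= e)%R) -> a = b.
Proof.
  intros H. apply Ceq_minus, Cmod_eq_0, Rle_antisym; [|apply Cmod_ge_0].
  apply le_epsilon. intros e He. rewrite Rplus_0_l. auto.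
Qed.

Lemma Cmod_triangle' (a b : C) : Cmod (a - b) <= Cmod a + Cmod b.
Proof. unfold Cminus. rewrite <- (Cmod_opp b). apply Cmod_triangle. Qed.

Lemma Cmod_triangle_rev (a b : C) : Cmod a - Cmod b <= Cmod (a + b).
Proof.
  assert (H := Cmod_triangle' (a + b) b).
  replace (a + b - b) with a in H by ring. lra.
Qed.

(** * The exponential and the logarithm *)

Lemma Cexp_0 : Cexp 0 = 1.
Proof. unfold Cexp. simpl. rewrite exp_0, cos_0, sin_0. apply C_eq; simpl; ring. Qed.

Lemma Cexp_plus (a b : C) : Cexp (a + b) = Cexp a * Cexp b.
Proof.
  unfold Cexp. destruct a as [a1 a2], b as [b1 b2]. simpl.
  rewrite exp_plus, cos_plus, sin_plus. apply C_eq; simpl; ring.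
Qed.

Lemma Cexp_mod (z : C) : Cmod (Cexp z) = exp (fst z).
Proof.
  unfold Cexp, Cmod. simpl.
  assert (H := sin2_cos2 (snd z)). unfold Rsqr in H.
  replace (_ + _)%R with (exp (fst z) * exp (fst z))%R by
    (transitivity (exp (fst z) * exp (fst z) * (sin (snd z) * sin (snd z) + cos (snd z) * cos (snd z)))%R;
     [rewrite H; ring | ring]).
  apply sqrt_square. left; apply exp_pos.
Qed.

Lemma Cexp_nz (z : C) : Cexp z <> 0.
Proof. apply Cmod_gt_0. rewrite Cexp_mod. apply exp_pos. Qed.

Lemma Cexp_opp (z : C) : Cexp (- z) = / Cexp z.
Proof.
  assert (H := Cexp_nz z).
  assert (E : Cexp (- z) * Cexp z = 1).
  { rewrite <- Cexp_plus. replace (- z + z) with (RtoC 0) by ring. apply Cexp_0. }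
  replace (Cexp (- z)) with (Cexp (- z) * Cexp z * / Cexp z) by (field; auto).
  rewrite E. field; auto.
Qed.

Lemma Cexp_conj (z : C) : Cexp (Cconj z) = Cconj (Cexp z).
Proof.
  unfold Cexp, Cconj. simpl. rewrite cos_neg, sin_neg. apply C_eq; simpl; ring.
Qed.

Lemma Cexp_real (x : R) : Cexp x = exp x.
Proof. unfold Cexp. simpl. rewrite cos_0, sin_0. apply C_eq; simpl; ring. Qed.

Lemma Cexp_nat (n : nat) (z : C) : Cexp (INR n * z) = Cexp z ^ n.
Proof.
  induction n.
  - simpl. rewrite Cmult_0_l. apply Cexp_0.
  - rewrite S_INR, RtoC_plus.
    replace ((INR n + 1) * z) with (z + INR n * z) by ring.
    rewrite Cexp_plus, IHn. reflexivity.
Qed.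

Lemma Cexp_iPI : Cexp (Ci * PI) = - (1).
Proof.
  unfold Cexp; apply C_eq; simpl;
    replace (0 * PI - 1 * 0)%R with 0%R by ring;
    replace (0 * 0 + 1 * PI)%R with PI by ring; rewrite exp_0, ?cos_PI, ?sin_PI; ring.
Qed.

Lemma Cexp_2iPI : Cexp (2 * Ci * PI) = 1.
Proof.
  replace (2 * Ci * PI) with (Ci * PI + Ci * PI) by ring.
  rewrite Cexp_plus, Cexp_iPI. ring.
Qed.

(** The plane cut along (-oo, 0], where [Clog] is the principal logarithm. *)
Definition slit (z : C) : Prop := (0 < Cmod z + fst z).

Lemma slit_pos (z : C) : 0 < fst z -> slit z.
Proof. intros H. unfold slit. assert (K := Cmod_ge_0 z). lra. Qed.

Lemma slit_im (z : C) : snd z <> 0%R -> slit z.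
Proof.
  intros H. unfold slit.
  assert (K := Cmod_ge_0 z). assert (E := Cmod_sqr z).
  assert (0 < snd z * snd z) by nra.
  nra.
Qed.

Lemma slit_iff (z : C) : slit z -> (0 < fst z) \/ snd z <> 0%R.
Proof.
  intros H. destruct (Rlt_dec 0 (fst z)) as [?|N]; [now left|right].
  intros E0. unfold slit in H.
  assert (E := Cmod_sqr z). rewrite E0 in E. assert (K := Cmod_ge_0 z). nra.
Qed.

Lemma slit_nz (z : C) : slit z -> 0 < Cmod z.
Proof.
  intros H. destruct (slit_iff z H).
  - eapply Rlt_le_trans; [|apply fst_le_Cmod]. rewrite Rabs_pos_eq; lra.
  - eapply Rlt_le_trans; [|apply im_le_Cmod]. now apply Rabs_pos_lt.
Qed.

Lemma slit_neq (z : C) : slit z -> z <> 0.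
Proof. intros H. apply Cmod_gt_0. now apply slit_nz. Qed.

Lemma Carg_bound (z : C) : - PI < Carg z < PI.
Proof. unfold Carg. assert (H := atan_bound (snd z / (Cmod z + fst z))). lra. Qed.

(** By the half-angle formulas, since [Carg] is twice an arctangent. *)
Lemma Cexp_Clog (z : C) : slit z -> Cexp (Clog z) = z.
Proof.
  intros Hs. assert (Hz := slit_nz z Hs). assert (E := Cmod_sqr z).
  unfold slit in Hs.
  unfold Clog, Carg, Cexp. simpl. rewrite exp_ln by assumption.
  set (r := Cmod z) in *. set (x := fst z) in *. set (y := snd z) in *.
  rewrite sin_2a, cos_2a, sin_atan, cos_atan.
  set (t := (y / (r + x))%R).
  assert (Ht : (1 + Rsqr t = 2 * r / (r + x))%R).
  { unfold t, Rsqr.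
    replace (1 + y / (r + x) * (y / (r + x)))%R
      with (1 + (r * r - x * x) / ((r + x) * (r + x)))%R.
    - field. lra.
    - replace (r * r - x * x)%R with (y * y)%R by lra. field. lra. }
  assert (Hp : 0 < 1 + Rsqr t) by (assert (K := Rle_0_sqr t); lra).
  assert (S : (sqrt (1 + Rsqr t) * sqrt (1 + Rsqr t) = 2 * r / (r + x))%R)
    by (rewrite sqrt_sqrt; lra).
  assert (Sp := sqrt_lt_R0 _ Hp).
  set (q := sqrt (1 + Rsqr t)) in *.
  assert (Sq : (/ q * / q = (r + x) / (2 * r))%R).
  { rewrite <- Rinv_mult, S. field. lra. }
  apply C_eq; simpl.
  - replace (r * (1 / q * (1 / q) - t / q * (t / q)))%R
      with (r * ((/ q * / q) * (1 - t * t)))%R by (field; lra).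
    rewrite Sq. fold x.
    replace (1 - t * t)%R with (2 - (1 + Rsqr t))%R by (unfold Rsqr; ring).
    rewrite Ht. field; lra.
  - replace (r * (2 * (t / q) * (1 / q)))%R with (r * 2 * t * (/ q * / q))%R by (field; lra).
    rewrite Sq. fold y. unfold t. field; lra.
Qed.

Lemma Carg_polar (r th : R) : 0 < r -> - PI < th < PI ->
  Carg (r * cos th, r * sin th)%R = th.
Proof.
  intros Hr Ht. unfold Carg, Cmod. simpl.
  assert (H := sin2_cos2 th). unfold Rsqr in H.
  replace (r * cos th * (r * cos th * 1) + r * sin th * (r * sin th * 1))%R with (r * r)%R by
    (transitivity (r * r * (sin th * sin th + cos th * cos th))%R; [rewrite H; ring | ring]).
  rewrite sqrt_square by lra.
  assert (Hc : 0 < cos (th / 2)) by (apply cos_gt_0; lra).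
  assert (H2 := sin2_cos2 (th / 2)). unfold Rsqr in H2.
  assert (E1 : sin th = (2 * sin (th / 2) * cos (th / 2))%R)
    by (rewrite <- sin_2a; f_equal; field).
  assert (E2 : cos th = (2 * cos (th / 2) * cos (th / 2) - 1)%R)
    by (rewrite <- cos_2a_cos; f_equal; field).
  replace (r * sin th / (r + r * cos th))%R with (tan (th / 2)).
  - rewrite atan_tan; [field | lra].
  - assert (0 < r * (cos (th / 2) * cos (th / 2))) by (apply Rmult_lt_0_compat; nra).
    unfold tan. rewrite E1, E2. field. split; intro Z; nra.
Qed.

Lemma Clog_Cexp (z : C) : - PI < snd z < PI -> Clog (Cexp z) = z.
Proof.
  intros H. unfold Clog. rewrite Cexp_mod, ln_exp. unfold Cexp.
  rewrite Carg_polar; auto. 2: apply exp_pos. now destruct z.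
Qed.

Lemma Cexp_slit (z : C) : - PI < snd z < PI -> slit (Cexp z).
Proof.
  intros H. unfold slit. rewrite Cexp_mod. unfold Cexp. simpl.
  assert (Hp := exp_pos (fst z)).
  assert (Hc : 0 < cos (snd z / 2)) by (apply cos_gt_0; lra).
  assert (E2 : cos (snd z) = (2 * cos (snd z / 2) * cos (snd z / 2) - 1)%R)
    by (rewrite <- cos_2a_cos; f_equal; field).
  assert (0 < exp (fst z) * (cos (snd z / 2) * cos (snd z / 2))) by (apply Rmult_lt_0_compat; nra).
  rewrite E2. nra.
Qed.

Lemma Carg_half (z : C) : 0 < fst z -> - PI / 2 < Carg z < PI / 2.
Proof.
  intros H. unfold Carg.
  assert (K := Cmod_ge_0 z). assert (I := im_le_Cmod z).
  assert (A : Rabs (snd z / (Cmod z + fst z)) < 1).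
  { unfold Rdiv. rewrite Rabs_mult, (Rabs_pos_eq (/ _)).
    2: left; apply Rinv_0_lt_compat; lra.
    apply (Rmult_lt_reg_r (Cmod z + fst z)); [lra|].
    rewrite Rmult_assoc, Rinv_l; lra. }
  apply Rabs_def2 in A.
  assert (B1 := atan_increasing _ _ (proj2 A)). assert (B2 := atan_increasing _ _ (proj1 A)).
  rewrite atan_opp, atan_1 in B1. rewrite atan_1 in B2. lra.
Qed.

Lemma Clog_mult (a b : C) : slit a -> slit b ->
  - PI < Carg a + Carg b < PI -> Clog (a * b) = Clog a + Clog b.
Proof.
  intros Ha Hb H. rewrite <- (Cexp_Clog a) at 1 by auto.
  rewrite <- (Cexp_Clog b) at 1 by auto.
  rewrite <- Cexp_plus. apply Clog_Cexp. exact H.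
Qed.

Lemma Clog_real (x : R) : 0 < x -> Clog x = ln x.
Proof.
  intros H. transitivity (Clog (Cexp (ln x))).
  - rewrite Cexp_real, exp_ln; auto.
  - apply Clog_Cexp. simpl. assert (K := PI_RGT_0). lra.
Qed.

Lemma Clog_conj (z : C) : Clog (Cconj z) = Cconj (Clog z).
Proof.
  unfold Clog. apply C_eq.
  - simpl. now rewrite Cmod_conj.
  - simpl. unfold Carg. rewrite Cmod_conj. simpl.
    unfold Rdiv. rewrite Ropp_mult_distr_l_reverse, atan_opp. ring.
Qed.

Lemma Cpower_conj (z a : C) : Cpower (Cconj z) (Cconj a) = Cconj (Cpower z a).
Proof. unfold Cpower. rewrite Clog_conj, <- Cmult_conj. apply Cexp_conj. Qed.

Lemma Cpower_mod (z a : C) :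
  Cmod (Cpower z a) = exp (fst a * ln (Cmod z) - snd a * Carg z).
Proof. unfold Cpower. rewrite Cexp_mod. reflexivity. Qed.

Lemma Cpower_plus (z a b : C) : Cpower z (a + b) = Cpower z a * Cpower z b.
Proof. unfold Cpower. rewrite <- Cexp_plus. f_equal. ring. Qed.

Lemma Cpower_nz (z a : C) : Cpower z a <> 0.
Proof. apply Cexp_nz. Qed.

Lemma Cpower_1 (z : C) : slit z -> Cpower z 1 = z.
Proof. intros H. unfold Cpower. rewrite Cmult_1_l. now apply Cexp_Clog. Qed.

Lemma Cpower_nat (z : C) (n : nat) : slit z -> Cpower z (INR n) = z ^ n.
Proof. intros H. unfold Cpower. rewrite Cexp_nat, Cexp_Clog; auto. Qed.

Lemma Cpower_1_l (a : C) : Cpower 1 a = 1.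
Proof.
  unfold Cpower. rewrite Clog_real by lra. rewrite ln_1, Cmult_0_r. apply Cexp_0.
Qed.

Lemma Cpower_opp (z a : C) : Cpower z (- a) = / Cpower z a.
Proof. unfold Cpower. rewrite <- Cexp_opp. f_equal. ring. Qed.

(** * Complex differentiability *)

Lemma locally_Ceps (z : C) (P : C -> Prop) :
  locally z P <-> exists d : R, 0 < d /\ forall w, Cmod (w - z) < d -> P w.
Proof.
  split.
  - intros [e He]. exists e. split; [apply cond_pos|].
    intros w Hw. apply He. apply (C_NormedModule_mixin_compat1 z w e). exact Hw.
  - intros [d [Hd H]].
    assert (Hq : 0 < sqrt 2) by (apply sqrt_lt_R0; lra).
    exists (mkposreal (d / sqrt 2) (Rdiv_lt_0_compat _ _ Hd Hq)).
    intros w Hw. apply H.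
    assert (K := C_NormedModule_mixin_compat2 z w _ Hw). simpl in K.
    replace (sqrt 2 * (d / sqrt 2))%R with d in K by (field; lra). exact K.
Qed.

Lemma filterlim_C {T} (F : (T -> Prop) -> Prop) {FF : Filter F} (f : T -> C) (l : C) :
  filterlim f F (locally l) <->
  forall e : R, 0 < e -> F (fun x => (Cmod (f x - l) < e)).
Proof.
  split.
  - intros H e He. apply (H (fun w => (Cmod (w - l) < e))).
    apply locally_Ceps. exists e. auto.
  - intros H P HP. apply locally_Ceps in HP. destruct HP as [d [Hd HP]].
    unfold filtermap. generalize (H d Hd). apply filter_imp. auto.
Qed.

Lemma locally'_C (z : C) (P : C -> Prop) :
  locally' z P <->
  exists d : R, 0 < d /\ forall w, Cmod (w - z) < d -> w <> z -> P w.
Proof. unfold locally', within. apply locally_Ceps. Qed.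

Lemma continuous_Ceps {U : UniformSpace} (f : U -> C) (x : U) :
  continuous f x <->
  forall e : R, 0 < e -> locally x (fun y => (Cmod (f y - f x) < e)).
Proof. apply filterlim_C. apply locally_filter. Qed.

Lemma continuous_C_iff (f : C -> C) (z : C) :
  continuous f z <-> forall e : R, 0 < e -> exists d : R, 0 < d /\
    forall w, Cmod (w - z) < d -> Cmod (f w - f z) < e.
Proof.
  rewrite continuous_Ceps.
  split; intros H e He; specialize (H e He); now apply locally_Ceps.
Qed.

Lemma continuous_Cplus {U : UniformSpace} (f g : U -> C) (x : U) :
  continuous f x -> continuous g x -> continuous (fun y => f y + g y) x.
Proof. intros Hf Hg. apply (@continuous_plus U R_AbsRing C_R_NormedModule f g x Hf Hg). Qed.

Lemma continuous_Cext {U : UniformSpace} (f g : U -> C) (x : U) :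
  (forall y, f y = g y) -> continuous f x -> continuous g x.
Proof. intros H K. now apply (continuous_ext f g). Qed.

Lemma continuous_Copp {U : UniformSpace} (f : U -> C) (x : U) :
  continuous f x -> continuous (fun y => - f y) x.
Proof. intros Hf. apply (@continuous_opp U R_AbsRing C_R_NormedModule f x Hf). Qed.

Lemma continuous_Cminus {U : UniformSpace} (f g : U -> C) (x : U) :
  continuous f x -> continuous g x -> continuous (fun y => f y - g y) x.
Proof. intros Hf Hg. apply continuous_Cplus; auto. now apply continuous_Copp. Qed.

Lemma continuous_Cconst {U : UniformSpace} (c : C) (x : U) :
  continuous (fun _ : U => c) x.
Proof. apply (@continuous_const U C_UniformSpace). Qed.

Lemma locally_Rabs (x e : R) : 0 < e -> locally x (fun y : R => (Rabs (y - x) < e)).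
Proof. intros He. exists (mkposreal e He). intros y Hy. exact Hy. Qed.

Lemma continuous_Reps {U : UniformSpace} (f : U -> R) (x : U) (e : R) :
  continuous f x -> 0 < e -> locally x (fun y => (Rabs (f y - f x) < e)).
Proof. intros H He. apply (H _ (locally_Rabs (f x) e He)). Qed.

Lemma continuous_RtoC {U : UniformSpace} (f : U -> R) (x : U) :
  continuous f x -> continuous (fun t => RtoC (f t)) x.
Proof.
  intros H. rewrite continuous_Ceps. intros e He.
  generalize (continuous_Reps f x e H He). apply filter_imp.
  intros y Hy. rewrite <- RtoC_minus, Cmod_R. exact Hy.
Qed.

Lemma continuous_pair {U : UniformSpace} (f g : U -> R) (x : U) :
  continuous f x -> continuous g x -> continuous (fun y => (f y, g y) : C) x.
Proof.
  intros Hf Hg. rewrite continuous_Ceps. intros e He.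
  assert (He2 : 0 < e / 2) by lra.
  assert (Kf := continuous_Reps f x _ Hf He2).
  assert (Kg := continuous_Reps g x _ Hg He2).
  generalize (filter_and _ _ Kf Kg). apply filter_imp. intros y [H1 H2].
  eapply Rle_lt_trans; [apply Cmod_le_sum|]. simpl. unfold Rminus in *. lra.
Qed.

Lemma continuous_Cfst {U : UniformSpace} (f : U -> C) (x : U) :
  continuous f x -> continuous (fun y => fst (f y)) x.
Proof.
  intros H. apply (continuous_comp f (fun z : C => fst z)); auto.
  apply continuous_fst.
Qed.

Lemma continuous_Csnd {U : UniformSpace} (f : U -> C) (x : U) :
  continuous f x -> continuous (fun y => snd (f y)) x.
Proof.
  intros H. apply (continuous_comp f (fun z : C => snd z)); auto.
  apply continuous_snd.
Qed.

Lemma continuous_Cmult {U : UniformSpace} (f g : U -> C) (x : U) :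
  continuous f x -> continuous g x -> continuous (fun y => f y * g y) x.
Proof.
  intros Hf Hg. assert (F1 := continuous_Cfst f x Hf). assert (F2 := continuous_Csnd f x Hf).
  assert (G1 := continuous_Cfst g x Hg). assert (G2 := continuous_Csnd g x Hg).
  apply (continuous_pair (fun y => fst (f y) * fst (g y) - snd (f y) * snd (g y))%R
    (fun y => fst (f y) * snd (g y) + snd (f y) * fst (g y))%R).
  - apply (@continuous_minus U R_AbsRing R_NormedModule); now apply (@continuous_mult U R_AbsRing).
  - apply (@continuous_plus U R_AbsRing R_NormedModule); now apply (@continuous_mult U R_AbsRing).
Qed.

Lemma continuous_Cmod {U : UniformSpace} (f : U -> C) (x : U) :
  continuous f x -> continuous (fun y => Cmod (f y)) x.
Proof.
  rewrite continuous_Ceps. intros H P [e HP]. unfold filtermap. generalize (H e (cond_pos e)).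
  apply filter_imp. intros y Hy. apply HP.
  unfold ball; simpl. unfold AbsRing_ball, abs, minus, plus, opp; simpl.
  eapply Rle_lt_trans; [|exact Hy].
  assert (A := Cmod_triangle (f y - f x) (f x)).
  assert (B := Cmod_triangle (- (f y - f x)) (f y)).
  rewrite Cmod_opp in B.
  replace (f y - f x + f x) with (f y) in A by ring.
  replace (- (f y - f x) + f y) with (f x) in B by ring.
  apply Rabs_le. lra.
Qed.

(** The normed module is the field itself, whose balls are those of [Cmod]; the product and chain
    rules hold for this structure. *)
Definition cderiv (f : C -> C) (z l : C) : Prop :=
  @is_derive C_AbsRing (AbsRing_NormedModule C_AbsRing) f z l.

Lemma cderiv_iff (f : C -> C) (z l : C) : cderiv f z l <->
  forall e : R, 0 < e -> exists d : R, 0 < d /\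
    forall h : C, Cmod h < d -> Cmod (f (z + h)%C - f z - h * l) <= e * Cmod h.
Proof.
  split.
  - intros [_ H] e He. destruct (H z (fun P HP => HP) (mkposreal e He)) as [d K].
    exists d. split; [apply cond_pos|]. intros h Hh. specialize (K (z + h)).
    change (Cmod (z + h - z) < d ->
      Cmod (f (z + h) - f z - (z + h - z) * l) <= e * Cmod (z + h - z)) in K.
    replace (z + h - z) with h in K by ring. auto.
  - intros H. split; [apply is_linear_scal_l|]. intros x Hx.
    rewrite <- (@is_filter_lim_locally_unique C_AbsRing (AbsRing_NormedModule C_AbsRing) z x Hx). intros e.
    destruct (H e (cond_pos e)) as [d [Hd K]]. exists (mkposreal d Hd). intros w Hw.
    specialize (K (Cminus w z) Hw). assert (E : forall u : C, z + (u - z) = u) by (intros; ring).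
    rewrite (E w) in K. exact K.
Qed.

(** Continuity of the derivative is part of the notion: the proof of [star_primitive] integrates
    the derivative. *)
Definition hol (f : C -> C) (z : C) : Prop :=
  exists f' : C -> C, locally z (fun w => cderiv f w (f' w)) /\ continuous f' z.

Lemma cderiv_bound f z l : cderiv f z l -> exists d, 0 < d /\
  forall h, Cmod h < d -> Cmod (f (z + h)%C - f z) <= (Cmod l + 1) * Cmod h.
Proof.
  rewrite cderiv_iff. intros H. destruct (H 1%R) as [d [Hd K]]; [lra|].
  exists d. split; auto. intros h Hh. specialize (K h Hh).
  replace (f (z + h)%C - f z) with ((f (z + h)%C - f z - h * l) + h * l) by ring.
  eapply Rle_trans; [apply Cmod_triangle|]. rewrite Cmod_mult. lra.
Qed.

Lemma cderiv_continuous f z l : cderiv f z l -> continuous f z.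
Proof.
  intros H. apply continuous_C_iff. intros e He.
  destruct (cderiv_bound f z l H) as [d [Hd K]].
  assert (HA : 0 < Cmod l + 1) by (assert (Q := Cmod_ge_0 l); lra).
  exists (Rmin d (e / (Cmod l + 1))). split.
  - apply Rmin_glb_lt; auto. now apply Rdiv_lt_0_compat.
  - intros w Hw. assert (Q1 := Rmin_l d (e / (Cmod l + 1))).
    assert (Q2 := Rmin_r d (e / (Cmod l + 1))).
    replace w with (z + (w - z)) by ring.
    eapply Rle_lt_trans; [apply K; lra|].
    apply Rlt_le_trans with ((Cmod l + 1) * (e / (Cmod l + 1)))%R.
    + apply Rmult_lt_compat_l; lra.
    + right. field. lra.
Qed.

Lemma cderiv_unique f z l m : cderiv f z l -> cderiv f z m -> l = m.
Proof.
  rewrite !cderiv_iff. intros H1 H2. apply C_eq_eps. intros e He.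
  destruct (H1 (e / 2)%R) as [d1 [D1 K1]]; [lra|].
  destruct (H2 (e / 2)%R) as [d2 [D2 K2]]; [lra|].
  set (h := (Rmin d1 d2 / 2)%R).
  assert (Q1 := Rmin_l d1 d2). assert (Q2 := Rmin_r d1 d2).
  assert (Hh : 0 < h) by (unfold h; assert (0 < Rmin d1 d2) by (apply Rmin_glb_lt; auto); lra).
  assert (Hh2 : h <= Rmin d1 d2 / 2) by (unfold h; lra).
  assert (E : Cmod (RtoC h) = h) by (rewrite Cmod_R; apply Rabs_pos_eq; lra).
  specialize (K1 h). specialize (K2 h). rewrite E in K1, K2.
  assert (K1' := K1 ltac:(lra)). assert (K2' := K2 ltac:(lra)).
  assert (K : h * Cmod (l - m) <= h * e).
  { rewrite <- E at 1. rewrite <- Cmod_mult.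
    replace (h * (l - m)) with ((f (z + h)%C - f z - h * m) - (f (z + h)%C - f z - h * l)) by ring.
    eapply Rle_trans; [apply Cmod_triangle'|]. lra. }
  apply Rmult_le_reg_l in K; lra.
Qed.

Lemma cderiv_ext_loc f g z l :
  locally z (fun w => f w = g w) -> cderiv f z l -> cderiv g z l.
Proof.
  intros H. apply is_derive_ext_loc. apply locally_Ceps in H. destruct H as [d [Hd H]].
  exists (mkposreal d Hd). exact H.
Qed.

Lemma cderiv_eq f z l m : cderiv f z l -> l = m -> cderiv f z m.
Proof. now intros H <-. Qed.

Lemma cderiv_const c z : cderiv (fun _ => c) z 0.
Proof. apply (@is_derive_const C_AbsRing (AbsRing_NormedModule C_AbsRing)). Qed.

Lemma cderiv_id z : cderiv (fun w => w) z 1.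
Proof. apply (@is_derive_id C_AbsRing). Qed.

Lemma cderiv_plus f g z l m :
  cderiv f z l -> cderiv g z m -> cderiv (fun w => f w + g w) z (l + m).
Proof. apply (@is_derive_plus C_AbsRing (AbsRing_NormedModule C_AbsRing)). Qed.

Lemma cderiv_mult f g z l m :
  cderiv f z l -> cderiv g z m -> cderiv (fun w => f w * g w) z (l * g z + f z * m).
Proof. intros H K. apply (@is_derive_mult C_AbsRing f g z l m H K). exact Cmult_comm. Qed.

Lemma cderiv_comp f g z l m :
  cderiv f (g z) l -> cderiv g z m -> cderiv (fun w => f (g w)) z (m * l).
Proof. apply (@is_derive_comp C_AbsRing (AbsRing_NormedModule C_AbsRing)). Qed.

Lemma cderiv_opp f z l : cderiv f z l -> cderiv (fun w => - f w) z (- l).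
Proof. apply (@is_derive_opp C_AbsRing (AbsRing_NormedModule C_AbsRing)). Qed.

Lemma cderiv_minus f g z l m :
  cderiv f z l -> cderiv g z m -> cderiv (fun w => f w - g w) z (l - m).
Proof. intros. apply cderiv_plus; auto. now apply cderiv_opp. Qed.

Lemma cderiv_cmul c f z l : cderiv f z l -> cderiv (fun w => c * f w) z (c * l).
Proof.
  intros H. eapply cderiv_eq; [apply cderiv_mult; [apply cderiv_const|exact H]|]. cbv beta. ring.
Qed.

Lemma cderiv_inv_id (z : C) : z <> 0 -> cderiv (fun w => / w) z (- / (z * z)).
Proof.
  intros Hz. apply cderiv_iff. intros e He. assert (Hm := proj1 (Cmod_gt_0 z) Hz). set (r := Cmod z) in *.
  exists (Rmin (r / 2) (e * r * r * r / 2)). split.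
  - apply Rmin_glb_lt; [lra|]. assert (0 < e * r * r * r) by (repeat apply Rmult_lt_0_compat; auto). lra.
  - intros h Hh.
    assert (H1 := Rlt_le_trans _ _ _ Hh (Rmin_l _ _)).
    assert (H2 := Rlt_le_trans _ _ _ Hh (Rmin_r _ _)).
    assert (Hzh : r / 2 <= Cmod (z + h)%C).
    { assert (K := Cmod_triangle_rev z h). fold r in K. lra. }
    assert (Hzh0 : z + h <> 0) by (apply Cmod_gt_0; lra).
    replace (_ - _) with (h * h / ((z + h) * (z * z))) by (field; auto).
    assert (Hzz : (z + h) * (z * z) <> 0) by (repeat apply Cmult_neq_0; auto).
    rewrite Cmod_div, !Cmod_mult by assumption. fold r.
    assert (T := Cmod_ge_0 h). set (x := Cmod h) in *. set (y := Cmod (z + h)) in *.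
    assert (P : 0 < y * (r * r)) by (apply Rmult_lt_0_compat; nra).
    apply (Rmult_le_reg_r (y * (r * r))); [assumption|].
    unfold Rdiv. rewrite Rmult_assoc, Rinv_l by lra.
    assert (e * r * r * r / 2 <= e * (y * (r * r))).
    { replace (e * r * r * r / 2)%R with (e * (r / 2 * (r * r)))%R by field.
      apply Rmult_le_compat_l; [lra|]. apply Rmult_le_compat_r; nra. }
    nra.
Qed.

Lemma exp_ge_1_plus (x : R) : 1 + x <= exp x.
Proof.
  destruct (Req_dec x 0) as [->|H]; [rewrite exp_0; lra|].
  left. apply exp_ineq1. auto.
Qed.

Lemma mean_value_bound (f f' : R -> R) (M : R) :
  (forall t, 0 <= t <= 1 -> is_derive f t (f' t) /\ Rabs (f' t) <= M)%R -> Rabs (f 1 - f 0) <= M.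
Proof.
  intros H. destruct (MVT_gen f 0 1 f') as [c [Hc E]];
    try (intros x Hx; rewrite Rmin_left, Rmax_right in Hx by lra).
  - apply H. lra.
  - apply continuity_pt_filterlim, (@ex_derive_continuous R_AbsRing R_NormedModule f x).
    eexists. apply H. lra.
  - rewrite Rmin_left, Rmax_right in Hc by lra. rewrite E, Rminus_0_r, Rmult_1_r. now apply H.
Qed.

(** The factor two is the price for treating the two components separately. *)
Lemma C_mean_value (f f' : R -> C) (M : R) :
  (forall t, 0 <= t <= 1 -> is_derive (fun t => fst (f t)) t (fst (f' t)) /\
     is_derive (fun t => snd (f t)) t (snd (f' t)) /\ Cmod (f' t) <= M)%R ->
  Cmod (f 1%R - f 0%R) <= 2 * M.
Proof.
  intros H. eapply Rle_trans; [apply Cmod_le_sum|]. replace (2 * M)%R with (M + M)%R by ring.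
  apply Rplus_le_compat.
  - apply (mean_value_bound (fun t => fst (f t)) (fun t => fst (f' t))). intros t Ht.
    destruct (H t Ht) as [H1 [_ H3]]. split; [exact H1|]. eapply Rle_trans; [apply fst_le_Cmod|exact H3].
  - apply (mean_value_bound (fun t => snd (f t)) (fun t => snd (f' t))). intros t Ht.
    destruct (H t Ht) as [_ [H2 H3]]. split; [exact H2|]. eapply Rle_trans; [apply im_le_Cmod|exact H3].
Qed.

Lemma exp_le_of_fst (z : C) (t : R) : 0 <= t <= 1 ->
  Cmod (Cexp (t * z)) <= exp (Cmod z).
Proof.
  intros H. rewrite Cexp_mod. simpl.
  assert (K := fst_le_Cmod z). assert (K2 := Rle_abs (fst z)).
  assert (K3 := Cmod_ge_0 z).
  assert (t * fst z - 0 * snd z <= Cmod z) by nra.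
  destruct H0 as [H0|H0]; [left; now apply exp_increasing|right; now rewrite H0].
Qed.

(** Each remainder is the integral of the preceding one, so the mean value inequality bounds them
    in turn. *)
Lemma Cexp_taylor1 (z : C) : Cmod (Cexp z - 1) <= 2 * (Cmod z * exp (Cmod z)).
Proof.
  assert (K := C_mean_value (fun t => Cexp (t * z)) (fun t => z * Cexp (t * z))
    (Cmod z * exp (Cmod z))).
  simpl in K. rewrite Cmult_1_l, Cmult_0_l, Cexp_0 in K.
  apply K. intros t Ht. split; [|split].
  - unfold Cexp; simpl. auto_derive; auto. unfold Rminus. ring.
  - unfold Cexp; simpl. auto_derive; auto. unfold Rminus. ring.
  - rewrite Cmod_mult. apply Rmult_le_compat_l; [apply Cmod_ge_0|]. now apply exp_le_of_fst.
Qed.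

Lemma Cmod_tz (t : R) (z : C) : 0 <= t <= 1 -> Cmod (t * z) <= Cmod z.
Proof.
  intros H. rewrite Cmod_mult, Cmod_R, Rabs_pos_eq by lra.
  assert (K := Cmod_ge_0 z). nra.
Qed.

Lemma exp_mono (x y : R) : x <= y -> exp x <= exp y.
Proof. intros [H|H]; [left; now apply exp_increasing|right; now rewrite H]. Qed.

Lemma Cexp_taylor2 (z : C) :
  Cmod (Cexp z - 1 - z) <= 4 * (Cmod z ^ 2 * exp (Cmod z)).
Proof.
  assert (K := C_mean_value (fun t => Cexp (t * z) - 1 - t * z)
    (fun t => z * (Cexp (t * z) - 1)) (2 * (Cmod z ^ 2 * exp (Cmod z)))).
  replace (Cexp z - 1 - z) with
    ((fun t : R => Cexp (t * z) - 1 - t * z) 1%R - (fun t : R => Cexp (t * z) - 1 - t * z) 0%R).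
  - eapply Rle_trans; [apply K|right; ring]. intros t Ht. split; [|split].
    + unfold Cexp; simpl. auto_derive; auto. unfold Rminus. ring.
    + unfold Cexp; simpl. auto_derive; auto. unfold Rminus. ring.
    + rewrite Cmod_mult. eapply Rle_trans.
      * apply Rmult_le_compat_l; [apply Cmod_ge_0|apply Cexp_taylor1].
      * assert (Q := Cmod_tz t z Ht). assert (Q2 := exp_mono _ _ Q).
        assert (Z0 := Cmod_ge_0 z). assert (Z1 := Cmod_ge_0 (t * z)).
        assert (E1 := exp_pos (Cmod (t * z))).
        assert (A := Rmult_le_compat _ _ _ _ Z1 (Rlt_le _ _ E1) Q Q2).
        assert (B := Rmult_le_compat_l _ _ _ Z0 A). simpl. lra.
  - rewrite !Cmult_0_l, Cmult_1_l, Cexp_0. ring.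
Qed.

Lemma Cexp_taylor3 (z : C) :
  Cmod (Cexp z - 1 - z - z * z / 2) <= 8 * (Cmod z ^ 3 * exp (Cmod z)).
Proof.
  assert (K := C_mean_value (fun t => Cexp (t * z) - 1 - t * z - t * t * (z * z / 2))
    (fun t => z * (Cexp (t * z) - 1 - t * z)) (4 * (Cmod z ^ 3 * exp (Cmod z)))).
  replace (Cexp z - 1 - z - z * z / 2) with
    ((fun t : R => Cexp (t * z) - 1 - t * z - t * t * (z * z / 2)) 1%R
     - (fun t : R => Cexp (t * z) - 1 - t * z - t * t * (z * z / 2)) 0%R).
  - eapply Rle_trans; [apply K|right; ring]. intros t Ht. split; [|split].
    + unfold Cexp; simpl. auto_derive; auto. unfold Rminus. field.
    + unfold Cexp; simpl. auto_derive; auto. unfold Rminus. field.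
    + rewrite Cmod_mult. eapply Rle_trans.
      * apply Rmult_le_compat_l; [apply Cmod_ge_0|apply Cexp_taylor2].
      * assert (Q := Cmod_tz t z Ht). assert (Q2 := exp_mono _ _ Q).
        assert (Z0 := Cmod_ge_0 z). assert (Z1 := Cmod_ge_0 (t * z)).
        assert (Q3 := pow_incr _ _ 2 (conj Z1 Q)).
        assert (E1 := exp_pos (Cmod (t * z))).
        assert (A := Rmult_le_compat _ _ _ _ (pow_le _ 2 Z1) (Rlt_le _ _ E1) Q3 Q2).
        assert (B := Rmult_le_compat_l _ _ _ Z0 A). simpl in *. lra.
  - cbv beta. rewrite !Cmult_0_l, !Cmult_1_l, Cexp_0. field.
Qed.

Lemma norm_CR (z : C) : @norm R_AbsRing C_R_NormedModule z = Cmod z.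
Proof.
  unfold norm. simpl. unfold prod_norm. simpl. unfold norm. simpl.
  unfold Cmod. unfold abs; simpl. f_equal.
  assert (A := pow2_abs (fst z)). assert (B := pow2_abs (snd z)). simpl in A, B. lra.
Qed.

Lemma cderiv_ex_derive (f : C -> C) (z l : C) :
  cderiv f z l -> @is_derive C_AbsRing C_NormedModule f z l.
Proof.
  rewrite cderiv_iff. intros H. split; [apply is_linear_scal_l|].
  intros x Hx. assert (Ex := @is_filter_lim_locally_unique C_AbsRing (AbsRing_NormedModule C_AbsRing) z x Hx). subst x.
  intros e. destruct (H e (cond_pos e)) as [d [Hd K]].
  exists (mkposreal d Hd). intros w' Hw. set (w := w' : C).
  specialize (K (w - z) Hw). replace (z + (w - z)) with w in K by ring. exact K.
Qed.

Lemma ex_derive_continuous_C (f : C -> C) (z : C) :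
  @ex_derive C_AbsRing C_NormedModule f z -> continuous f z.
Proof.
  intros [l [_ H]]. specialize (H z (fun P HP => HP) (mkposreal 1 Rlt_0_1)).
  destruct H as [d H]. apply continuous_C_iff. intros e He.
  assert (HA : 0 < Cmod l + 1) by (assert (Q := Cmod_ge_0 l); lra).
  exists (Rmin d (e / (Cmod l + 1))). split.
  - apply Rmin_glb_lt; [apply cond_pos|]. now apply Rdiv_lt_0_compat.
  - intros w Hw. assert (Q1 := Rmin_l d (e / (Cmod l + 1))).
    assert (Q2 := Rmin_r d (e / (Cmod l + 1))).
    assert (Hw1 : Cmod (w - z) < d) by lra.
    assert (K := H w Hw1). simpl in K.
    change (Cmod (f w - f z - (w - z) * l) <= 1 * Cmod (w - z)) in K.
    replace (f w - f z) with ((f w - f z - (w - z) * l) + (w - z) * l) by ring.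
    eapply Rle_lt_trans; [apply Cmod_triangle|]. rewrite Cmod_mult.
    apply Rle_lt_trans with (Cmod (w - z) * (Cmod l + 1))%R; [lra|].
    apply Rlt_le_trans with (e / (Cmod l + 1) * (Cmod l + 1))%R.
    + apply Rmult_lt_compat_r; lra.
    + right; field; lra.
Qed.

Notation rderiv := (@is_derive R_AbsRing C_R_NormedModule).

(** Real differentiability, for the composition with curves. *)
Lemma cderiv_filterdiff (f : C -> C) (z l : C) : cderiv f z l ->
  @filterdiff R_AbsRing C_R_NormedModule C_R_NormedModule f (locally z) (fun h => h * l).
Proof.
  rewrite cderiv_iff. intros H. split.
  - split.
    + intros x y. apply (Cmult_plus_distr_r x y l).
    + intros k x. rewrite !scal_R_Cmult. symmetry. apply Cmult_assoc.
    + exists (Cmod l + 1)%R. assert (P := Cmod_ge_0 l). split; [lra|]. intros x.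
      rewrite !norm_CR, Cmod_mult. assert (Q := Cmod_ge_0 x). nra.
  - intros x Hx. rewrite <- (@is_filter_lim_locally_unique R_AbsRing C_R_NormedModule z x Hx).
    intros e. apply locally_Ceps. destruct (H e (cond_pos e)) as [d [Hd K]].
    exists d. split; auto. intros w Hw. specialize (K (w - z) Hw).
    replace (z + (w - z)) with w in K by ring. rewrite !norm_CR. exact K.
Qed.

Lemma rderiv_comp (f : C -> C) (g : R -> C) (t : R) (l m : C) :
  cderiv f (g t) l -> rderiv g t m -> rderiv (fun x => f (g x)) t (m * l).
Proof.
  intros H K. apply cderiv_filterdiff in H.
  apply (filterdiff_ext_lin _ (fun h : R => scal h m * l)).
  - exact (filterdiff_comp' g f t _ _ K H).
  - intros h. rewrite !scal_R_Cmult. symmetry. apply Cmult_assoc.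
Qed.

Lemma rderiv_eq (g : R -> C) (t : R) (l m : C) : rderiv g t l -> l = m -> rderiv g t m.
Proof. now intros H <-. Qed.

Lemma rderiv_affine (a b : C) (t : R) : rderiv (fun x : R => a + x * b) t b.
Proof.
  apply (is_derive_ext (fun x : R => plus (a : C_R_NormedModule) (scal x (b : C_R_NormedModule)))).
  { intros x. rewrite scal_R_Cmult. reflexivity. }
  apply (rderiv_eq _ _ (plus zero b)); [|apply plus_zero_l].
  apply (@is_derive_plus R_AbsRing C_R_NormedModule); [apply (@is_derive_const R_AbsRing C_R_NormedModule)|].
  apply filterdiff_linear, is_linear_scal_l.
Qed.

Lemma rderiv_RtoC (t : R) : rderiv RtoC t (RtoC 1).
Proof.
  apply (is_derive_ext (fun x : R => 0 + x * 1)); [|apply rderiv_affine].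
  intros x. apply C_eq; simpl; ring.
Qed.

Lemma cderiv_quadratic (f : C -> C) (z l : C) (K d : R) : 0 < d ->
  (forall h, Cmod h < d -> Cmod (f (z + h)%C - f z - h * l) <= K * (Cmod h * Cmod h))%R ->
  cderiv f z l.
Proof.
  intros Hd H. apply cderiv_iff. intros e He.
  assert (P : 0 < Rabs K + 1) by (assert (Q := Rabs_pos K); lra).
  exists (Rmin d (e / (Rabs K + 1))). split.
  - apply Rmin_glb_lt; auto. now apply Rdiv_lt_0_compat.
  - intros h Hh. assert (Q1 := Rlt_le_trans _ _ _ Hh (Rmin_l _ _)).
    assert (Q2 := Rlt_le_trans _ _ _ Hh (Rmin_r _ _)).
    eapply Rle_trans; [now apply H|].
    assert (T := Cmod_ge_0 h). assert (Q3 := Rle_abs K).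
    assert (Q4 : (Rabs K + 1) * Cmod h <= e).
    { apply Rle_trans with ((Rabs K + 1) * (e / (Rabs K + 1)))%R.
      - apply Rmult_le_compat_l; lra.
      - right; field; lra. }
    assert (K * Cmod h <= e) by nra. nra.
Qed.

Lemma cderiv_Cexp (z : C) : cderiv Cexp z (Cexp z).
Proof.
  apply (cderiv_quadratic _ _ _ (exp (fst z) * (4 * exp 1)) 1); [lra|].
  intros h Hh. rewrite Cexp_plus.
  replace (_ - _) with (Cexp z * (Cexp h - 1 - h)) by ring.
  rewrite Cmod_mult, Cexp_mod, Rmult_assoc.
  apply Rmult_le_compat_l; [left; apply exp_pos|].
  eapply Rle_trans; [apply Cexp_taylor2|].
  assert (E := exp_mono (Cmod h) 1 ltac:(lra)).
  assert (T := Cmod_ge_0 h). simpl.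
  assert (T2 : 0 <= Cmod h * Cmod h) by nra.
  assert (T3 := Rmult_le_compat_l _ _ _ T2 E). lra.
Qed.

Lemma continuous_Cexp {U : UniformSpace} (f : U -> C) (x : U) :
  continuous f x -> continuous (fun y => Cexp (f y)) x.
Proof.
  intros H. apply (continuous_comp f Cexp); auto.
  apply (cderiv_continuous _ _ _ (cderiv_Cexp _)).
Qed.

Create HintDb cont.

Ltac solve_cont := cbv beta; first [ assumption |
  lazymatch goal with
  | |- continuous (fun _ => ?c) _ => apply continuous_Cconst
  | |- continuous (fun x => Cplus (@?f x) (@?g x)) _ => apply (continuous_Cplus f g); solve_cont
  | |- continuous (fun x => Cminus (@?f x) (@?g x)) _ => apply (continuous_Cminus f g); solve_cont
  | |- continuous (fun x => Cmult (@?f x) (@?g x)) _ => apply (continuous_Cmult f g); solve_cont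
  | |- continuous (fun x => Copp (@?f x)) _ => apply (continuous_Copp f); solve_cont
  | |- continuous (fun x => Cexp (@?f x)) _ => apply (continuous_Cexp f); solve_cont
  | |- continuous (fun x => RtoC (@?f x)) _ => apply (continuous_RtoC f); solve_cont
  | |- continuous (fun x => x) _ => apply continuous_id
  | |- continuous (fun x => fst x) _ => apply continuous_fst
  | |- continuous (fun x => snd x) _ => apply continuous_snd
  | _ => try solve [auto with cont]
  end ].

Lemma continuous_real_fun {U : UniformSpace} (f : R -> R) (g : U -> R) (x : U) :
  ex_derive f (g x) -> continuous g x -> continuous (fun y => f (g y)) x.
Proof.
  intros H K. apply continuous_comp; auto.
  now apply (@ex_derive_continuous R_AbsRing R_NormedModule).
Qed.

Lemma continuous_Clog (z : C) : slit z -> continuous Clog z.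
Proof.
  intros H. assert (K := slit_nz z H). unfold slit in H.
  apply continuous_pair.
  - apply (continuous_real_fun ln Cmod).
    + auto_derive; auto.
    + apply (continuous_Cmod (fun w : C => w)), continuous_id.
  - unfold Carg.
    apply (continuous_real_fun (fun x => 2 * atan x)%R (fun z : C => snd z / (Cmod z + fst z))%R).
    + auto_derive; auto.
    + apply (@continuous_mult _ R_AbsRing (fun z : C => snd z) (fun z : C => / (Cmod z + fst z))%R).
      * apply (continuous_Csnd (fun w : C => w)), continuous_id.
      * apply (continuous_real_fun Rinv (fun z : C => Cmod z + fst z)%R).
        { auto_derive. lra. }
        apply (@continuous_plus _ R_AbsRing R_NormedModule Cmod (fun z : C => fst z)).
        -- apply (continuous_Cmod (fun w : C => w)), continuous_id.
        -- apply (continuous_Cfst (fun w : C => w)), continuous_id.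
Qed.

Lemma locally_slit (z : C) : slit z -> locally z slit.
Proof.
  intros H.
  assert (K : continuous (fun z : C => Cmod z + fst z)%R z).
  { apply (@continuous_plus _ R_AbsRing R_NormedModule Cmod (fun z : C => fst z)).
    -- apply (continuous_Cmod (fun w : C => w)), continuous_id.
    -- apply (continuous_Cfst (fun w : C => w)), continuous_id. }
  generalize (continuous_Reps _ _ _ K H). apply filter_imp.
  intros w Hw. unfold slit in *. apply Rabs_def2 in Hw. lra.
Qed.

(** With k = Clog (z + h) - Clog z, the quadratic bound of Cexp k - 1 - k and the continuity of the
    logarithm give |k| <= 2 |h / z| first, and then the quadratic bound of k - h / z. *)
Lemma cderiv_Clog (z : C) : slit z -> cderiv Clog z (/ z).
Proof.
  intros Hz. assert (r0 := slit_nz z Hz). assert (z0 := slit_neq z Hz).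
  assert (K := continuous_Clog z Hz). rewrite continuous_C_iff in K.
  destruct (K (/ 24)%R) as [d1 [D1 K1]]; [lra|].
  assert (L := locally_slit z Hz). destruct (proj1 (locally_Ceps z slit) L) as [d2 [D2 K2]].
  apply (cderiv_quadratic _ _ _ (48 * (/ Cmod z * / Cmod z)) (Rmin d1 d2)).
  { now apply Rmin_glb_lt. }
  intros h Hh. assert (Q1 := Rlt_le_trans _ _ _ Hh (Rmin_l _ _)).
  assert (Q2 := Rlt_le_trans _ _ _ Hh (Rmin_r _ _)).
  specialize (K1 (z + h)). specialize (K2 (z + h)).
  replace (z + h - z) with h in K1, K2 by ring.
  specialize (K1 Q1). specialize (K2 Q2).
  set (k := Clog (z + h) - Clog z) in *.
  assert (E : h * / z = Cexp k - 1).
  { unfold k, Cminus. rewrite Cexp_plus, Cexp_opp, !Cexp_Clog by auto. field; auto. }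
  rewrite E. replace (k - (Cexp k - 1)) with (- (Cexp k - 1 - k)) by ring.
  rewrite Cmod_opp.
  assert (T := Cexp_taylor2 k). assert (Tk := Cmod_ge_0 k).
  assert (Ek : exp (Cmod k) <= 3).
  { apply Rle_trans with (exp 1); [apply exp_mono; lra|apply exp_le_3]. }
  assert (B : Cmod k <= 2 * (Cmod h * / Cmod z)).
  { rewrite <- Cmod_inv, <- Cmod_mult, E by auto.
    assert (TT := Cmod_triangle_rev k (Cexp k - 1 - k)).
    replace (k + (Cexp k - 1 - k)) with (Cexp k - 1) in TT by ring.
    assert (Cmod k ^ 2 * exp (Cmod k) <= Cmod k * (/ 24) * 3).
    { simpl. apply Rmult_le_compat; try lra; [nra|left; apply exp_pos|nra]. }
    lra. }
  eapply Rle_trans; [exact T|].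
  assert (Cmod k ^ 2 * exp (Cmod k) <= Cmod k ^ 2 * 3).
  { apply Rmult_le_compat_l; [simpl; nra|auto]. }
  assert (Cmod k ^ 2 <= (2 * (Cmod h * / Cmod z)) ^ 2) by (apply pow_incr; lra).
  simpl in *. lra.
Qed.

Lemma hol_continuous f z : hol f z -> continuous f z.
Proof.
  intros [f' [H _]]. apply locally_singleton in H. eapply cderiv_continuous; eauto.
Qed.

Lemma hol_cderiv f z : hol f z -> exists l, cderiv f z l.
Proof. intros [f' [H _]]. apply locally_singleton in H. eauto. Qed.

Lemma hol_ext_loc f g z : locally z (fun w => f w = g w) -> hol f z -> hol g z.
Proof.
  intros E [f' [H K]]. exists f'. split; auto.
  apply locally_locally in E. generalize (filter_and _ _ E H). apply filter_imp.
  intros w [H1 H2]. now apply (cderiv_ext_loc f g).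
Qed.

Lemma hol_const c z : hol (fun _ => c) z.
Proof.
  exists (fun _ => RtoC 0). split; [|apply continuous_Cconst].
  apply filter_forall. intros. apply cderiv_const.
Qed.

Lemma hol_id z : hol (fun w => w) z.
Proof.
  exists (fun _ => RtoC 1). split; [|apply continuous_Cconst].
  apply filter_forall. intros. apply cderiv_id.
Qed.

Lemma hol_plus f g z : hol f z -> hol g z -> hol (fun w => f w + g w) z.
Proof.
  intros [f' [H1 K1]] [g' [H2 K2]]. exists (fun w => f' w + g' w).
  split; [|now apply continuous_Cplus].
  generalize (filter_and _ _ H1 H2). apply filter_imp. intros w [A B]. now apply cderiv_plus.
Qed.

Lemma hol_mult f g z : hol f z -> hol g z -> hol (fun w => f w * g w) z.
Proof.
  intros Hf Hg. assert (Cf := hol_continuous f z Hf). assert (Cg := hol_continuous g z Hg).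
  destruct Hf as [f' [H1 K1]], Hg as [g' [H2 K2]].
  exists (fun w => f' w * g w + f w * g' w).
  split; [|apply continuous_Cplus; now apply continuous_Cmult].
  generalize (filter_and _ _ H1 H2). apply filter_imp. intros w [A B]. now apply cderiv_mult.
Qed.

Lemma hol_comp f g z : hol g z -> hol f (g z) -> hol (fun w => f (g w)) z.
Proof.
  intros Hg [f' [H1 K1]]. assert (Cg := hol_continuous g z Hg).
  destruct Hg as [g' [H2 K2]].
  exists (fun w => g' w * f' (g w)).
  split.
  - assert (H3 := Cg _ H1). unfold filtermap in H3.
    generalize (filter_and _ _ H3 H2). apply filter_imp. intros w [A B]. now apply cderiv_comp.
  - apply continuous_Cmult; auto. apply (continuous_comp g f'); auto.
Qed.

Lemma hol_Cexp f z : hol f z -> hol (fun w => Cexp (f w)) z.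
Proof.
  intros H. apply (hol_comp Cexp f); auto. exists Cexp. split.
  - apply filter_forall. intros. apply cderiv_Cexp.
  - apply (cderiv_continuous _ _ _ (cderiv_Cexp (f z))).
Qed.

Lemma hol_opp f z : hol f z -> hol (fun w => - f w) z.
Proof.
  intros H. apply hol_ext_loc with (fun w => - (1) * f w).
  - apply filter_forall. intros. ring.
  - apply hol_mult; auto. apply hol_const.
Qed.

Lemma hol_minus f g z : hol f z -> hol g z -> hol (fun w => f w - g w) z.
Proof. intros. apply hol_plus; auto. now apply hol_opp. Qed.

Lemma locally_neq (z a : C) : z <> a -> locally z (fun w => w <> a).
Proof.
  intros H. apply locally_Ceps. exists (Cmod (z - a)). split.
  - apply Cmod_gt_0. intros E. apply H. now apply Ceq_minus.
  - intros w Hw ->. replace (a - z) with (- (z - a)) in Hw by ring.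
    rewrite Cmod_opp in Hw. lra.
Qed.

Lemma hol_inv (f : C -> C) (z : C) : hol f z -> f z <> 0 -> hol (fun w => / f w) z.
Proof.
  intros H Hz. apply (hol_comp Cinv f); auto.
  exists (fun w => - (/ w * / w)). split.
  - generalize (locally_neq _ _ Hz). apply filter_imp. intros w Hw.
    eapply cderiv_eq; [now apply cderiv_inv_id|]. field; auto.
  - assert (K := cderiv_continuous _ _ _ (cderiv_inv_id _ Hz)).
    apply continuous_Copp. now apply continuous_Cmult.
Qed.

Lemma hol_div (f g : C -> C) (z : C) : hol f z -> hol g z -> g z <> 0 -> hol (fun w => f w / g w) z.
Proof. intros. apply hol_mult; auto. now apply hol_inv. Qed.

Lemma hol_Clog f z : hol f z -> slit (f z) -> hol (fun w => Clog (f w)) z.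
Proof.
  intros H Hz. apply (hol_comp Clog f); auto. exists (fun w => / w). split.
  - generalize (locally_slit _ Hz). apply filter_imp. apply cderiv_Clog.
  - apply (cderiv_continuous _ _ _ (cderiv_inv_id _ (slit_neq _ Hz))).
Qed.

Lemma hol_Cpower f a z : hol f z -> slit (f z) -> hol (fun w => Cpower (f w) a) z.
Proof.
  intros. unfold Cpower. apply hol_Cexp. apply hol_mult; [apply hol_const|]. now apply hol_Clog.
Qed.

Lemma hol_Cpower_r a f z : hol f z -> hol (fun w => Cpower a (f w)) z.
Proof.
  intros. unfold Cpower. apply hol_Cexp. apply hol_mult; auto. apply hol_const.
Qed.

Lemma hol_pow f n z : hol f z -> hol (fun w => f w ^ n) z.
Proof.
  intros H. induction n; simpl; [apply hol_const|]. now apply hol_mult.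
Qed.

Lemma hol_holomorphic_near (f : C -> C) (z : C) : hol f z -> holomorphic_near f z.
Proof.
  intros [f' [H _]]. unfold holomorphic_near. revert H. apply filter_imp.
  intros w Hw. exists (f' w). now apply cderiv_ex_derive.
Qed.

Lemma cderiv_Cpower (z a : C) : slit z ->
  cderiv (fun w => Cpower w a) z (a * Cpower z (a - 1)).
Proof.
  intros H. eapply cderiv_eq.
  - apply (cderiv_comp Cexp (fun w => a * Clog w)); [apply cderiv_Cexp|].
    apply cderiv_cmul. now apply cderiv_Clog.
  - fold (Cpower z a). replace a with ((a - 1) + 1) at 2 by ring.
    rewrite Cpower_plus, Cpower_1 by auto. field. now apply slit_neq.
Qed.

(** Unknown functions are left as goals. *)
Ltac cderive := cbv beta; lazymatch goal with
  | |- cderiv (fun _ => ?c) _ _ => apply cderiv_const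
  | |- cderiv (fun x => x) _ _ => apply cderiv_id
  | |- cderiv (fun x => Cplus (@?f x) (@?g x)) _ _ => apply (cderiv_plus f g); cderive
  | |- cderiv (fun x => Cminus (@?f x) (@?g x)) _ _ => apply (cderiv_minus f g); cderive
  | |- cderiv (fun x => Cmult (@?f x) (@?g x)) _ _ => apply (cderiv_mult f g); cderive
  | |- cderiv (fun x => Cdiv (@?f x) ?c) _ _ => apply (cderiv_mult f (fun _ => / c)); cderive
  | |- cderiv (fun x => Cpow (@?f x) 2) _ _ => apply (cderiv_mult f (fun x => f x * 1)); cderive
  | |- cderiv (fun x => Copp (@?f x)) _ _ => apply (cderiv_opp f); cderive
  | |- cderiv (fun x => Cexp (@?f x)) _ _ => apply (cderiv_comp Cexp f); [apply cderiv_Cexp|cderive]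
  | |- cderiv Cexp _ _ => apply cderiv_Cexp
  | _ => idtac
  end.

#[export] Hint Resolve hol_const hol_id hol_plus hol_mult hol_opp hol_minus hol_Cexp hol_div
  hol_inv hol_Cpower hol_Cpower_r hol_pow hol_Clog : hol.

(** * Integrals over bounded intervals *)

Definition RIntC (f : R -> C) (a b : R) : C := @RInt C_R_CompleteNormedModule f a b.

Notation is_RIntC := (@is_RInt C_R_NormedModule).

Notation is_RIntC_unique := (@is_RInt_unique C_R_CompleteNormedModule).

Notation is_RIntC_gen := (@is_RInt_gen C_R_NormedModule).

Definition cont (f : R -> C) : Prop := forall t, continuous f t.

Lemma ex_RIntC (f : R -> C) (a b : R) : cont f -> @ex_RInt C_R_NormedModule f a b.
Proof.
  intros H. apply (@ex_RInt_continuous C_R_CompleteNormedModule). intros. apply H.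
Qed.

Lemma is_RIntC_RInt (f : R -> C) (a b : R) : cont f -> is_RIntC f a b (RIntC f a b).
Proof. intros H. apply (@RInt_correct C_R_CompleteNormedModule). now apply ex_RIntC. Qed.

Lemma RIntC_components (f : R -> C) (a b : R) : cont f ->
  RIntC f a b = (RInt (fun t => fst (f t)) a b, RInt (fun t => snd (f t)) a b).
Proof.
  intros H. apply is_RIntC_unique.
  apply (@is_RInt_fct_extend_pair R_NormedModule R_NormedModule);
    apply (@RInt_correct R_CompleteNormedModule);
    apply (@ex_RInt_continuous R_CompleteNormedModule); intros;
    [apply continuous_Cfst | apply continuous_Csnd]; apply H.
Qed.

Lemma is_RIntC_ext (f g : R -> C) (a b : R) (l : C) :
  (forall t, Rmin a b < t < Rmax a b -> f t = g t)%R -> is_RIntC f a b l -> is_RIntC g a b l.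
Proof. intros H K. now apply (@is_RInt_ext C_R_NormedModule f g). Qed.

Lemma is_RIntC_Cmul (c : C) (f : R -> C) (a b : R) (l : C) :
  is_RIntC f a b l -> is_RIntC (fun t => c * f t) a b (c * l).
Proof.
  intros H.
  assert (H1 := @is_RInt_fct_extend_fst R_NormedModule R_NormedModule f a b l H).
  assert (H2 := @is_RInt_fct_extend_snd R_NormedModule R_NormedModule f a b l H).
  apply (@is_RInt_fct_extend_pair R_NormedModule R_NormedModule); simpl.
  - apply (@is_RInt_minus R_NormedModule); now apply (@is_RInt_scal R_NormedModule).
  - apply (@is_RInt_plus R_NormedModule); now apply (@is_RInt_scal R_NormedModule).
Qed.

Lemma is_RIntC_conj (f : R -> C) (a b : R) (l : C) :
  is_RIntC f a b l -> is_RIntC (fun t => Cconj (f t)) a b (Cconj l).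
Proof.
  intros H.
  assert (H1 := @is_RInt_fct_extend_fst R_NormedModule R_NormedModule f a b l H).
  assert (H2 := @is_RInt_fct_extend_snd R_NormedModule R_NormedModule f a b l H).
  apply (@is_RInt_fct_extend_pair R_NormedModule R_NormedModule); simpl; auto.
  now apply (@is_RInt_opp R_NormedModule).
Qed.

Lemma is_RIntC_derive (F f : R -> C) (a b : R) :
  (forall t, Rmin a b <= t <= Rmax a b -> rderiv F t (f t) /\ continuous f t)%R ->
  is_RIntC f a b (F b - F a).
Proof.
  intros H. apply (@is_RInt_derive C_R_CompleteNormedModule F f a b); intros x Hx; now apply H.
Qed.

Lemma RIntC_norm (f : R -> C) (g : R -> R) (a b lg : R) (l : C) : a <= b ->
  is_RIntC f a b l -> is_RInt g a b lg ->
  (forall t, a <= t <= b -> Cmod (f t) <= g t)%R -> Cmod l <= lg.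
Proof.
  intros Hab Hf Hg H. rewrite <- norm_CR.
  apply (@norm_RInt_le C_R_NormedModule f g a b l lg Hab); auto.
  intros x Hx. rewrite norm_CR. auto.
Qed.

Definition cont2 (f : R -> R -> C) : Prop :=
  forall t y, continuous (fun p : R * R => f (fst p) (snd p)) (t, y).

Lemma cont2_l (f : R -> R -> C) (t : R) : cont2 f -> cont (f t).
Proof.
  intros H y. apply (continuous_comp_2 (fun _ : R => t) (fun y : R => y) f y).
  - apply continuous_const.
  - apply continuous_id.
  - apply H.
Qed.

Lemma cont2_r (f : R -> R -> C) (y : R) : cont2 f -> cont (fun t => f t y).
Proof.
  intros H t. apply (continuous_comp_2 (fun t : R => t) (fun _ : R => y) f t).
  - apply continuous_id.
  - apply continuous_const.
  - apply H.
Qed.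

Lemma continuous_swap (y t : R) : continuous (fun p : R * R => (snd p, fst p)) (y, t).
Proof.
  intros P [e HP]. exists e. intros [u v] [H1 H2]. apply HP. split; assumption.
Qed.

Lemma cont2_swap (f : R -> R -> C) : cont2 f -> cont2 (fun y t => f t y).
Proof.
  intros H y t.
  apply (continuous_comp (fun p : R * R => (snd p, fst p)) (fun p : R * R => f (fst p) (snd p))).
  - apply continuous_swap.
  - apply H.
Qed.

Lemma RInt_param_continuous (f : R -> R -> R) (a b c : R) :
  (forall t y, continuity_2d_pt f t y) ->
  continuous (fun t => RInt (fun y => f t y) a b) c.
Proof.
  intros H.
  assert (Hc : forall t y, continuous (fun y => f t y) y).
  { intros t y. apply (continuous_comp_2 (fun _ : R => t) (fun y : R => y) f y).
    - apply continuous_const.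
    - apply continuous_id.
    - apply (proj1 (continuity_2d_pt_filterlim _ _ _) (H t y)). }
  assert (Hex : forall t a b, ex_RInt (fun y => f t y) a b).
  { intros t a' b'. apply (@ex_RInt_continuous R_CompleteNormedModule). intros; apply Hc. }
  assert (K : forall a b, (a <= b) -> continuous (fun t => RInt (fun y => f t y) a b) c).
  { clear a b. intros a b Hab P [e HP].
    assert (He : 0 < e / (b - a + 1)) by (apply Rdiv_lt_0_compat; [apply cond_pos|lra]).
    destruct (uniform_continuity_2d_1d' f a b c (fun x _ => H c x) (mkposreal _ He)) as [d Hd].
    exists d. intros t Ht. apply HP.
    unfold ball in Ht |- *; simpl in Ht |- *. unfold AbsRing_ball, abs, minus, plus, opp in *; simpl in *.
    replace (RInt (fun y => f t y) a b + - RInt (fun y => f c y) a b)%R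
      with (RInt (fun y => minus (f t y) (f c y)) a b).
    2: { rewrite (@RInt_minus R_CompleteNormedModule); auto. }
    eapply Rle_lt_trans.
    - apply (@norm_RInt_le_const R_NormedModule (fun y => minus (f t y) (f c y)) a b _ (e / (b - a + 1))%R Hab).
      2: { apply (@RInt_correct R_CompleteNormedModule). apply (@ex_RInt_minus R_NormedModule); auto. }
      intros x Hx. left. apply Rabs_def2 in Ht.
      apply (Hd x c x t); try lra. rewrite Rminus_diag. rewrite Rabs_R0. apply cond_pos.
    - apply Rlt_le_trans with ((b - a + 1) * (e / (b - a + 1)))%R.
      + apply Rmult_lt_compat_r; lra.
      + right. field. lra. }
  destruct (Rle_dec a b) as [Hab|Hab]; [now apply K|].
  apply continuous_ext with (fun t => opp (RInt (fun y => f t y) b a)).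
  - intros t. apply opp_RInt_swap. auto.
  - apply (@continuous_opp _ R_AbsRing R_NormedModule). apply K. lra.
Qed.

(** As functions of the upper bound b, both sides vanish at a and have the same derivative. *)
Lemma RInt_fubini (f : R -> R -> R) (a b c d : R) :
  (forall t y, continuity_2d_pt f t y) ->
  RInt (fun t => RInt (fun y => f t y) c d) a b = RInt (fun y => RInt (fun t => f t y) a b) c d.
Proof.
  intros H.
  assert (H' : forall t y, continuity_2d_pt (fun y t => f t y) y t).
  { intros t y. apply continuity_2d_pt_filterlim.
    apply (continuous_comp (fun p : R * R => (snd p, fst p)) (fun p : R * R => f (fst p) (snd p)) (y, t)).
    - apply continuous_swap.
    - apply continuity_2d_pt_filterlim. apply H. }
  assert (Hc2 : forall y t, continuous (fun t => f t y) t).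
  { intros y t. apply (continuous_comp_2 (fun t : R => t) (fun _ : R => y) f t).
    - apply continuous_id.
    - apply continuous_const.
    - apply (proj1 (continuity_2d_pt_filterlim _ _ _) (H t y)). }
  assert (Hex : forall y a b, ex_RInt (fun t => f t y) a b).
  { intros y a' b'. apply (@ex_RInt_continuous R_CompleteNormedModule). intros; apply Hc2. }
  set (g := fun t => RInt (fun y => f t y) c d).
  assert (Hg : forall t, continuous g t) by (intros t; now apply RInt_param_continuous).
  assert (D : forall x y, is_derive (fun z => RInt (fun t => f t y) a z) x (f x y)).
  { intros x y. apply (@is_derive_RInt R_NormedModule (fun t => f t y) _ a).
    - apply filter_forall. intros z. apply (@RInt_correct R_CompleteNormedModule). auto.
    - apply Hc2. }
  apply (@is_RInt_unique R_CompleteNormedModule).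
  set (A := fun x => RInt (fun y => RInt (fun t => f t y) a x) c d).
  replace (RInt (fun y => RInt (fun t => f t y) a b) c d) with (minus (A b) (A a)).
  2: { unfold A. rewrite (RInt_ext (fun y => RInt (fun t => f t y) a a) (fun _ => 0%R)).
       - rewrite RInt_const. unfold minus, plus, opp, scal; simpl. unfold mult; simpl. ring.
       - intros x _. apply (@RInt_point R_CompleteNormedModule). }
  apply (@is_RInt_derive R_CompleteNormedModule); [|intros; apply Hg].
  intros x _. unfold A, g.
  replace (RInt (fun y => f x y) c d) with
    (RInt (fun y => Derive (fun u => RInt (fun t => f t y) a u) x) c d).
  2: { apply RInt_ext. intros y _. apply is_derive_unique. apply D. }
  apply (is_derive_RInt_param (fun x y => RInt (fun t => f t y) a x) c d x).
  - apply filter_forall. intros z y _. eexists. apply D.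
  - intros y _. apply continuity_2d_pt_ext with f; auto.
    intros u v. symmetry. apply is_derive_unique. apply D.
  - apply filter_forall. intros z. apply (@ex_RInt_continuous R_CompleteNormedModule).
    intros y _. apply (RInt_param_continuous (fun y t => f t y)). intros; apply H'.
Qed.

Lemma cont2_fst (f : R -> R -> C) : cont2 f -> forall t y, continuity_2d_pt (fun t y => fst (f t y)) t y.
Proof.
  intros H t y. apply continuity_2d_pt_filterlim.
  apply (continuous_Cfst (fun p : R * R => f (fst p) (snd p))). apply H.
Qed.

Lemma cont2_snd (f : R -> R -> C) : cont2 f -> forall t y, continuity_2d_pt (fun t y => snd (f t y)) t y.
Proof.
  intros H t y. apply continuity_2d_pt_filterlim.
  apply (continuous_Csnd (fun p : R * R => f (fst p) (snd p))). apply H.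
Qed.

Lemma RIntC_param_cont (f : R -> R -> C) (a b : R) :
  cont2 f -> cont (fun t => RIntC (f t) a b).
Proof.
  intros H t.
  apply continuous_ext with
    (fun t => (RInt (fun y => fst (f t y)) a b, RInt (fun y => snd (f t y)) a b) : C).
  - intros x. symmetry. apply RIntC_components. now apply cont2_l.
  - apply continuous_pair.
    + apply (RInt_param_continuous (fun t y => fst (f t y))). now apply cont2_fst.
    + apply (RInt_param_continuous (fun t y => snd (f t y))). now apply cont2_snd.
Qed.

Lemma RIntC_fubini (f : R -> R -> C) (a b c d : R) : cont2 f ->
  RIntC (fun t => RIntC (f t) c d) a b = RIntC (fun y => RIntC (fun t => f t y) a b) c d.
Proof.
  intros H.
  rewrite (RIntC_components (fun t => RIntC (f t) c d)) by now apply RIntC_param_cont.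
  rewrite (RIntC_components (fun y => RIntC (fun t => f t y) a b))
    by (apply (RIntC_param_cont (fun y t => f t y)); now apply cont2_swap).
  f_equal.
  - transitivity (RInt (fun t => RInt (fun y => fst (f t y)) c d) a b).
    { apply RInt_ext. intros x _. rewrite RIntC_components; auto. now apply cont2_l. }
    rewrite (RInt_fubini (fun t y => fst (f t y))) by now apply cont2_fst.
    apply RInt_ext. intros x _. rewrite RIntC_components; auto. now apply cont2_r.
  - transitivity (RInt (fun t => RInt (fun y => snd (f t y)) c d) a b).
    { apply RInt_ext. intros x _. rewrite RIntC_components; auto. now apply cont2_l. }
    rewrite (RInt_fubini (fun t y => snd (f t y))) by now apply cont2_snd.
    apply RInt_ext. intros x _. rewrite RIntC_components; auto. now apply cont2_r.
Qed.

(** * Absolutely convergent integrals over the line *)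

Lemma is_RIntC_gen_derive (F f : R -> C) (Fa Fb : (R -> Prop) -> Prop) (A B : C) :
  Filter Fa -> Filter Fb ->
  filter_prod Fa Fb (fun ab => forall t, Rmin (fst ab) (snd ab) <= t <= Rmax (fst ab) (snd ab) ->
    rderiv F t (f t) /\ continuous f t) ->
  filterlim F Fa (locally A) -> filterlim F Fb (locally B) ->
  is_RIntC_gen f Fa Fb (B - A).
Proof.
  intros HFa HFb H HA HB P HP.
  assert (HL : filterlim (fun ab : R * R => F (snd ab) - F (fst ab)) (filter_prod Fa Fb) (locally (B - A))).
  { rewrite filterlim_C by (apply filter_prod_filter; assumption). intros e He.
    rewrite filterlim_C in HA by auto. rewrite filterlim_C in HB by auto.
    apply (Filter_prod _ _ _ _ _ (HA (e / 2)%R ltac:(lra)) (HB (e / 2)%R ltac:(lra))).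
    intros x y Hx Hy. simpl.
    replace (F y - F x - (B - A)) with ((F y - B) - (F x - A)) by ring.
    eapply Rle_lt_trans; [apply Cmod_triangle'|]. lra. }
  assert (HP2 := HL P HP). unfold filtermap in HP2.
  unfold filtermapi. generalize (filter_and _ _ H HP2). apply filter_imp.
  intros ab [H1 H2]. exists (F (snd ab) - F (fst ab)). split; auto.
  now apply is_RIntC_derive.
Qed.

Definition wt (t : R) : R := (/ (1 + t * t))%R.

Definition dombd (M : R) (f : R -> C) : Prop := forall t, Cmod (f t) <= M * wt t.

(** The integrands over the line are continuous and bounded by a multiple of [wt], whose primitive
    is the arctangent. *)
Definition dom (f : R -> C) : Prop := cont f /\ exists M, dombd M f.

Definition Int (f : R -> C) : C := CRInt_gen f (Rbar_locally m_infty) (Rbar_locally p_infty).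

Lemma wt_pos t : 0 < wt t.
Proof. apply Rinv_0_lt_compat. nra. Qed.

Lemma wt_le_1 t : wt t <= 1.
Proof. unfold wt. rewrite <- Rinv_1. apply Rinv_le_contravar; nra. Qed.

Lemma dombd_pos M f : dombd M f -> 0 <= M.
Proof.
  intros H. specialize (H 0%R). assert (K := Cmod_ge_0 (f 0%R)).
  unfold wt in H. rewrite Rmult_0_r, Rplus_0_r, Rinv_1 in H. lra.
Qed.

Lemma is_RInt_wt (M a b : R) :
  is_RInt (fun t => M * wt t)%R a b (M * (atan b - atan a))%R.
Proof.
  apply (@is_RInt_scal R_NormedModule wt a b M).
  apply (@is_RInt_derive R_CompleteNormedModule atan wt).
  - intros x _. apply is_derive_Reals.
    assert (K := Ratan.derivable_pt_lim_atan x). unfold wt.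
    replace (x * x)%R with (x ^ 2)%R by ring. exact K.
  - intros x _. unfold wt. apply (continuous_real_fun Rinv (fun t => 1 + t * t)%R).
    + auto_derive. nra.
    + apply (@ex_derive_continuous R_AbsRing R_NormedModule). auto_derive. auto.
Qed.

Lemma RIntC_dom_bound (f : R -> C) (M a b : R) : cont f -> dombd M f -> a <= b ->
  Cmod (RIntC f a b) <= M * (atan b - atan a).
Proof.
  intros Hc HM Hab.
  apply (RIntC_norm f (fun t => M * wt t)%R a b); auto.
  - now apply is_RIntC_RInt.
  - apply is_RInt_wt.
Qed.

Lemma RIntC_Chasles (f : R -> C) (a b c : R) : cont f -> RIntC f a b + RIntC f b c = RIntC f a c.
Proof.
  intros H. apply (@RInt_Chasles C_R_CompleteNormedModule f a b c); now apply ex_RIntC.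
Qed.

Lemma RIntC_swap (f : R -> C) (a b : R) : cont f -> RIntC f b a = - RIntC f a b.
Proof.
  intros H. symmetry. apply (@opp_RInt_swap C_R_CompleteNormedModule). now apply ex_RIntC.
Qed.

Lemma RIntC_primitive (f : R -> C) (t : R) : cont f -> rderiv (fun x => RIntC f 0 x) t (f t).
Proof.
  intros H. apply (@is_derive_RInt C_R_NormedModule f _ 0%R).
  - apply filter_forall. intros x. now apply is_RIntC_RInt.
  - apply H.
Qed.

Lemma RIntC_dom_diff (f : R -> C) (M a b : R) : cont f -> dombd M f ->
  Cmod (RIntC f 0 b - RIntC f 0 a) <= M * Rabs (atan b - atan a).
Proof.
  intros Hc HM.
  replace (RIntC f 0 b - RIntC f 0 a) with (RIntC f a b)
    by (rewrite <- (RIntC_Chasles f 0 a b) by auto; ring).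
  destruct (Rle_dec a b) as [Hab|Hab].
  - eapply Rle_trans; [now apply RIntC_dom_bound|].
    apply Rmult_le_compat_l; [now apply dombd_pos with f|]. apply Rle_abs.
  - rewrite RIntC_swap by auto. rewrite Cmod_opp.
    eapply Rle_trans; [apply RIntC_dom_bound; eauto; lra|].
    apply Rmult_le_compat_l; [now apply dombd_pos with f|].
    rewrite Rabs_minus_sym. apply Rle_abs.
Qed.

Lemma atan_p_infty (e : R) : 0 < e -> Rbar_locally p_infty (fun t => (PI / 2 - e < atan t)).
Proof.
  intros He. exists (tan (PI / 2 - Rmin e 1))%R. intros t Ht.
  assert (B := PI_RGT_0). assert (B2 := PI2_1).
  assert (Q1 := Rmin_l e 1). assert (Q2 := Rmin_r e 1).
  assert (0 < Rmin e 1) by (apply Rmin_glb_lt; lra).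
  apply atan_increasing in Ht. rewrite atan_tan in Ht; lra.
Qed.

Lemma atan_m_infty (e : R) : 0 < e -> Rbar_locally m_infty (fun t => (atan t < - (PI / 2) + e)).
Proof.
  intros He. exists (- tan (PI / 2 - Rmin e 1))%R. intros t Ht.
  assert (B := PI_RGT_0). assert (B2 := PI2_1).
  assert (Q1 := Rmin_l e 1). assert (Q2 := Rmin_r e 1).
  assert (0 < Rmin e 1) by (apply Rmin_glb_lt; lra).
  apply atan_increasing in Ht. rewrite atan_opp, atan_tan in Ht; lra.
Qed.

(** Cauchy's criterion: increments of the primitive are bounded by those of the arctangent. *)
Lemma primitive_limit (f : R -> C) (M : R) (F : (R -> Prop) -> Prop) : ProperFilter F ->
  cont f -> dombd M f ->
  (forall e, 0 < e -> exists a, F (fun t => (Rabs (atan t - a) < e))) ->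
  exists l : C, filterlim (fun t => RIntC f 0 t) F (locally l).
Proof.
  intros HF Hc HM H.
  apply (proj1 (@filterlim_locally_cauchy R C_R_CompleteNormedModule F HF (fun t => RIntC f 0 t))).
  intros e.
  assert (PM := dombd_pos _ _ HM).
  assert (He : 0 < e / (2 * (M + 1))) by (apply Rdiv_lt_0_compat; [apply cond_pos|lra]).
  destruct (H _ He) as [a Ha]. exists (fun t => (Rabs (atan t - a) < e / (2 * (M + 1)))).
  split; auto. intros u v Hu Hv.
  apply (C_NormedModule_mixin_compat1 (RIntC f 0 u) (RIntC f 0 v) e).
  eapply Rle_lt_trans; [now apply (RIntC_dom_diff f M)|].
  assert (K : Rabs (atan v - atan u) <= 2 * (e / (2 * (M + 1)))).
  { replace (atan v - atan u)%R with ((atan v - a) - (atan u - a))%R by ring.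
    eapply Rle_trans; [apply Rabs_triang|]. rewrite Rabs_Ropp. lra. }
  apply Rle_lt_trans with (M * (2 * (e / (2 * (M + 1)))))%R; [now apply Rmult_le_compat_l|].
  apply Rlt_le_trans with ((M + 1) * (2 * (e / (2 * (M + 1)))))%R.
  - apply Rmult_lt_compat_r; lra.
  - right. field. lra.
Qed.

Lemma primitive_limit_p (f : R -> C) : dom f ->
  exists l : C, filterlim (fun t => RIntC f 0 t) (Rbar_locally p_infty) (locally l).
Proof.
  intros [Hc [M HM]]. apply (primitive_limit f M); auto. apply Rbar_locally_filter.
  intros e He. exists (PI / 2)%R. generalize (atan_p_infty e He). apply filter_imp.
  intros t Ht. apply Rabs_def1; assert (B := atan_bound t); lra.
Qed.

Lemma primitive_limit_m (f : R -> C) : dom f ->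
  exists l : C, filterlim (fun t => RIntC f 0 t) (Rbar_locally m_infty) (locally l).
Proof.
  intros [Hc [M HM]]. apply (primitive_limit f M); auto. apply Rbar_locally_filter.
  intros e He. exists (- (PI / 2))%R. generalize (atan_m_infty e He). apply filter_imp.
  intros t Ht. apply Rabs_def1; assert (B := atan_bound t); lra.
Qed.

Lemma Int_unique (f : R -> C) (l : C) :
  is_RIntC_gen f (Rbar_locally m_infty) (Rbar_locally p_infty) l -> Int f = l.
Proof. intros H. apply (@is_RInt_gen_unique C_R_CompleteNormedModule _ _ _ _ f l H). Qed.

Lemma Int_correct (f : R -> C) : dom f ->
  is_RIntC_gen f (Rbar_locally m_infty) (Rbar_locally p_infty) (Int f).
Proof.
  intros Hd. destruct (primitive_limit_p f Hd) as [lp Hp].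
  destruct (primitive_limit_m f Hd) as [lm Hm].
  assert (K : is_RIntC_gen f (Rbar_locally m_infty) (Rbar_locally p_infty) (lp - lm)).
  { apply (is_RIntC_gen_derive (fun t => RIntC f 0 t)); auto; try apply Rbar_locally_filter.
    apply filter_forall. intros ab t _. split.
    - apply RIntC_primitive, Hd.
    - apply Hd. }
  now rewrite (Int_unique f _ K).
Qed.

Lemma Int_derive (F f : R -> C) (A B : C) : cont f -> (forall t, rderiv F t (f t)) ->
  filterlim F (Rbar_locally m_infty) (locally A) ->
  filterlim F (Rbar_locally p_infty) (locally B) -> Int f = B - A.
Proof.
  intros Hc HF HA HB. apply Int_unique.
  apply (is_RIntC_gen_derive F); auto; try apply Rbar_locally_filter.
  apply filter_forall. intros ab t _. auto.
Qed.

Lemma Int_tail (f : R -> C) (M a b : R) : cont f -> dombd M f -> a <= b ->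
  Cmod (Int f - RIntC f a b) <= M * (PI - (atan b - atan a)).
Proof.
  intros Hc HM Hab. assert (PM := dombd_pos _ _ HM).
  apply le_epsilon. intros e He.
  assert (Hd : dom f) by (split; eauto).
  assert (K := Int_correct f Hd (fun z => (Cmod (z - Int f) < e))).
  assert (L : locally (Int f) (fun z => (Cmod (z - Int f) < e))) by (apply locally_Ceps; exists e; auto).
  destruct (K L) as [Q1 Q2 [m Hm] [p Hp] Q].
  set (u := (Rmin (m - 1) a)%R). set (v := (Rmax (p + 1) b)%R).
  assert (Hu := Rmin_l (m - 1) a). assert (Hu2 := Rmin_r (m - 1) a). fold u in Hu, Hu2.
  assert (Hv := Rmax_l (p + 1) b). assert (Hv2 := Rmax_r (p + 1) b). fold v in Hv, Hv2.
  destruct (Q u v) as [z [Hz1 Hz2]]; [apply Hm; lra|apply Hp; lra|].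
  simpl in Hz1. assert (Ez : z = RIntC f u v).
  { symmetry. now apply is_RIntC_unique. }
  subst z.
  rewrite <- (RIntC_Chasles f u a v), <- (RIntC_Chasles f a b v) in Hz2 by auto.
  replace (Int f - RIntC f a b) with
    ((RIntC f u a + RIntC f b v) - (RIntC f u a + (RIntC f a b + RIntC f b v) - Int f)) by ring.
  eapply Rle_trans; [apply Cmod_triangle'|].
  assert (B1 := RIntC_dom_bound f M u a Hc HM Hu2).
  assert (B2 := RIntC_dom_bound f M b v Hc HM Hv2).
  assert (B3 := Cmod_triangle (RIntC f u a) (RIntC f b v)).
  assert (A1 := atan_bound u). assert (A2 := atan_bound v). nra.
Qed.

Lemma Int_bound (f : R -> C) (M : R) : cont f -> dombd M f -> Cmod (Int f) <= PI * M.
Proof.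
  intros Hc HM. assert (K := Int_tail f M 0 0 Hc HM ltac:(lra)).
  assert (Z : RIntC f 0 0 = 0) by apply (@RInt_point C_R_CompleteNormedModule).
  rewrite Z in K.
  replace (Int f - 0) with (Int f) in K by ring. lra.
Qed.

Lemma dom_plus f g : dom f -> dom g -> dom (fun t => f t + g t).
Proof.
  intros [H1 [M1 B1]] [H2 [M2 B2]]. split.
  - intros t. now apply continuous_Cplus.
  - exists (M1 + M2)%R. intros t. eapply Rle_trans; [apply Cmod_triangle|].
    specialize (B1 t). specialize (B2 t). lra.
Qed.

Lemma dom_Cmul c f : dom f -> dom (fun t => c * f t).
Proof.
  intros [H1 [M1 B1]]. split.
  - intros t. apply continuous_Cmult; auto. apply continuous_Cconst.
  - exists (Cmod c * M1)%R. intros t. rewrite Cmod_mult, Rmult_assoc.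
    apply Rmult_le_compat_l; auto. apply Cmod_ge_0.
Qed.

Lemma dom_ext (f g : R -> C) : (forall t, f t = g t) -> dom f -> dom g.
Proof. intros H. apply functional_extensionality in H. now subst. Qed.

Lemma Int_ext (f g : R -> C) : (forall t, f t = g t) -> Int f = Int g.
Proof. intros H. apply functional_extensionality in H. now subst. Qed.

Lemma dom_minus f g : dom f -> dom g -> dom (fun t => f t - g t).
Proof.
  intros Hf Hg. apply dom_ext with (fun t => f t + - (1) * g t); [intros; ring|].
  apply dom_plus; auto. now apply dom_Cmul.
Qed.

Lemma Int_plus f g : dom f -> dom g -> Int (fun t => f t + g t) = Int f + Int g.
Proof.
  intros Hf Hg. apply Int_unique.
  apply (@is_RInt_gen_plus C_R_NormedModule); try apply Rbar_locally_filter; now apply Int_correct.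
Qed.

Lemma Int_minus f g : dom f -> dom g -> Int (fun t => f t - g t) = Int f - Int g.
Proof.
  intros Hf Hg. apply Int_unique.
  apply (@is_RInt_gen_minus C_R_NormedModule); try apply Rbar_locally_filter; now apply Int_correct.
Qed.

Lemma is_RIntC_gen_map (T : C -> C) (Tr : R -> R) (f g : R -> C) (Fa Fb : (R -> Prop) -> Prop) (l : C) :
  (forall a b l, is_RIntC f a b l -> is_RIntC g a b (T l)) -> continuous T l ->
  is_RIntC_gen f Fa Fb l -> is_RIntC_gen g Fa Fb (T l).
Proof.
  intros H HT Hf P HP.
  destruct (Hf (fun z => P (T z)) (HT P HP)) as [Q1 Q2 HQ1 HQ2 Q].
  apply (Filter_prod _ _ _ Q1 Q2 HQ1 HQ2). intros x y Hx Hy.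
  destruct (Q x y Hx Hy) as [z [A B]]. exists (T z). split; auto.
Qed.

Lemma continuous_Cmul_l (c l : C) : continuous (fun z : C => c * z) l.
Proof. apply continuous_Cmult; [apply continuous_Cconst|apply continuous_id]. Qed.

Lemma is_RIntC_gen_Cmul (c : C) (f : R -> C) (Fa Fb : (R -> Prop) -> Prop) (l : C) :
  is_RIntC_gen f Fa Fb l -> is_RIntC_gen (fun t => c * f t) Fa Fb (c * l).
Proof.
  apply (is_RIntC_gen_map (fun z => c * z)); auto.
  - intros; now apply is_RIntC_Cmul.
  - apply continuous_Cmul_l.
Qed.

Lemma continuous_Cconj {U : UniformSpace} (f : U -> C) (x : U) :
  continuous f x -> continuous (fun y => Cconj (f y)) x.
Proof.
  intros H. apply continuous_pair.
  - now apply continuous_Cfst.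
  - apply (@continuous_opp _ R_AbsRing R_NormedModule (fun y => snd (f y))). now apply continuous_Csnd.
Qed.

Lemma is_RIntC_gen_conj (f : R -> C) (Fa Fb : (R -> Prop) -> Prop) (l : C) :
  is_RIntC_gen f Fa Fb l -> is_RIntC_gen (fun t => Cconj (f t)) Fa Fb (Cconj l).
Proof.
  apply (is_RIntC_gen_map Cconj); auto.
  - intros; now apply is_RIntC_conj.
  - apply (continuous_Cconj (fun z : C => z)), continuous_id.
Qed.

Lemma Int_Cmul c f : dom f -> Int (fun t => c * f t) = c * Int f.
Proof. intros Hf. apply Int_unique. now apply is_RIntC_gen_Cmul, Int_correct. Qed.

Lemma Int_conj f : dom f -> Int (fun t => Cconj (f t)) = Cconj (Int f).
Proof. intros Hf. apply Int_unique. now apply is_RIntC_gen_conj, Int_correct. Qed.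

Lemma dom_conj f : dom f -> dom (fun t => Cconj (f t)).
Proof.
  intros [H [M B]]. split.
  - intros t. now apply continuous_Cconj.
  - exists M. intros t. now rewrite Cmod_conj.
Qed.

Lemma Int_reflect f : dom f -> Int (fun t => f (- t)%R) = Int f.
Proof.
  intros Hf. apply Int_unique. intros P HP.
  destruct (Int_correct f Hf P HP) as [Q1 Q2 [m Hm] [p Hp] Q].
  apply (Filter_prod _ _ _ (fun x => Q2 (- x)%R) (fun x => Q1 (- x)%R)).
  - exists (- p)%R. intros x Hx. apply Hp. lra.
  - exists (- m)%R. intros x Hx. apply Hm. lra.
  - intros x y Hx Hy. destruct (Q _ _ Hy Hx) as [z [A B]]. exists z. split; auto.
    simpl in *. apply (@is_RInt_swap C_R_NormedModule) in A.
    assert (K := @is_RInt_comp_opp C_R_NormedModule f x y _ A).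
    apply (@is_RInt_opp C_R_NormedModule) in K. rewrite opp_opp in K.
    eapply (@is_RInt_ext C_R_NormedModule); [|exact K].
    intros t _. cbv beta. apply opp_opp.
Qed.

Lemma dom_reflect f : dom f -> dom (fun t => f (- t)%R).
Proof.
  intros [H [M B]]. split.
  - intros t. apply (continuous_comp Ropp f); auto.
    apply (@continuous_opp _ R_AbsRing R_NormedModule (fun y => y)). apply continuous_id.
  - exists M. intros t. specialize (B (- t)%R). unfold wt in *.
    now replace (- t * - t)%R with (t * t)%R in B by ring.
Qed.

(** * Fubini's theorem *)

Definition dombd2 (M : R) (f : R -> R -> C) : Prop :=
  forall t y, Cmod (f t y) <= M * wt t * wt y.

Definition dom2 (f : R -> R -> C) : Prop := cont2 f /\ exists M, dombd2 M f.

Lemma dom2_swap f : dom2 f -> dom2 (fun y t => f t y).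
Proof.
  intros [H [M B]]. split; [now apply cont2_swap|].
  exists M. intros y t. specialize (B t y). lra.
Qed.

Lemma dombd2_pos M f : dombd2 M f -> 0 <= M.
Proof.
  intros H. specialize (H 0 0)%R. assert (K := Cmod_ge_0 (f 0 0)%R).
  unfold wt in H. rewrite Rmult_0_r, Rplus_0_r, Rinv_1 in H. lra.
Qed.

Lemma dom2_bd M f t : dombd2 M f -> dombd (M * wt t) (f t).
Proof. intros H y. apply H. Qed.

Lemma Int_param_cont f : dom2 f -> cont (fun t => Int (f t)).
Proof.
  intros [H [M B]] t. assert (PM := dombd2_pos _ _ B).
  rewrite continuous_Ceps. intros e He.
  assert (He' : 0 < e / (3 * (2 * (M + 1)))) by (apply Rdiv_lt_0_compat; lra).
  destruct (atan_p_infty _ He') as [T HT].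
  set (Y := (Rmax T 0 + 1)%R).
  assert (Y1 := Rmax_l T 0). assert (Y2 := Rmax_r T 0).
  specialize (HT Y ltac:(unfold Y; lra)).
  assert (A : forall x, (Cmod (Int (f x) - RIntC (f x) (- Y) Y) < e / 3)).
  { intros x. eapply Rle_lt_trans.
    - apply (Int_tail (f x) (M * wt x)); [now apply cont2_l|now apply dom2_bd|unfold Y; lra].
    - rewrite atan_opp. assert (W := wt_le_1 x). assert (W2 := wt_pos x).
      assert (AB := atan_bound Y).
      apply Rle_lt_trans with (M * (2 * (e / (3 * (2 * (M + 1))))))%R.
      + apply Rmult_le_compat; try lra.
        * apply Rmult_le_pos; lra.
        * nra.
      + apply Rlt_le_trans with ((M + 1) * (2 * (e / (3 * (2 * (M + 1))))))%R.
        * apply Rmult_lt_compat_r; lra.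
        * right. field. lra. }
  assert (K := RIntC_param_cont f (- Y) Y H t). rewrite continuous_Ceps in K.
  generalize (K (e / 3)%R ltac:(lra)). apply filter_imp. intros x Hx.
  replace (Int (f x) - Int (f t)) with
    ((Int (f x) - RIntC (f x) (- Y) Y) - (Int (f t) - RIntC (f t) (- Y) Y)
     + (RIntC (f x) (- Y) Y - RIntC (f t) (- Y) Y)) by ring.
  eapply Rle_lt_trans; [apply Cmod_triangle|].
  assert (A1 := A x). assert (A2 := A t).
  assert (A3 := Cmod_triangle' (Int (f x) - RIntC (f x) (- Y) Y) (Int (f t) - RIntC (f t) (- Y) Y)).
  lra.
Qed.

Lemma dom2_Int f : dom2 f -> dom (fun t => Int (f t)).
Proof.
  intros Hf. split; [now apply Int_param_cont|].
  destruct Hf as [H [M B]]. exists (PI * M)%R. intros t.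
  rewrite Rmult_assoc. apply Int_bound; [now apply cont2_l|now apply dom2_bd].
Qed.

Lemma Int_RInt_fubini f (a b : R) : dom2 f -> a <= b ->
  Int (fun y => RIntC (fun t => f t y) a b) = RIntC (fun t => Int (f t)) a b /\
  dom (fun y => RIntC (fun t => f t y) a b).
Proof.
  intros Hf Hab. assert (Hf0 := Hf). destruct Hf as [H [M B]].
  assert (PM := dombd2_pos _ _ B).
  assert (Hc : cont (fun y => RIntC (fun t => f t y) a b)).
  { apply (RIntC_param_cont (fun y t => f t y)). now apply cont2_swap. }
  assert (Hb : dombd (M * (atan b - atan a)) (fun y => RIntC (fun t => f t y) a b)).
  { intros y. replace (M * (atan b - atan a) * wt y)%R with (M * wt y * (atan b - atan a))%R by ring.
    apply RIntC_dom_bound; auto; [now apply cont2_r|].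
    intros t. specialize (B t y). lra. }
  split; [|split; eauto].
  apply C_eq_eps. intros e He.
  assert (He' : 0 < e / (2 * (PI * M * 2 + 1))).
  { apply Rdiv_lt_0_compat; auto. assert (P := PI_RGT_0). nra. }
  set (q := (e / (2 * (PI * M * 2 + 1)))%R) in *.
  destruct (atan_p_infty _ He') as [T HT].
  set (Y := (Rmax T 0 + 1)%R).
  assert (Y1 := Rmax_l T 0). assert (Y2 := Rmax_r T 0).
  specialize (HT Y ltac:(unfold Y; lra)).
  assert (Y3 : - Y <= Y) by (unfold Y; lra).
  assert (A1 := Int_tail _ _ (- Y) Y Hc Hb Y3).
  rewrite <- (RIntC_fubini f a b (- Y) Y) in A1 by auto.
  assert (A2 : Cmod (RIntC (fun t => Int (f t)) a b - RIntC (fun t => RIntC (f t) (- Y) Y) a b)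
     <= M * (PI - (atan Y - atan (- Y))) * (atan b - atan a)).
  { assert (Hc2 := Int_param_cont f Hf0).
    assert (Hc3 := RIntC_param_cont f (- Y) Y H).
    replace (RIntC (fun t => Int (f t)) a b - RIntC (fun t => RIntC (f t) (- Y) Y) a b)
      with (RIntC (fun t => Int (f t) - RIntC (f t) (- Y) Y) a b).
    2: { apply (@RInt_minus C_R_CompleteNormedModule); now apply ex_RIntC. }
    apply (RIntC_dom_bound (fun t => Int (f t) - RIntC (f t) (- Y) Y)); auto.
    - intros t. now apply continuous_Cminus.
    - intros t. replace (M * (PI - (atan Y - atan (- Y))) * wt t)%R
        with (M * wt t * (PI - (atan Y - atan (- Y))))%R by ring.
      apply Int_tail; auto; [now apply cont2_l|now apply dom2_bd]. }
  replace (_ - _) with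
    ((Int (fun y => RIntC (fun t => f t y) a b) - RIntC (fun t => RIntC (f t) (- Y) Y) a b)
    - (RIntC (fun t => Int (f t)) a b - RIntC (fun t => RIntC (f t) (- Y) Y) a b)) by ring.
  eapply Rle_trans; [apply Cmod_triangle'|].
  rewrite atan_opp in A1, A2.
  assert (AB := atan_bound Y). assert (ABa := atan_bound a). assert (ABb := atan_bound b).
  assert (Mo : atan a <= atan b).
  { destruct Hab as [Hab| ->]; [left; now apply atan_increasing|lra]. }
  assert (D1 : 0 <= atan b - atan a <= PI) by lra.
  assert (D2 : 0 <= PI - (atan Y - - atan Y) <= 2 * q) by lra.
  set (x := (atan b - atan a)%R) in *. set (z := (PI - (atan Y - - atan Y))%R) in *.
  assert (D3 : x * z <= PI * (2 * q)) by (apply Rmult_le_compat; lra).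
  assert (D4 : M * (x * z) <= M * (PI * (2 * q))) by (apply Rmult_le_compat_l; lra).
  assert (D5 : 2 * (M * (PI * (2 * q))) <= e).
  { assert (P := PI_RGT_0).
    apply Rle_trans with (2 * ((PI * M * 2 + 1) * q))%R; [nra|].
    right. unfold q. field. nra. }
  lra.
Qed.

(** The order of integration is exchanged over bounded intervals, then over strips
    ([Int_RInt_fubini]), and the tails are controlled by those of the majorant. *)
Theorem Int_fubini f : dom2 f ->
  Int (fun t => Int (f t)) = Int (fun y => Int (fun t => f t y)).
Proof.
  intros Hf. assert (Hf0 := Hf). destruct Hf as [H [M B]].
  assert (PM := dombd2_pos _ _ B).
  assert (Hs := dom2_swap f Hf0).
  apply C_eq_eps. intros e He.
  assert (He' : 0 < e / (2 * (PI * M * 2 + 1))).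
  { apply Rdiv_lt_0_compat; auto. assert (P := PI_RGT_0). nra. }
  set (q := (e / (2 * (PI * M * 2 + 1)))%R) in *.
  destruct (atan_p_infty _ He') as [T HT].
  set (Y := (Rmax T 0 + 1)%R).
  assert (Y1 := Rmax_l T 0). assert (Y2 := Rmax_r T 0).
  specialize (HT Y ltac:(unfold Y; lra)).
  assert (Y3 : - Y <= Y) by (unfold Y; lra).
  destruct (Int_RInt_fubini f (- Y) Y Hf0 Y3) as [E Hd].
  assert (A1 : Cmod (Int (fun t => Int (f t)) - RIntC (fun t => Int (f t)) (- Y) Y)
     <= PI * M * (PI - (atan Y - atan (- Y)))).
  { apply Int_tail; auto; [now apply Int_param_cont|].
    intros t. rewrite Rmult_assoc. apply Int_bound; [now apply cont2_l|now apply dom2_bd]. }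
  assert (A2 : Cmod (Int (fun y => Int (fun t => f t y)) - Int (fun y => RIntC (fun t => f t y) (- Y) Y))
     <= PI * (M * (PI - (atan Y - atan (- Y))))).
  { rewrite <- Int_minus; auto; [|now apply dom2_Int].
    apply Int_bound.
    - intros y. apply continuous_Cminus; [now apply (Int_param_cont (fun y t => f t y))|apply Hd].
    - intros y. replace (M * (PI - (atan Y - atan (- Y))) * wt y)%R
        with (M * wt y * (PI - (atan Y - atan (- Y))))%R by ring.
      apply Int_tail; auto; [now apply cont2_r|]. intros t. specialize (B t y). lra. }
  rewrite E in A2.
  replace (_ - _) with
    ((Int (fun t => Int (f t)) - RIntC (fun t => Int (f t)) (- Y) Y)
    - (Int (fun y => Int (fun t => f t y)) - RIntC (fun t => Int (f t)) (- Y) Y)) by ring.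
  eapply Rle_trans; [apply Cmod_triangle'|].
  rewrite atan_opp in A1, A2. assert (AB := atan_bound Y).
  assert (D2 : 0 <= PI - (atan Y - - atan Y) <= 2 * q) by lra.
  set (z := (PI - (atan Y - - atan Y))%R) in *.
  assert (P := PI_RGT_0).
  assert (D4 : PI * M * z <= PI * M * (2 * q)) by (apply Rmult_le_compat_l; nra).
  assert (D5 : 2 * (M * (PI * (2 * q))) <= e).
  { apply Rle_trans with (2 * ((PI * M * 2 + 1) * q))%R; [nra|].
    right. unfold q. field. nra. }
  lra.
Qed.

(** * Integrals depending on a complex variable through an exponential *)

(** The factor exp (d |L|) leaves room for all exponents in a disc of radius d around z0, and for
    derivatives under the integral sign. *)
Definition edom (k L : R -> C) (z0 : C) (d : R) : Prop :=
  cont k /\ cont L /\ 0 < d /\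
  exists M, forall t, Cmod (k t) * exp (d * Cmod (L t)) * Cmod (Cexp (z0 * L t)) <= M * wt t.

Definition eint (k L : R -> C) (z : C) : C := Int (fun t => k t * Cexp (z * L t)).

Lemma exp_le_1 (x : R) : 0 <= x -> 1 <= exp x.
Proof. intros H. assert (K := exp_ge_1_plus x). lra. Qed.

Lemma edom_dom k L z0 d : edom k L z0 d -> dom (fun t => k t * Cexp (z0 * L t)).
Proof.
  intros (Hk & HL & Hd & M & HM). split.
  - intros t. specialize (Hk t). specialize (HL t). solve_cont.
  - exists M. intros t. eapply Rle_trans; [|apply HM]. rewrite Cmod_mult.
    apply Rmult_le_compat_r; [apply Cmod_ge_0|].
    rewrite <- (Rmult_1_r (Cmod (k t))) at 1. apply Rmult_le_compat_l; [apply Cmod_ge_0|].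
    apply exp_le_1. apply Rmult_le_pos; [lra|apply Cmod_ge_0].
Qed.

Lemma edom_move k L z0 d z : edom k L z0 d -> Cmod (z - z0) <= d / 2 -> edom k L z (d / 2).
Proof.
  intros (Hk & HL & Hd & M & HM) Hz. repeat split; auto; try lra.
  exists M. intros t. eapply Rle_trans; [|apply HM].
  rewrite !Rmult_assoc. apply Rmult_le_compat_l; [apply Cmod_ge_0|].
  replace (z * L t) with ((z - z0) * L t + z0 * L t) by ring.
  rewrite Cexp_plus, Cmod_mult, <- Rmult_assoc.
  apply Rmult_le_compat_r; [apply Cmod_ge_0|].
  rewrite Cexp_mod, <- exp_plus. apply exp_mono.
  assert (K1 := fst_le_Cmod ((z - z0) * L t)). rewrite Cmod_mult in K1.
  assert (K2 := Rle_abs (fst ((z - z0) * L t))).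
  assert (K3 := Cmod_ge_0 (L t)).
  assert (Cmod (z - z0) * Cmod (L t) <= d / 2 * Cmod (L t)) by (apply Rmult_le_compat_r; auto).
  lra.
Qed.

Lemma cube_le_exp (x : R) : 0 <= x -> x * x * x <= 27 * exp x.
Proof.
  intros H. replace (exp x) with (exp (x / 3) * exp (x / 3) * exp (x / 3))%R
    by (rewrite <- !exp_plus; f_equal; field).
  assert (K := exp_ge_1_plus (x / 3)). set (y := exp (x / 3)) in *.
  assert (A : x / 3 * (x / 3) <= y * y) by (apply Rmult_le_compat; lra).
  assert (B : x / 3 * (x / 3) * (x / 3) <= y * y * y).
  { apply Rmult_le_compat; try lra. nra. }
  lra.
Qed.

Lemma edom_mul k L z0 d : edom k L z0 d -> edom (fun t => L t * k t) L z0 (d / 2).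
Proof.
  intros (Hk & HL & Hd & M & HM). repeat split; auto; try lra.
  - intros t. now apply continuous_Cmult.
  - exists (2 / d * M)%R. intros t.
    apply Rle_trans with (2 / d * (Cmod (k t) * exp (d * Cmod (L t)) * Cmod (Cexp (z0 * L t))))%R.
    + rewrite Cmod_mult. rewrite <- !Rmult_assoc. apply Rmult_le_compat_r; [apply Cmod_ge_0|].
      rewrite (Rmult_comm (Cmod (L t))), (Rmult_comm (2 / d)), !Rmult_assoc.
      apply Rmult_le_compat_l; [apply Cmod_ge_0|].
      set (x := Cmod (L t)). assert (Hx : 0 <= x) by apply Cmod_ge_0.
      replace (d * x)%R with (d / 2 * x + d / 2 * x)%R by field. rewrite exp_plus.
      assert (K := exp_ge_1_plus (d / 2 * x)). assert (E := exp_pos (d / 2 * x)).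
      assert (B : x <= exp (d / 2 * x) * (2 / d)).
      { apply (Rmult_le_reg_l (d / 2)); [lra|].
        replace (d / 2 * (exp (d / 2 * x) * (2 / d)))%R with (exp (d / 2 * x)) by (field; lra). lra. }
      assert (B2 := Rmult_le_compat_r _ _ _ (Rlt_le _ _ E) B). lra.
    + rewrite (Rmult_assoc _ M). apply Rmult_le_compat_l; auto.
      left; apply Rdiv_lt_0_compat; lra.
Qed.

(** The Taylor expansion of the exponential to second order, under the integral sign. *)
Lemma eint_expand k L z0 d : edom k L z0 d ->
  exists K, forall h, Cmod h <= d / 2 ->
    Cmod (eint k L (z0 + h) - eint k L z0 - h * eint (fun t => L t * k t) L z0
       - h * h / 2 * eint (fun t => L t * (L t * k t)) L z0)%C
     <= K * (Cmod h * Cmod h * Cmod h).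
Proof.
  intros He.
  assert (D0 := edom_dom _ _ _ _ He).
  assert (D1 := edom_dom _ _ _ _ (edom_mul _ _ _ _ He)).
  assert (D2 := edom_dom _ _ _ _ (edom_mul _ _ _ _ (edom_mul _ _ _ _ He))).
  assert (He0 := He). destruct He as (Hk & HL & Hd & M & HM).
  exists (PI * (8 * 27 * (2 / d * (2 / d) * (2 / d)) * M))%R. intros h Hh.
  assert (Dh : dom (fun t => k t * Cexp ((z0 + h) * L t))).
  { apply (edom_dom _ _ _ (d / 2)). apply (edom_move k L z0 d); auto.
    now replace (z0 + h - z0) with h by ring. }
  unfold eint. rewrite <- !Int_Cmul by auto.
  rewrite <- !Int_minus; auto using dom_minus, dom_Cmul.
  rewrite (Rmult_assoc PI). apply Int_bound.
  - assert (Hdom : dom (fun t => k t * Cexp ((z0 + h) * L t) - k t * Cexp (z0 * L t) -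
      h * (L t * k t * Cexp (z0 * L t)) - h * h / 2 * (L t * (L t * k t) * Cexp (z0 * L t))))
      by auto 6 using dom_minus, dom_Cmul.
    apply Hdom.
  - intros t.
    set (g := k t * Cexp (z0 * L t)).
    replace (_ - _) with (g * (Cexp (h * L t) - 1 - h * L t - h * L t * (h * L t) / 2)).
    2: { unfold g. replace ((z0 + h) * L t) with (z0 * L t + h * L t) by ring.
         rewrite Cexp_plus. field. }
    rewrite Cmod_mult. eapply Rle_trans.
    { apply Rmult_le_compat_l; [apply Cmod_ge_0|apply Cexp_taylor3]. }
    specialize (HM t). rewrite Cmod_mult. set (x := Cmod (L t)) in *.
    assert (Hx : 0 <= x) by apply Cmod_ge_0.
    set (a := Cmod h) in *. assert (Ha : 0 <= a) by apply Cmod_ge_0.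
    set (y := (d / 2 * x)%R). assert (Hy : 0 <= y) by (unfold y; nra).
    assert (C1 := cube_le_exp y Hy).
    assert (E1 : exp (a * x) <= exp y) by (apply exp_mono; unfold y; nra).
    assert (E2 : exp (d * x) = (exp y * exp y)%R) by (rewrite <- exp_plus; f_equal; unfold y; field).
    assert (Ey := exp_pos y).
    assert (Q : (a * x) ^ 3 * exp (a * x) <= 27 * (2 / d * (2 / d) * (2 / d)) * (a * a * a) * exp (d * x)).
    { replace ((a * x) ^ 3)%R with ((2 / d * (2 / d) * (2 / d)) * (a * a * a) * (y * y * y))%R
        by (unfold y; field; lra).
      rewrite E2.
      replace (27 * (2 / d * (2 / d) * (2 / d)) * (a * a * a) * (exp y * exp y))%R
        with (2 / d * (2 / d) * (2 / d) * (a * a * a) * ((27 * exp y) * exp y))%R by ring.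
      assert (0 < 2 / d) by (apply Rdiv_lt_0_compat; lra).
      rewrite Rmult_assoc. apply Rmult_le_compat_l.
      - apply Rmult_le_pos; repeat apply Rmult_le_pos; lra.
      - apply Rmult_le_compat; try lra.
        + apply Rmult_le_pos; [apply Rmult_le_pos|]; auto.
        + left; apply exp_pos. }
    assert (G : Cmod g * exp (d * x) <= M * wt t).
    { unfold g. rewrite Cmod_mult. lra. }
    assert (Gp : 0 <= Cmod g) by apply Cmod_ge_0.
    set (W := (27 * (2 / d * (2 / d) * (2 / d)) * (a * a * a))%R) in *.
    assert (WP : 0 <= W).
    { assert (0 < 2 / d) by (apply Rdiv_lt_0_compat; lra).
      unfold W. apply Rmult_le_pos; repeat apply Rmult_le_pos; lra. }
    apply Rle_trans with (8 * W * (Cmod g * exp (d * x)))%R.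
    + assert (T := Rmult_le_compat_l _ _ _ Gp Q). lra.
    + apply Rle_trans with (8 * W * (M * wt t))%R.
      * apply Rmult_le_compat_l; lra.
      * right. unfold W. ring.
Qed.

Lemma eint_cderiv k L z0 d : edom k L z0 d ->
  cderiv (eint k L) z0 (eint (fun t => L t * k t) L z0).
Proof.
  intros He. destruct (eint_expand k L z0 d He) as [K HK].
  assert (Hd : 0 < d) by apply He.
  set (E2 := eint (fun t => L t * (L t * k t)) L z0) in *.
  apply (cderiv_quadratic _ _ _ (Rabs K * (d / 2) + Cmod E2) (d / 2)); [lra|].
  intros h Hh.
  specialize (HK h ltac:(lra)).
  replace (eint k L (z0 + h)%C - _ - _) with
    ((eint k L (z0 + h) - eint k L z0 - h * eint (fun t => L t * k t) L z0 - h * h / 2 * E2)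
      + h * h / 2 * E2) by field.
  eapply Rle_trans; [apply Cmod_triangle|].
  assert (A : Cmod (h * h / 2 * E2) = (Cmod h * Cmod h / 2 * Cmod E2)%R).
  { unfold Cdiv. rewrite !Cmod_mult, Cmod_inv, Cmod_R, Rabs_pos_eq; try lra.
    intros E; apply RtoC_inj in E; lra. }
  rewrite A.
  assert (B := Cmod_ge_0 h). assert (B2 := Cmod_ge_0 E2). assert (B3 := Rle_abs K). assert (B4 := Rabs_pos K).
  set (a := Cmod h) in *.
  assert (T1 : K * (a * a * a) <= Rabs K * (d / 2) * (a * a)).
  { apply Rle_trans with (Rabs K * (a * a * a))%R.
    - apply Rmult_le_compat_r; auto. repeat apply Rmult_le_pos; auto.
    - replace (Rabs K * (d / 2) * (a * a))%R with (Rabs K * (a * a * (d / 2)))%R by ring.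
      apply Rmult_le_compat_l; auto. apply Rmult_le_compat_l; [nra|lra]. }
  assert (0 <= a * a * Cmod E2) by (repeat apply Rmult_le_pos; auto).
  lra.
Qed.

Lemma eint_hol k L z0 d : edom k L z0 d -> hol (eint k L) z0.
Proof.
  intros He. exists (eint (fun t => L t * k t) L). split.
  - apply locally_Ceps. exists (d / 2)%R. split; [assert (H : 0 < d) by apply He; lra|].
    intros w Hw. apply eint_cderiv with (d / 2)%R. apply edom_move with z0; auto. lra.
  - eapply cderiv_continuous. apply eint_cderiv with (d / 2)%R. now apply edom_mul.
Qed.

(** Removing the zero of an integral of this kind leaves a differentiable quotient. *)
Lemma eint_quotient_cderiv k L z0 d (Q : C -> C) : edom k L z0 d -> eint k L z0 = 0 ->
  Q z0 = eint (fun t => L t * k t) L z0 ->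
  (forall z, z <> z0 -> Q z = eint k L z / (z - z0)) ->
  cderiv Q z0 (eint (fun t => L t * (L t * k t)) L z0 / 2).
Proof.
  intros He H0 HQ0 HQ. destruct (eint_expand k L z0 d He) as [K HK].
  assert (Hd : 0 < d) by apply He.
  apply (cderiv_quadratic _ _ _ K (d / 2)); [lra|].
  intros h Hh. destruct (Ceq_dec h 0) as [->|Hn].
  - replace (z0 + 0) with z0 by ring. replace (Q z0 - Q z0 - _) with (RtoC 0) by ring.
    rewrite Cmod_0. lra.
  - specialize (HK h ltac:(lra)). rewrite H0 in HK.
    rewrite HQ0, HQ. 2: { intros E. apply Hn. replace h with (z0 + h - z0) by ring. rewrite E. ring. }
    replace (z0 + h - z0) with h by ring.
    assert (Hp : 0 < Cmod h) by now apply Cmod_gt_0.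
    apply (Rmult_le_reg_l (Cmod h)); auto. rewrite <- Cmod_mult.
    replace (h * _) with (eint k L (z0 + h) - 0 - h * eint (fun t => L t * k t) L z0
       - h * h / 2 * eint (fun t => L t * (L t * k t)) L z0) by (field; auto).
    eapply Rle_trans; [exact HK|]. right. ring.
Qed.

(** * Primitives on star-shaped domains *)

(** Cutting the parameter off makes an integrand over [a, b] continuous on the whole line. *)
Definition clamp (a b t : R) : R := Rmax a (Rmin b t).

Lemma clamp_id a b t : a <= t <= b -> clamp a b t = t.
Proof. intros H. unfold clamp. rewrite Rmin_right, Rmax_right; lra. Qed.

Lemma clamp_range a b t : a <= b -> a <= clamp a b t <= b.
Proof.
  intros H. unfold clamp. split; [apply Rmax_l|].
  apply Rmax_lub; auto. apply Rmin_l.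
Qed.

Lemma clamp_lip a b x y : Rabs (clamp a b x - clamp a b y) <= Rabs (x - y).
Proof.
  unfold clamp, Rmax, Rmin. unfold Rabs.
  repeat (destruct Rle_dec); repeat (destruct Rcase_abs); lra.
Qed.

Lemma clamp_continuous {U : UniformSpace} a b (f : U -> R) x :
  continuous f x -> continuous (fun y => clamp a b (f y)) x.
Proof.
  intros H. apply (continuous_comp f (clamp a b)); auto.
  intros P [e HP]. exists e. intros y Hy. apply HP.
  unfold ball in *; simpl in *. unfold AbsRing_ball, abs, minus, plus, opp in *; simpl in *.
  eapply Rle_lt_trans; [|exact Hy].
  apply (clamp_lip a b y (f x)).
Qed.

#[export] Hint Extern 1 (continuous (fun x => clamp ?a ?b (@?f x)) _) =>
  apply (clamp_continuous a b f); solve_cont : cont.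

Definition deriv (f : C -> C) (z : C) : C := epsilon (inhabits (RtoC 0)) (fun l => cderiv f z l).

Lemma hol_deriv f z : hol f z -> cderiv f z (deriv f z).
Proof. intros H. apply (epsilon_spec (inhabits (RtoC 0)) (fun l => cderiv f z l)). now apply hol_cderiv. Qed.

Lemma hol_deriv_continuous f z : hol f z -> continuous (deriv f) z.
Proof.
  intros [f' [H K]]. apply (continuous_ext_loc _ f').
  - revert H. apply filter_imp. intros w Hw.
    apply (cderiv_unique f w); auto. apply (epsilon_spec (inhabits (RtoC 0)) (fun l => cderiv f w l)). eauto.
  - exact K.
Qed.

Definition star (D : C -> Prop) (z0 : C) : Prop :=
  forall z, D z -> forall t : R, 0 <= t <= 1 -> D (z0 + t * (z - z0)).

Definition opens (D : C -> Prop) : Prop := forall z, D z -> locally z D.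

Section Primitive.

Variables (D : C -> Prop) (z0 : C) (f : C -> C).

Hypothesis HD : opens D.

Hypothesis Hstar : star D z0.

Hypothesis Hcont : forall z, D z -> continuous f z.

Hypothesis Hhol : forall z, D z -> z <> z0 -> hol f z.

(** The integral along the segment from z0 to p, the candidate for a primitive. *)
Definition ray_int (p : C) : C :=
  RIntC (fun t => f (z0 + clamp 0 1 t * (p - z0))) 0 1 * (p - z0).

Lemma ray_cont p : D p -> cont (fun t => f (z0 + clamp 0 1 t * (p - z0))).
Proof.
  intros Hp t. apply (continuous_comp (fun t : R => z0 + clamp 0 1 t * (p - z0)) f).
  - solve_cont.
  - apply Hcont. apply Hstar; auto. apply clamp_range; lra.
Qed.

Lemma seg_cont p h : (forall t : R, 0 <= t <= 1 -> D (p + t * h)) ->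
  cont (fun t => f (p + clamp 0 1 t * h)).
Proof.
  intros Hp t. apply (continuous_comp (fun t : R => p + clamp 0 1 t * h) f).
  - solve_cont.
  - apply Hcont. apply Hp. apply clamp_range; lra.
Qed.

(** The homotopy (l, t) -> z0 + t (p + l h - z0) sweeps the triangle; its mixed derivative is
    integrated in both orders.  The cut-off e keeps it away from z0. *)
Lemma triangle_cut p h e : 0 < e <= 1 ->
  (forall t : R, 0 <= t <= 1 -> D (p + t * h) /\ p + t * h <> z0) ->
  RIntC (fun t => f (z0 + clamp 0 1 t * (p + h - z0))) e 1 * (p + h - z0)
  - RIntC (fun t => f (z0 + clamp 0 1 t * (p - z0))) e 1 * (p - z0)
  = h * RIntC (fun t => f (p + clamp 0 1 t * h)) 0 1
    - e * h * RIntC (fun t => f (z0 + e * (p + clamp 0 1 t * h - z0))) 0 1.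
Proof.
  intros He Hp.
  set (zeta := fun l t : R => z0 + clamp e 1 t * (p + clamp 0 1 l * h - z0)).
  assert (Hz : forall l t, D (zeta l t) /\ zeta l t <> z0).
  { intros l t. assert (R1 := clamp_range e 1 t ltac:(lra)).
    assert (R2 := clamp_range 0 1 l ltac:(lra)).
    destruct (Hp _ R2) as [H1 H2]. split.
    - unfold zeta. apply Hstar; auto. lra.
    - unfold zeta. intros E. apply H2.
      assert (E2 : clamp e 1 t * (p + clamp 0 1 l * h - z0) = 0).
      { replace (clamp e 1 t * (p + clamp 0 1 l * h - z0)) with
          (z0 + clamp e 1 t * (p + clamp 0 1 l * h - z0) - z0) by ring. rewrite E. ring. }
      apply Ceq_minus.
      destruct (Ceq_dec (p + clamp 0 1 l * h - z0) 0) as [E3|N]; auto.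
      exfalso. apply (Cmult_neq_0 (clamp e 1 t) (p + clamp 0 1 l * h - z0)); auto.
      intros E4. apply RtoC_inj in E4. lra. }
  set (g := fun l t : R => h * (f (zeta l t)
     + clamp e 1 t * (p + clamp 0 1 l * h - z0) * deriv f (zeta l t))).
  assert (Cz : cont2 zeta).
  { intros l t. unfold zeta. solve_cont. }
  assert (Cg : cont2 g).
  { intros l t. destruct (Hz l t) as [Z1 Z2].
    assert (C1 : continuous (fun x : R * R => f (zeta (fst x) (snd x))) (l, t)).
    { apply (continuous_comp (fun x : R * R => zeta (fst x) (snd x)) f); [apply Cz|now apply Hcont]. }
    assert (C2 : continuous (fun x : R * R => deriv f (zeta (fst x) (snd x))) (l, t)).
    { apply (continuous_comp (fun x : R * R => zeta (fst x) (snd x)) (deriv f)); [apply Cz|].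
      now apply hol_deriv_continuous, Hhol. }
    unfold g. solve_cont. }
  assert (Fub := RIntC_fubini g 0 1 e 1 Cg).
  assert (E1 : forall l, (0 <= l <= 1) ->
    RIntC (g l) e 1 = h * f (p + l * h) - h * e * f (z0 + e * (p + l * h - z0))).
  { intros l Hl. apply is_RIntC_unique.
    assert (K := is_RIntC_derive (fun t => h * t * f (z0 + t * (p + l * h - z0))) (g l) e 1).
    simpl in K.
    replace (h * f (p + l * h)) with (h * 1 * f (z0 + 1 * (p + l * h - z0))).
    2: { replace (z0 + 1 * (p + l * h - z0)) with (p + l * h) by ring. ring. }
    apply K. intros t Ht. rewrite Rmin_left, Rmax_right in Ht by lra.
    split; [|now apply cont2_l].
    destruct (Hz l t) as [Z1 Z2].
    assert (Ez : zeta l t = z0 + t * (p + l * h - z0)).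
    { unfold zeta. rewrite !clamp_id by lra. reflexivity. }
    eapply rderiv_eq.
    - apply (rderiv_comp (fun z => h * z * f (z0 + z * (p + l * h - z0))) RtoC).
      2: apply rderiv_RtoC.
      cderive. apply (cderiv_comp f (fun z => z0 + z * (p + l * h - z0))); [|cderive].
      rewrite <- Ez. apply hol_deriv. auto.
    - cbv beta. unfold g. rewrite Ez. rewrite !clamp_id by lra. ring. }
  assert (E2 : forall t, (e <= t <= 1) ->
    RIntC (fun l => g l t) 0 1 = f (z0 + t * (p + h - z0)) * (p + h - z0)
      - f (z0 + t * (p - z0)) * (p - z0)).
  { intros t Ht. apply is_RIntC_unique.
    assert (K := is_RIntC_derive (fun l => f (z0 + t * (p + l * h - z0)) * (p + l * h - z0))
      (fun l => g l t) 0 1). simpl in K.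
    replace (f (z0 + t * (p + h - z0)) * (p + h - z0)
      - f (z0 + t * (p - z0)) * (p - z0)) with
      (f (z0 + t * (p + 1 * h - z0)) * (p + 1 * h - z0)
      - f (z0 + t * (p + 0 * h - z0)) * (p + 0 * h - z0)).
    2: { now replace (p + 1 * h) with (p + h) by ring; replace (p + 0 * h) with p by ring. }
    apply K. intros l Hl. rewrite Rmin_left, Rmax_right in Hl by lra.
    split; [|now apply (cont2_r g)].
    destruct (Hz l t) as [Z1 Z2].
    assert (Ez : zeta l t = z0 + t * (p + l * h - z0)).
    { unfold zeta. rewrite !clamp_id by lra. reflexivity. }
    eapply rderiv_eq.
    - apply (rderiv_comp (fun z => f (z0 + t * (p + z * h - z0)) * (p + z * h - z0)) RtoC).
      2: apply rderiv_RtoC.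
      cderive. apply (cderiv_comp f (fun z => z0 + t * (p + z * h - z0))); [|cderive].
      rewrite <- Ez. apply hol_deriv. auto.
    - cbv beta. unfold g. rewrite Ez. rewrite !clamp_id by lra. ring. }
  assert (P0 := Hp 0%R ltac:(lra)). assert (P1 := Hp 1%R ltac:(lra)).
  replace (p + 0%R * h) with p in P0 by ring. replace (p + 1%R * h) with (p + h) in P1 by ring.
  assert (L1 : RIntC (fun l => RIntC (g l) e 1) 0 1 =
    h * RIntC (fun t => f (p + clamp 0 1 t * h)) 0 1
    - e * h * RIntC (fun t => f (z0 + e * (p + clamp 0 1 t * h - z0))) 0 1).
  { apply is_RIntC_unique.
    apply is_RIntC_ext with
      (fun l => h * f (p + clamp 0 1 l * h) - e * h * f (z0 + e * (p + clamp 0 1 l * h - z0))).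
    { intros l Hl. rewrite Rmin_left, Rmax_right in Hl by lra.
      rewrite E1 by lra. rewrite !clamp_id by lra. ring. }
    apply (@is_RInt_minus C_R_NormedModule).
    - apply is_RIntC_Cmul. apply is_RIntC_RInt. apply seg_cont. apply Hp.
    - apply is_RIntC_Cmul. apply is_RIntC_RInt.
      intros t. apply continuous_Cext with (fun t => f (zeta t e)).
      { intros x. unfold zeta. now rewrite (clamp_id e 1 e) by lra. }
      apply (continuous_comp (fun t => zeta t e) f).
      + now apply (cont2_r zeta).
      + apply Hcont. apply Hz. }
  rewrite <- L1, Fub.
  symmetry. apply is_RIntC_unique.
  apply is_RIntC_ext with
    (fun t => (p + h - z0) * f (z0 + clamp 0 1 t * (p + h - z0))
       - (p - z0) * f (z0 + clamp 0 1 t * (p - z0))).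
  { intros t Ht. rewrite Rmin_left, Rmax_right in Ht by lra.
    rewrite E2 by lra. rewrite !clamp_id by lra. ring. }
  rewrite (Cmult_comm _ (p + h - z0)), (Cmult_comm _ (p - z0)).
  apply (@is_RInt_minus C_R_NormedModule); apply is_RIntC_Cmul, is_RIntC_RInt, ray_cont; tauto.
Qed.

(** The cut-off tends to 0 in [triangle_cut]; at z0 itself only the continuity of f is used. *)
Lemma triangle p h :
  (forall t : R, 0 <= t <= 1 -> D (p + t * h) /\ p + t * h <> z0) ->
  ray_int (p + h) - ray_int p = h * RIntC (fun t => f (p + clamp 0 1 t * h)) 0 1.
Proof.
  intros Hp. unfold ray_int.
  assert (P0 := Hp 0%R ltac:(lra)). assert (P1 := Hp 1%R ltac:(lra)).
  replace (p + 0%R * h) with p in P0 by ring. replace (p + 1%R * h) with (p + h) in P1 by ring.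
  assert (C1 := ray_cont p (proj1 P0)). assert (C2 := ray_cont (p + h) (proj1 P1)).
  set (phi0 := fun t : R => f (z0 + clamp 0 1 t * (p - z0))) in *.
  set (phi1 := fun t : R => f (z0 + clamp 0 1 t * (p + h - z0))) in *.
  set (B := fun e : R => RIntC (fun t => f (z0 + clamp 0 1 e * (p + clamp 0 1 t * h - z0))) 0 1).
  set (I := RIntC (fun t => f (p + clamp 0 1 t * h)) 0 1).
  set (A := fun e : R => (RIntC phi1 0 1 - RIntC phi1 0 e) * (p + h - z0)
    - (RIntC phi0 0 1 - RIntC phi0 0 e) * (p - z0) - h * I + e * h * B e).
  assert (CA : continuous A 0%R).
  { assert (CB : continuous B 0%R).
    { apply (RIntC_param_cont (fun e t => f (z0 + clamp 0 1 e * (p + clamp 0 1 t * h - z0)))).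
      intros l t.
      apply (continuous_comp (fun x : R * R => z0 + clamp 0 1 (fst x) * (p + clamp 0 1 (snd x) * h - z0)) f).
      - solve_cont.
      - apply Hcont. simpl. apply Hstar; [|apply clamp_range; lra].
        apply Hp. apply clamp_range; lra. }
    assert (CP : forall g, cont g -> continuous (fun e => RIntC g 0 e) 0%R).
    { intros g Hg. apply (@ex_derive_continuous R_AbsRing C_R_NormedModule).
      eexists. now apply RIntC_primitive. }
    assert (CP0 := CP phi0 C1). assert (CP1 := CP phi1 C2). unfold A. solve_cont. }
  assert (A0 : forall e : R, (0 < e <= 1) -> A e = 0).
  { intros e He. unfold A.
    replace (RIntC phi1 0 1 - RIntC phi1 0 e) with (RIntC phi1 e 1)
      by (rewrite <- (RIntC_Chasles phi1 0 e 1) by auto; ring).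
    replace (RIntC phi0 0 1 - RIntC phi0 0 e) with (RIntC phi0 e 1)
      by (rewrite <- (RIntC_Chasles phi0 0 e 1) by auto; ring).
    unfold phi1, phi0. rewrite (triangle_cut p h e He Hp).
    unfold B. rewrite (clamp_id 0 1 e) by lra. fold I. ring. }
  assert (Z : A 0%R = 0).
  { apply Cmod_eq_0. apply Rle_antisym; [|apply Cmod_ge_0]. apply le_epsilon. intros x Hx.
    rewrite continuous_Ceps in CA. destruct (CA x Hx) as [d Hd].
    set (e := (Rmin (d / 2) 1)%R). assert (Q1 := Rmin_l (d / 2) 1). assert (Q2 := Rmin_r (d / 2) 1).
    assert (Dp := cond_pos d).
    assert (He : 0 < e) by (apply Rmin_glb_lt; lra). fold e in Q1, Q2.
    assert (K : Cmod (A e - A 0%R)%C < x).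
    { apply Hd. unfold ball; simpl. unfold AbsRing_ball, abs, minus, plus, opp; simpl.
      rewrite Rabs_pos_eq; lra. }
    rewrite A0 in K by lra. replace (0 - A 0%R) with (- A 0%R) in K by ring.
    rewrite Cmod_opp in K. lra. }
  unfold A in Z.
  assert (Zp : forall g, RIntC g 0 0 = 0) by (intros g; apply (@RInt_point C_R_CompleteNormedModule)).
  rewrite !Zp in Z. apply Ceq_minus. rewrite <- Z. ring.
Qed.

Lemma ray_int_increment p : D p -> exists d : R, 0 < d /\ forall h, Cmod h < d ->
  (forall t : R, 0 <= t <= 1 -> D (p + t * h)) /\
  ray_int (p + h) - ray_int p = h * RIntC (fun t => f (p + clamp 0 1 t * h)) 0 1.
Proof.
  intros Hp. destruct (proj1 (locally_Ceps p D) (HD p Hp)) as [d [Hd K]].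
  assert (Sm : forall h (t : R), (0 <= t <= 1) -> Cmod h < d -> D (p + t * h)).
  { intros h t Ht Hh. apply K. replace (p + t * h - p) with (t * h) by ring.
    eapply Rle_lt_trans; [now apply Cmod_tz|auto]. }
  destruct (Ceq_dec p z0) as [E|N].
  - exists d. split; auto. intros h Hh. split; [now auto|].
    subst p. unfold ray_int. rewrite (Cmult_comm _ (z0 - z0)).
    replace (z0 + h - z0) with h by ring. ring.
  - assert (N' : 0 < Cmod (p - z0)).
    { apply Cmod_gt_0. intros E. apply N. now apply Ceq_minus. }
    exists (Rmin d (Cmod (p - z0))). split; [now apply Rmin_glb_lt|].
    intros h Hh. assert (Q1 := Rlt_le_trans _ _ _ Hh (Rmin_l _ _)).
    assert (Q2 := Rlt_le_trans _ _ _ Hh (Rmin_r _ _)).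
    split; auto. apply triangle. intros t Ht. split; auto.
    intros E. assert (A := Cmod_tz t h Ht).
    replace (t * h) with (- (p - z0)) in A.
    + rewrite Cmod_opp in A. lra.
    + rewrite <- E. ring.
Qed.

(** Cauchy's theorem on a star-shaped domain.  The function may fail to be differentiable at the
    centre, so that a singularity removed by continuity can be placed there. *)
Theorem star_primitive : exists F : C -> C, forall z, D z -> cderiv F z (f z).
Proof.
  exists ray_int. intros p Hp. destruct (ray_int_increment p Hp) as [d [Hd K]].
  apply cderiv_iff. intros e He. assert (Cf := Hcont p Hp). rewrite continuous_C_iff in Cf.
  destruct (Cf e He) as [d' [Hd' K']].
  exists (Rmin d d'). split; [now apply Rmin_glb_lt|].
  intros h Hh. assert (Q1 := Rlt_le_trans _ _ _ Hh (Rmin_l _ _)).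
  assert (Q2 := Rlt_le_trans _ _ _ Hh (Rmin_r _ _)).
  destruct (K h Q1) as [K1 K2]. rewrite K2.
  assert (Cs := seg_cont p h K1).
  replace (_ - _) with (h * (RIntC (fun t => f (p + clamp 0 1 t * h)) 0 1 - f p)) by ring.
  rewrite Cmod_mult, Rmult_comm. apply Rmult_le_compat_r; [apply Cmod_ge_0|].
  replace (f p) with (RIntC (fun _ => f p) 0 1).
  2: { transitivity (@scal R_AbsRing C_R_NormedModule (1 - 0)%R (f p)).
       - apply (@RInt_const C_R_CompleteNormedModule).
       - rewrite scal_R_Cmult. rewrite RtoC_minus. ring. }
  replace e with ((1 - 0) * e)%R by ring.
  apply (RIntC_norm (fun t => f (p + clamp 0 1 t * h) - f p) (fun _ => e) 0 1); [lra| |apply (@is_RInt_const R_NormedModule)|].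
  - apply (@is_RInt_minus C_R_NormedModule); apply is_RIntC_RInt; auto.
    intros t. apply continuous_Cconst.
  - intros t Ht. left. apply K'. rewrite clamp_id by lra.
    replace (p + t * h - p) with (t * h) by ring.
    eapply Rle_lt_trans; [now apply Cmod_tz|auto].
Qed.

End Primitive.

(** * Moving the path of integration *)

Lemma rderiv_fst (g : R -> C) (t : R) (l : C) : rderiv g t l -> is_derive (fun x => fst (g x)) t (fst l).
Proof.
  intros H. apply (@filterdiff_comp' R_AbsRing R_NormedModule C_R_NormedModule R_NormedModule g (fun z => fst z) t _ (fun z => fst z) H).
  apply filterdiff_linear, is_linear_fst.
Qed.

Lemma rderiv_snd (g : R -> C) (t : R) (l : C) : rderiv g t l -> is_derive (fun x => snd (g x)) t (snd l).
Proof.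
  intros H. apply (@filterdiff_comp' R_AbsRing R_NormedModule C_R_NormedModule R_NormedModule g (fun z => snd z) t _ (fun z => snd z) H).
  apply filterdiff_linear, is_linear_snd.
Qed.

Lemma segment_bound (F f : C -> C) (z1 z2 : C) (M : R) :
  (forall t : R, 0 <= t <= 1 -> cderiv F (z1 + t * (z2 - z1)) (f (z1 + t * (z2 - z1)))
     /\ Cmod (f (z1 + t * (z2 - z1))%C) <= M) ->
  Cmod (F z2 - F z1) <= 2 * (Cmod (z2 - z1)%C * M).
Proof.
  intros H.
  assert (K := C_mean_value (fun t => F (z1 + t * (z2 - z1)))
    (fun t => (z2 - z1) * f (z1 + t * (z2 - z1))) (Cmod (z2 - z1)%C * M)). simpl in K.
  replace (z1 + 1 * (z2 - z1)) with z2 in K by ring.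
  replace (z1 + 0 * (z2 - z1)) with z1 in K by ring.
  apply K. intros t Ht. destruct (H t Ht) as [H1 H2].
  assert (D := rderiv_comp F _ t _ _ H1 (rderiv_affine z1 (z2 - z1) t)).
  split; [|split].
  - apply (rderiv_fst _ _ _ D).
  - apply (rderiv_snd _ _ _ D).
  - rewrite Cmod_mult. apply Rmult_le_compat_l; auto. apply Cmod_ge_0.
Qed.

Lemma constant_on_segment (F : C -> C) (z1 z2 : C) :
  (forall t : R, 0 <= t <= 1 -> cderiv F (z1 + t * (z2 - z1)) 0) -> F z1 = F z2.
Proof.
  intros H. symmetry. apply Ceq_minus, Cmod_eq_0. apply Rle_antisym; [|apply Cmod_ge_0].
  replace 0%R with (2 * (Cmod (z2 - z1)%C * 0))%R by ring.
  apply (segment_bound F (fun _ => 0)). intros t Ht. split; [now apply H|]. rewrite Cmod_0; lra.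
Qed.

Lemma Int_approx (f : R -> C) (e : R) : dom f -> 0 < e ->
  exists T0, 0 < T0 /\ forall T, T0 <= T -> Cmod (Int f - RIntC f (- T) T) < e.
Proof.
  intros [Hc [M HM]] He. assert (PM := dombd_pos _ _ HM).
  assert (He' : 0 < e / (2 * (M + 1))) by (apply Rdiv_lt_0_compat; lra).
  destruct (atan_p_infty _ He') as [T HT].
  exists (Rmax T 0 + 1)%R. assert (Y1 := Rmax_l T 0). assert (Y2 := Rmax_r T 0).
  split; [lra|]. intros Y HY. specialize (HT Y ltac:(lra)).
  eapply Rle_lt_trans; [apply (Int_tail f M); auto; lra|].
  rewrite atan_opp. assert (AB := atan_bound Y).
  apply Rle_lt_trans with (M * (2 * (e / (2 * (M + 1)))))%R.
  - apply Rmult_le_compat_l; lra.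
  - apply Rlt_le_trans with ((M + 1) * (2 * (e / (2 * (M + 1)))))%R.
    + apply Rmult_lt_compat_r; lra.
    + right. field. lra.
Qed.

Lemma RIntC_line (F f : C -> C) (p dir : C) (a b : R) :
  cont (fun t => f (p + t * dir) * dir) ->
  (forall t : R, cderiv F (p + t * dir) (f (p + t * dir))) ->
  RIntC (fun t => f (p + t * dir) * dir) a b = F (p + b * dir) - F (p + a * dir).
Proof.
  intros Hc HF. apply is_RIntC_unique.
  apply (is_RIntC_derive (fun t => F (p + t * dir))). intros t _. split; auto.
  eapply rderiv_eq; [apply (rderiv_comp F); [apply HF|apply rderiv_affine]|].
  ring.
Qed.

Lemma wt_small (M e : R) : 0 <= M -> 0 < e -> exists T, 0 < T /\ forall t, T <= Rabs t -> M * wt t < e.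
Proof.
  intros HM He. exists (M / e + 1)%R.
  assert (Q : 0 <= M / e) by (apply Rmult_le_pos; [lra|left; now apply Rinv_0_lt_compat]).
  split; [lra|]. intros t Ht. unfold wt.
  assert (E : (t * t = Rabs t * Rabs t)%R) by exact (Rsqr_abs _).
  apply (Rmult_lt_reg_r (1 + t * t)); [nra|]. rewrite Rmult_assoc, Rinv_l, Rmult_1_r by nra.
  assert (M = e * (M / e))%R by (field; lra).
  rewrite H at 1. apply Rmult_lt_compat_l; auto. rewrite E. nra.
Qed.

(** Integrals along parallel lines agree when the integrand has a primitive between them and
    decays at both ends of the strip. *)
Lemma line_shift (F f : C -> C) (a b : R) (dir : C) (M T0 : R) : a <= b ->
  (forall (p t : R), a <= p <= b -> cderiv F (p + t * dir) (f (p + t * dir))) ->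
  (forall (p t : R), a <= p <= b -> T0 <= Rabs t -> Cmod (f (p + t * dir)%C) <= M * wt t) ->
  dom (fun t => f (a + t * dir) * dir) -> dom (fun t => f (b + t * dir) * dir) ->
  Int (fun t => f (a + t * dir) * dir) = Int (fun t => f (b + t * dir) * dir).
Proof.
  intros Hab HF Hb Da Db.
  apply C_eq_eps. intros e He.
  destruct (Int_approx _ (e / 4) Da ltac:(lra)) as [T1 [T1p H1]].
  destruct (Int_approx _ (e / 4) Db ltac:(lra)) as [T2 [T2p H2]].
  destruct (wt_small (4 * (b - a) * Rabs M) (e / 4)) as [T3 [T3p H3]]; [|lra|].
  { apply Rmult_le_pos; [lra|apply Rabs_pos]. }
  set (T := (Rabs T0 + T1 + T2 + T3)%R).
  assert (A0 := Rabs_pos T0). assert (A1 := Rle_abs T0).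
  assert (TT : 0 < T) by (unfold T; lra).
  specialize (H1 T ltac:(unfold T; lra)). specialize (H2 T ltac:(unfold T; lra)).
  rewrite (RIntC_line F f) in H1;  [|apply Da|intros; apply HF; lra].
  rewrite (RIntC_line F f) in H2; [|apply Db|intros; apply HF; lra].
  assert (S : forall t, (T <= Rabs t) -> Cmod (F (b + t * dir)%C - F (a + t * dir)%C) <= e / 8).
  { intros t Ht. eapply Rle_trans.
    - apply (segment_bound F f _ _ (M * wt t)). intros x Hx.
      replace (a + t * dir + x * (b + t * dir - (a + t * dir))) with ((a + x * (b - a))%R + t * dir)
        by (rewrite RtoC_plus, RtoC_mult, RtoC_minus; ring).
      assert (Hp : a <= a + x * (b - a) <= b) by nra.
      split; [now apply HF|]. apply Hb; auto. unfold T in Ht. lra.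
    - replace (b + t * dir - (a + t * dir)) with (RtoC (b - a)) by (rewrite RtoC_minus; ring).
      rewrite Cmod_R, Rabs_pos_eq by lra.
      specialize (H3 t ltac:(unfold T in Ht; lra)).
      assert (W := wt_pos t). assert (MM := Rle_abs M).
      assert (M * wt t <= Rabs M * wt t) by (apply Rmult_le_compat_r; lra).
      assert ((b - a) * (M * wt t) <= (b - a) * (Rabs M * wt t)) by (apply Rmult_le_compat_l; lra).
      lra. }
  assert (S1 := S T ltac:(rewrite Rabs_pos_eq; lra)).
  assert (S2 := S (- T)%R ltac:(rewrite Rabs_Ropp, Rabs_pos_eq; lra)).
  set (Ia := Int (fun t => f (a + t * dir) * dir)) in *.
  set (Ib := Int (fun t => f (b + t * dir) * dir)) in *.
  set (Fa := F (a + T * dir)) in *. set (Fb := F (b + T * dir)) in *.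
  set (Ga := F (a + (- T)%R * dir)) in *. set (Gb := F (b + (- T)%R * dir)) in *.
  replace (Ia - Ib) with (((Ia - (Fa - Ga)) - (Ib - (Fb - Gb))) + ((Gb - Ga) - (Fb - Fa))) by ring.
  eapply Rle_trans; [apply Cmod_triangle|].
  assert (K1 := Cmod_triangle' (Ia - (Fa - Ga)) (Ib - (Fb - Gb))).
  assert (K2 := Cmod_triangle' (Gb - Ga) (Fb - Fa)). lra.
Qed.

(** L'Hopital's rule: the value that makes the quotient continuous at a common zero. *)
Lemma removable_quotient (N S : C -> C) (z0 n s : C) :
  cderiv N z0 n -> cderiv S z0 s -> N z0 = 0 -> S z0 = 0 -> s <> 0 ->
  continuous (fun z => if Ceq_dec z z0 then n / s else N z / S z) z0.
Proof.
  rewrite !cderiv_iff. intros HN HS N0 S0 Hs. apply continuous_C_iff. intros e He.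
  assert (Ps := proj1 (Cmod_gt_0 s) Hs). assert (Pn := Cmod_ge_0 n).
  set (q := (Cmod n / Cmod s + 1)%R).
  assert (Hq : 1 <= q).
  { unfold q. assert (0 <= Cmod n / Cmod s); [|lra].
    apply Rmult_le_pos; auto. left. now apply Rinv_0_lt_compat. }
  set (r := (Rmin (Cmod s / 2) (e * Cmod s / (4 * (q + 1))))%R).
  assert (Hr : 0 < r).
  { apply Rmin_glb_lt; [lra|]. apply Rdiv_lt_0_compat; [now apply Rmult_lt_0_compat|lra]. }
  assert (R1 := Rmin_l (Cmod s / 2) (e * Cmod s / (4 * (q + 1)))).
  assert (R2 := Rmin_r (Cmod s / 2) (e * Cmod s / (4 * (q + 1)))). fold r in R1, R2.
  destruct (HN r Hr) as [d1 [D1 K1]]. destruct (HS r Hr) as [d2 [D2 K2]].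
  exists (Rmin d1 d2). split; [now apply Rmin_glb_lt|]. intros w Hw.
  destruct (Ceq_dec z0 z0) as [_|X]; [|now elim X].
  destruct (Ceq_dec w z0) as [->|Hn].
  { replace (n / s - n / s) with (RtoC 0) by ring. now rewrite Cmod_0. }
  set (h := w - z0). assert (Ew : w = z0 + h) by (unfold h; ring).
  assert (Hh : h <> 0) by (intros E; apply Hn; now apply Ceq_minus).
  assert (Ph := proj1 (Cmod_gt_0 h) Hh).
  specialize (K1 h (Rlt_le_trans _ _ _ Hw (Rmin_l _ _))).
  specialize (K2 h (Rlt_le_trans _ _ _ Hw (Rmin_r _ _))).
  rewrite <- Ew, N0 in K1. rewrite <- Ew, S0 in K2.
  set (A := N w - 0 - h * n) in *. set (B := S w - 0 - h * s) in *.
  assert (ES : S w = h * s + B) by (unfold B; ring). assert (EN : N w = h * n + A) by (unfold A; ring).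
  assert (LS : Cmod h * Cmod s / 2 <= Cmod (S w)).
  { rewrite ES. assert (T := Cmod_triangle_rev (h * s) B). rewrite Cmod_mult in T.
    assert (r * Cmod h <= Cmod s / 2 * Cmod h) by (apply Rmult_le_compat_r; lra). lra. }
  assert (SP : 0 < Cmod h * Cmod s) by (apply Rmult_lt_0_compat; auto).
  assert (Sn : S w <> 0) by (apply Cmod_gt_0; lra).
  replace (N w / S w - n / s) with ((A - n / s * B) / S w).
  2: { rewrite EN. replace A with (A + h * n - h * n) at 1 by ring.
       unfold B. field. auto. }
  rewrite Cmod_div by auto.
  apply (Rmult_lt_reg_r (Cmod (S w))); [lra|].
  unfold Rdiv at 1. rewrite Rmult_assoc, Rinv_l, Rmult_1_r by lra.
  eapply Rle_lt_trans; [apply Cmod_triangle'|].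
  rewrite Cmod_mult, Cmod_div by auto.
  assert (T1 : Cmod n / Cmod s * Cmod B <= q * (r * Cmod h)).
  { apply Rmult_le_compat; auto; try apply Cmod_ge_0; [|unfold q; lra].
    apply Rmult_le_pos; auto. left. now apply Rinv_0_lt_compat. }
  assert (T2 : (q + 1) * r <= e * Cmod s / 4).
  { apply Rle_trans with ((q + 1) * (e * Cmod s / (4 * (q + 1))))%R.
    - apply Rmult_le_compat_l; lra.
    - right. field. lra. }
  assert (T3 : (q + 1) * r * Cmod h <= e * Cmod s / 4 * Cmod h) by (apply Rmult_le_compat_r; lra).
  assert (T4 : e * (Cmod h * Cmod s / 2) <= e * Cmod (S w)) by (apply Rmult_le_compat_l; lra).
  assert (0 < e * (Cmod h * Cmod s)) by (apply Rmult_lt_0_compat; auto).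
  lra.
Qed.

(** At a simple zero of S that is also a zero of N the singularity of N / S is removable. *)
Lemma quotient_primitive (D : C -> Prop) (z0 : C) (N S : C -> C) (l : C) : opens D -> star D z0 -> D z0 ->
  (forall z, D z -> hol N z) -> (forall z, D z -> hol S z) -> (forall z, D z -> z <> z0 -> S z <> 0) ->
  cderiv S z0 l -> l <> 0 -> N z0 = 0 -> S z0 = 0 ->
  exists F f : C -> C, (forall z, D z -> cderiv F z (f z)) /\ (forall z, z <> z0 -> f z = N z / S z).
Proof.
  intros Ho Hs H0 HN HS Hn Hl Hl0 N0 S0. destruct (hol_cderiv _ _ (HN z0 H0)) as [n Dn].
  set (f := fun z => if Ceq_dec z z0 then n / l else N z / S z).
  assert (Ef : forall z, z <> z0 -> f z = N z / S z) by (intros z Hz; unfold f; now destruct (Ceq_dec z z0)).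
  assert (Hf : forall z, D z -> z <> z0 -> hol f z).
  { intros z Hz Hz0. apply hol_ext_loc with (fun z => N z / S z); [|apply hol_div; auto].
    generalize (locally_neq z z0 Hz0). apply filter_imp. intros y Hy. now rewrite Ef. }
  destruct (star_primitive D z0 f Ho Hs) as [F HF]; auto.
  - intros z Hz. destruct (Ceq_dec z z0) as [->|Nz]; [now apply removable_quotient|].
    now apply hol_continuous, Hf.
  - now exists F, f.
Qed.

(** * Elementary dominations *)

Lemma inv_exp_le (x : R) : 0 <= x -> exp (- x) <= / (1 + x).
Proof.
  intros H. rewrite exp_Ropp. apply Rinv_le_contravar; [lra|]. apply exp_ge_1_plus.
Qed.

Lemma gauss_dom (a A B : R) : 0 < a ->
  exists M, forall t, exp (- a * (t * t) + A * Rabs t + B) <= M * wt t.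
Proof.
  intros Ha. set (m := Rmax 1 (2 / a)).
  assert (M1 := Rmax_l 1 (2 / a)). assert (M2 := Rmax_r 1 (2 / a)). fold m in M1, M2.
  exists (exp (A * A / (2 * a) + B) * m)%R. intros t.
  apply Rle_trans with (exp (A * A / (2 * a) + B) * exp (- (a / 2 * (t * t))))%R.
  - rewrite <- exp_plus. apply exp_mono.
    assert (E : (t * t = Rabs t * Rabs t)%R) by exact (Rsqr_abs _).
    rewrite E. set (x := Rabs t).
    assert (0 <= a / 2 * ((x - A / a) * (x - A / a))) by (apply Rmult_le_pos; [lra|apply (Rle_0_sqr (x - A / a))]).
    replace (a / 2 * ((x - A / a) * (x - A / a)))%R with (a / 2 * (x * x) - A * x + A * A / (2 * a))%R in H
      by (field; lra). lra.
  - rewrite Rmult_assoc. apply Rmult_le_compat_l; [left; apply exp_pos|].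
    assert (0 <= a / 2 * (t * t)) by (apply Rmult_le_pos; nra).
    eapply Rle_trans; [now apply inv_exp_le|]. unfold wt.
    assert (Hm : 1 + t * t <= m * (1 + a / 2 * (t * t))).
    { assert (T : 1 <= m * (a / 2)).
      { apply Rle_trans with (2 / a * (a / 2))%R; [right; field; lra|].
        apply Rmult_le_compat_r; lra. }
      assert (0 <= t * t) by nra. nra. }
    apply (Rmult_le_reg_r (1 + t * t)); [nra|]. rewrite Rmult_assoc, Rinv_l by nra.
    apply (Rmult_le_reg_l (1 + a / 2 * (t * t))); [lra|].
    rewrite <- Rmult_assoc, Rinv_r by lra. lra.
Qed.

Lemma exp_dom (a B : R) : 0 < a ->
  exists M, forall t, exp (- a * Rabs t + B) <= M * wt t.
Proof.
  intros Ha. set (m := Rmax 1 (4 / (a * a))).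
  assert (M1 := Rmax_l 1 (4 / (a * a))). assert (M2 := Rmax_r 1 (4 / (a * a))). fold m in M1, M2.
  exists (exp B * m)%R. intros t. rewrite exp_plus, Rmult_comm, Rmult_assoc.
  apply Rmult_le_compat_l; [left; apply exp_pos|].
  replace (- a * Rabs t)%R with (- (a / 2 * Rabs t) + - (a / 2 * Rabs t))%R by field.
  assert (P := Rabs_pos t).
  assert (P2 : 0 <= a / 2 * Rabs t) by (apply Rmult_le_pos; lra).
  rewrite exp_plus.
  apply Rle_trans with (/ (1 + a / 2 * Rabs t) * / (1 + a / 2 * Rabs t))%R.
  { apply Rmult_le_compat; try (left; apply exp_pos); now apply inv_exp_le. }
  rewrite <- Rinv_mult. unfold wt.
  assert (E : (t * t = Rabs t * Rabs t)%R) by exact (Rsqr_abs _).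
  rewrite E. set (x := Rabs t) in *.
  assert (Hm : 1 + x * x <= m * ((1 + a / 2 * x) * (1 + a / 2 * x))).
  { assert (T : 1 <= m * (a * a / 4)).
    { apply Rle_trans with (4 / (a * a) * (a * a / 4))%R; [right; field; lra|].
      apply Rmult_le_compat_r; nra. }
    assert (0 <= x * x) by nra. assert (0 <= a * x) by nra. nra. }
  apply (Rmult_le_reg_r (1 + x * x)); [nra|]. rewrite Rmult_assoc, Rinv_l by nra.
  apply (Rmult_le_reg_l ((1 + a / 2 * x) * (1 + a / 2 * x))); [nra|].
  rewrite <- Rmult_assoc, Rinv_r by nra. lra.
Qed.

Lemma positive_lower_bound (g : R -> R) (T m : R) :
  (forall t, continuous g t) -> (forall t, 0 < g t) -> 0 < m ->
  (forall t, T <= Rabs t -> m <= g t) ->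
  exists c, 0 < c /\ forall t, c <= g t.
Proof.
  intros Hc Hp Hm Ho.
  destruct (continuity_ab_min g (- Rabs T) (Rabs T)) as [x [Hx _]].
  { assert (P := Rabs_pos T). lra. }
  { intros c _. apply continuity_pt_filterlim. apply Hc. }
  exists (Rmin m (g x)). split; [apply Rmin_glb_lt; auto|]. intros t.
  destruct (Rle_dec (Rabs t) (Rabs T)) as [A|A].
  - eapply Rle_trans; [apply Rmin_r|]. apply Hx. now apply Rabs_le_between.
  - eapply Rle_trans; [apply Rmin_l|]. apply Ho. assert (P := Rle_abs T). lra.
Qed.

(** * The Mordell integral *)

(** The coordinates of [dir_NE] and, up to sign, of the other directions. *)
Definition q4 : R := cos (PI / 4).

Lemma q4_sqr : (q4 * q4 = / 2)%R.
Proof.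
  unfold q4. rewrite cos_PI4. assert (H := Rlt_sqrt2_0).
  replace (1 / sqrt 2 * (1 / sqrt 2))%R with (/ (sqrt 2 * sqrt 2))%R by (field; lra).
  rewrite sqrt_sqrt by lra. reflexivity.
Qed.

Lemma q4_pos : / 2 < q4 < 1.
Proof.
  assert (H : 0 < q4) by (apply cos_gt_0; assert (K := PI_RGT_0); lra).
  assert (E := q4_sqr). split; nra.
Qed.

Lemma Cexp_iPI4 : Cexp (Ci * PI / 4) = (q4, q4).
Proof.
  assert (E : Ci * PI / 4 = (0, PI / 4)%R) by (apply C_eq; simpl; field).
  rewrite E. unfold Cexp, q4. apply C_eq; simpl; rewrite exp_0; rewrite Rmult_1_l; auto.
  now rewrite cos_PI4, sin_PI4.
Qed.

Lemma Cexp_miPI4 : Cexp (- (Ci * PI / 4)) = (q4, - q4)%R.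
Proof.
  replace (- (Ci * PI / 4)) with (Cconj (Ci * PI / 4)) by (apply C_eq; simpl; field).
  rewrite Cexp_conj, Cexp_iPI4. reflexivity.
Qed.

Lemma dir_SW_eq : dir_SW = (- q4, - q4)%R.
Proof. unfold dir_SW, dir_NE. now rewrite Cexp_iPI4. Qed.

Lemma dir_SE_eq : dir_SE = (q4, - q4)%R.
Proof. unfold dir_SE. now rewrite Cexp_miPI4. Qed.

Lemma dir_SW_mod : Cmod dir_SW = 1%R.
Proof.
  unfold dir_SW, dir_NE. rewrite Cmod_opp, Cexp_mod.
  replace (fst (Ci * PI / 4)) with 0%R by (simpl; field). apply exp_0.
Qed.

Lemma dir_SE_mod : Cmod dir_SE = 1%R.
Proof.
  unfold dir_SE. rewrite Cexp_mod.
  replace (fst (- (Ci * PI / 4))) with 0%R by (simpl; field). apply exp_0.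
Qed.

(** 2 i sin (PI u), the denominator of [F_integrand]. *)
Definition two_i_sin (u : C) : C := Cexp (Ci * PI * u) - Cexp (- (Ci * PI * u)).

Lemma two_i_sin_hol z : hol two_i_sin z.
Proof. unfold two_i_sin. auto 8 with hol. Qed.

Lemma two_i_sin_cderiv z : cderiv two_i_sin z (Ci * PI * (Cexp (Ci * PI * z) + Cexp (- (Ci * PI * z)))).
Proof.
  unfold two_i_sin. eapply cderiv_eq; [cderive|]. ring.
Qed.

Lemma two_i_sin_conj u : Cconj (two_i_sin u) = - two_i_sin (Cconj u).
Proof.
  unfold two_i_sin. rewrite Cminus_conj, <- !Cexp_conj.
  replace (Cconj (Ci * PI * u)) with (- (Ci * PI * Cconj u)) by (apply C_eq; simpl; ring).
  replace (Cconj (- (Ci * PI * u))) with (Ci * PI * Cconj u) by (apply C_eq; simpl; ring).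
  ring.
Qed.

Lemma two_i_sin_shift u : two_i_sin (u + 1) = - two_i_sin u.
Proof.
  unfold two_i_sin. replace (Ci * PI * (u + 1)) with (Ci * PI * u + Ci * PI) by ring.
  rewrite !Cexp_opp, !Cexp_plus, Cexp_iPI. field. apply Cexp_nz.
Qed.

Lemma two_i_sin_lower u : exp (PI * Rabs (snd u)) - 1 <= Cmod (two_i_sin u).
Proof.
  assert (P := PI_RGT_0).
  assert (M1 : Cmod (Cexp (Ci * PI * u)) = exp (- (PI * snd u))) by (rewrite Cexp_mod; f_equal; simpl; ring).
  assert (M2 : Cmod (Cexp (- (Ci * PI * u))) = exp (PI * snd u)) by (rewrite Cexp_mod; f_equal; simpl; ring).
  unfold two_i_sin. unfold Rabs. destruct Rcase_abs.
  - assert (K := Cmod_triangle_rev (Cexp (Ci * PI * u)) (- Cexp (- (Ci * PI * u)))).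
    rewrite Cmod_opp, M1, M2 in K.
    assert (exp (PI * snd u) <= 1) by (rewrite <- exp_0; apply exp_mono; nra).
    replace (PI * - snd u)%R with (- (PI * snd u))%R by ring. unfold Cminus. lra.
  - assert (K := Cmod_triangle_rev (- Cexp (- (Ci * PI * u))) (Cexp (Ci * PI * u))).
    rewrite Cmod_opp, M1, M2 in K. rewrite Cplus_comm in K.
    assert (exp (- (PI * snd u)) <= 1) by (rewrite <- exp_0; apply exp_mono; nra).
    unfold Cminus. lra.
Qed.

Lemma two_i_sin_zero u : two_i_sin u = 0 -> snd u = 0%R /\ sin (PI * fst u) = 0%R.
Proof.
  intros H. assert (K := two_i_sin_lower u). rewrite H, Cmod_0 in K.
  assert (P := PI_RGT_0). assert (E := exp_ge_1_plus (PI * Rabs (snd u))).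
  assert (Z : Rabs (snd u) = 0%R).
  { apply Rle_antisym; [|apply Rabs_pos]. assert (A := Rabs_pos (snd u)). nra. }
  assert (Z2 : snd u = 0%R) by (destruct (Req_dec (snd u) 0); auto; exfalso; now apply (Rabs_no_R0 (snd u))).
  split; auto.
  assert (G : snd (two_i_sin u) = 0%R) by now rewrite H.
  assert (E1 : Ci * PI * u = (0, PI * fst u)%R) by (apply C_eq; simpl; rewrite Z2; ring).
  unfold two_i_sin in G. rewrite E1 in G. unfold Cexp in G. simpl in G.
  rewrite Ropp_0, exp_0, sin_neg in G. lra.
Qed.

Lemma two_i_sin_nz01 u : (0 < fst u < 1) \/ snd u <> 0%R -> two_i_sin u <> 0.
Proof.
  intros H E. apply two_i_sin_zero in E. destruct E as [E1 E2].
  destruct H as [H|H]; auto. assert (P := PI_RGT_0).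
  assert (0 < sin (PI * fst u)) by (apply sin_gt_0; nra). lra.
Qed.

Lemma two_i_sin_nz12 u : (1 < fst u < 2) \/ snd u <> 0%R -> two_i_sin u <> 0.
Proof.
  intros H E. apply (two_i_sin_nz01 (u - 1)).
  - destruct H; [left|right]; simpl; lra.
  - replace u with (u - 1 + 1) in E by ring. rewrite two_i_sin_shift in E.
    replace (two_i_sin (u - 1)) with (- - two_i_sin (u - 1)) by ring. rewrite E. ring.
Qed.

Lemma two_i_sin_line_lower (p dir : C) : / 2 <= Rabs (snd dir) -> snd p = 0%R ->
  (forall t : R, two_i_sin (p + t * dir) <> 0) ->
  exists c, 0 < c /\ forall t : R, c <= Cmod (two_i_sin (p + t * dir)).
Proof.
  intros Hd Hp Hn. apply (positive_lower_bound _ 2 1); try lra.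
  - intros t. apply continuous_Cmod.
    apply (continuous_comp (fun t : R => p + t * dir) two_i_sin).
    + solve_cont.
    + apply hol_continuous, two_i_sin_hol.
  - intros t. now apply Cmod_gt_0.
  - intros t Ht. eapply Rle_trans; [|apply two_i_sin_lower].
    replace (snd (p + t * dir)) with (t * snd dir)%R by (simpl; rewrite Hp; ring).
    rewrite Rabs_mult. assert (K := exp_ge_1_plus (PI * (Rabs t * Rabs (snd dir)))).
    assert (P2 := PI2_3_2). assert (1 <= Rabs t * Rabs (snd dir)) by nra. nra.
Qed.

Lemma cont_line (f : C -> C) (p dir : C) :
  (forall t : R, continuous f (p + t * dir)) -> cont (fun t => f (p + t * dir) * dir).
Proof.
  intros H t. apply continuous_Cmult; [|apply continuous_Cconst].
  apply (continuous_comp (fun t : R => p + t * dir) f); auto.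
  solve_cont.
Qed.

(** The numerator of Mordell's integral. *)
Definition gker (w u : C) : C := Cexp (Ci * PI * u ^ 2 - u * w).

Lemma gker_hol w z : hol (gker w) z.
Proof. unfold gker. auto 8 with hol. Qed.

Lemma gker_bound (w : C) (P p t : R) : Rabs p <= P ->
  Cmod (gker w (p + t * dir_SW)%C) <= exp (- PI * (t * t) + (2 * PI * P + Cmod w) * Rabs t + P * Cmod w).
Proof.
  intros Hp. unfold gker. rewrite Cexp_mod. apply exp_mono.
  set (u := p + t * dir_SW).
  assert (E : fst (Ci * PI * u ^ 2 - u * w) = (2 * PI * (p * q4 * t) - PI * (t * t) - fst (u * w)%C)%R).
  { unfold u. rewrite dir_SW_eq. simpl.
    replace (PI * (t * t))%R with (2 * PI * (q4 * q4) * (t * t))%R by (rewrite q4_sqr; field). ring. }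
  rewrite E.
  assert (B1 : - fst (u * w)%C <= (P + Rabs t) * Cmod w).
  { assert (A := fst_le_Cmod (u * w)). rewrite Cmod_mult in A.
    assert (A2 := Rle_abs (- fst (u * w)%C)). rewrite Rabs_Ropp in A2.
    assert (Bu : Cmod u <= P + Rabs t).
    { unfold u. eapply Rle_trans; [apply Cmod_triangle|].
      rewrite Cmod_mult, dir_SW_mod, !Cmod_R. lra. }
    assert (Cmod u * Cmod w <= (P + Rabs t) * Cmod w) by (apply Rmult_le_compat_r; auto; apply Cmod_ge_0).
    lra. }
  assert (B2 : p * q4 * t <= P * Rabs t).
  { eapply Rle_trans; [apply Rle_abs|]. rewrite !Rabs_mult.
    apply Rmult_le_compat_r; [apply Rabs_pos|]. assert (Q := q4_pos).
    rewrite (Rabs_pos_eq q4) by lra. assert (A := Rabs_pos p). nra. }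
  assert (Pp := PI_RGT_0). nra.
Qed.

Lemma dom_of_bound (f : R -> C) (K : R) (g : R -> R) : cont f ->
  (forall t, Cmod (f t) <= K * g t) -> 0 <= K -> (exists M, forall t, g t <= M * wt t) -> dom f.
Proof.
  intros Hc Hb HK [M HM]. split; auto. exists (K * M)%R. intros t.
  eapply Rle_trans; [apply Hb|]. rewrite Rmult_assoc. apply Rmult_le_compat_l; auto.
Qed.

Lemma gker_dom (w : C) (p : R) : dom (fun t => gker w (p + t * dir_SW) * dir_SW).
Proof.
  apply (dom_of_bound _ 1 (fun t => exp (- PI * (t * t) + (2 * PI * Rabs p + Cmod w) * Rabs t + Rabs p * Cmod w))).
  - apply cont_line. intros t. apply hol_continuous, gker_hol.
  - intros t. rewrite Cmod_mult, dir_SW_mod, Rmult_1_l, Rmult_1_r. apply gker_bound. lra.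
  - lra.
  - apply gauss_dom, PI_RGT_0.
Qed.

Lemma dir_SW_snd : / 2 <= Rabs (snd dir_SW).
Proof.
  rewrite dir_SW_eq. simpl. rewrite Rabs_Ropp. assert (Q := q4_pos). rewrite Rabs_pos_eq; lra.
Qed.

Lemma SW_off (p t : R) : p = fst (p + t * dir_SW) \/ snd (p + t * dir_SW) <> 0%R.
Proof.
  rewrite dir_SW_eq. simpl. assert (Q := q4_pos).
  destruct (Req_dec t 0) as [->|H]; [left; ring|right]. intros E.
  nra.
Qed.

Lemma gker_two_i_sin_dom (w : C) (p : R) : (forall t : R, two_i_sin (p + t * dir_SW) <> 0) ->
  dom (fun t => gker w (p + t * dir_SW) / two_i_sin (p + t * dir_SW) * dir_SW).
Proof.
  intros Hn.
  destruct (two_i_sin_line_lower p dir_SW dir_SW_snd eq_refl Hn) as [c [Hc K]].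
  apply (dom_of_bound _ (/ c) (fun t => exp (- PI * (t * t) + (2 * PI * Rabs p + Cmod w) * Rabs t + Rabs p * Cmod w))).
  - apply (cont_line (fun u => gker w u / two_i_sin u)). intros t. apply hol_continuous.
    apply hol_div; auto; [apply gker_hol|apply two_i_sin_hol].
  - intros t. rewrite Cmod_mult, dir_SW_mod, Rmult_1_r, Cmod_div by auto.
    rewrite Rmult_comm. apply Rmult_le_compat; try apply Cmod_ge_0.
    + left. apply Rinv_0_lt_compat. specialize (K t). lra.
    + apply gker_bound. lra.
    + apply Rinv_le_contravar; auto.
  - left. now apply Rinv_0_lt_compat.
  - apply gauss_dom, PI_RGT_0.
Qed.

Definition phi (c : R) (w : C) : C := Int (fun t => gker w (c + t * dir_SW) / two_i_sin (c + t * dir_SW) * dir_SW).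

Definition gauss_line (c : R) (w : C) : C := Int (fun t => gker w (c + t * dir_SW) * dir_SW).

Lemma SW_nz01 (c t : R) : 0 < c < 1 -> two_i_sin (c + t * dir_SW) <> 0.
Proof.
  intros H. apply two_i_sin_nz01. destruct (SW_off c t) as [E|E]; [left|right; auto].
  rewrite <- E. lra.
Qed.

Lemma SW_nz12 (c t : R) : 0 < c < 1 -> two_i_sin ((c + 1)%R + t * dir_SW) <> 0.
Proof.
  intros H. apply two_i_sin_nz12. destruct (SW_off (c + 1) t) as [E|E]; [left|right; auto].
  rewrite <- E. lra.
Qed.

(** The factor e^(2 pi i u) - 1 that comes from the period cancels the denominator. *)
Lemma phi_period_difference (c : R) (w : C) : 0 < c < 1 ->
  phi c (w - 2 * Ci * PI) = phi c w + gauss_line c (w - Ci * PI).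
Proof.
  intros Hc. unfold phi, gauss_line.
  assert (H := fun t => SW_nz01 c t Hc).
  rewrite <- Int_plus; [|now apply gker_two_i_sin_dom|apply gker_dom].
  apply Int_ext. intros t. specialize (H t). set (u := c + t * dir_SW) in *.
  unfold gker.
  replace (Ci * PI * u ^ 2 - u * (w - 2 * Ci * PI)) with (Ci * PI * u ^ 2 - u * w + (Ci * PI * u + Ci * PI * u)) by ring.
  replace (Ci * PI * u ^ 2 - u * (w - Ci * PI)) with (Ci * PI * u ^ 2 - u * w + Ci * PI * u) by ring.
  rewrite !Cexp_plus. unfold two_i_sin in *. rewrite Cexp_opp in *.
  field. split; auto using Cexp_nz.
  intros E. apply H. assert (N := Cexp_nz (Ci * PI * u)).
  transitivity ((Cexp (Ci * PI * u) * Cexp (Ci * PI * u) - 1) / Cexp (Ci * PI * u)); [field; auto|].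
  rewrite E. field; auto.
Qed.

Lemma phi_translate (c : R) (w : C) : 0 < c < 1 ->
  phi (c + 1) w = Cexp (- w) * phi c (w - 2 * Ci * PI).
Proof.
  intros Hc. unfold phi. assert (H := fun t => SW_nz01 c t Hc).
  rewrite <- Int_Cmul by now apply gker_two_i_sin_dom.
  apply Int_ext. intros t. specialize (H t).
  replace ((c + 1)%R + t * dir_SW) with (c + t * dir_SW + 1) by (rewrite RtoC_plus; ring).
  set (u := c + t * dir_SW) in *. rewrite two_i_sin_shift. unfold gker.
  replace (Ci * PI * (u + 1) ^ 2 - (u + 1) * w) with
    (- w + (Ci * PI * u ^ 2 - u * (w - 2 * Ci * PI)) + Ci * PI) by ring.
  rewrite !Cexp_plus, Cexp_iPI. field. auto.
Qed.

Definition strip (u : C) : Prop := (0 < fst u - snd u < 2).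

Lemma strip_open : opens strip.
Proof.
  intros z Hz. unfold strip in *.
  assert (K : continuous (fun z : C => fst z - snd z)%R z).
  { apply (@continuous_minus _ R_AbsRing R_NormedModule (fun z : C => fst z) (fun z : C => snd z)).
    -- apply (continuous_Cfst (fun w : C => w)), continuous_id.
    -- apply (continuous_Csnd (fun w : C => w)), continuous_id. }
  set (m := Rmin (fst z - snd z) (2 - (fst z - snd z))).
  assert (M1 := Rmin_l (fst z - snd z) (2 - (fst z - snd z))).
  assert (M2 := Rmin_r (fst z - snd z) (2 - (fst z - snd z))). fold m in M1, M2.
  assert (Hm : 0 < m) by (apply Rmin_glb_lt; lra).
  generalize (continuous_Reps _ _ _ K Hm). apply filter_imp.
  intros w Hw. apply Rabs_def2 in Hw. lra.
Qed.

Lemma strip_star : star strip 1.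
Proof.
  intros z Hz t Ht. unfold strip in *. simpl.
  replace (1 + (t * (fst z + - (1)) - 0 * (snd z + - 0)) - (0 + (t * (snd z + - 0) + 0 * (fst z + - (1)))))%R
    with (1 + t * (fst z - snd z - 1))%R by ring. nra.
Qed.

Lemma strip_nz (u : C) : strip u -> u <> 1 -> two_i_sin u <> 0.
Proof.
  intros Hu Hn E. assert (E0 := E). apply two_i_sin_zero in E. destruct E as [E1 E2].
  unfold strip in Hu. rewrite E1 in Hu.
  destruct (Rtotal_order (fst u) 1) as [A|[A|A]].
  - now apply (two_i_sin_nz01 u); [left; lra|].
  - apply Hn. apply C_eq; auto.
  - now apply (two_i_sin_nz12 u); [left; lra|].
Qed.

Lemma two_i_sin_at_1 : two_i_sin 1 = 0.
Proof.
  unfold two_i_sin. rewrite Cexp_opp, !Cmult_1_r, Cexp_iPI. field.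
Qed.

Lemma two_i_sin_derivative_at_1 : Ci * PI * (Cexp (Ci * PI * 1) + Cexp (- (Ci * PI * 1))) <> 0.
Proof.
  rewrite Cexp_opp, !Cmult_1_r, Cexp_iPI. assert (P := PI_RGT_0).
  replace (- (1) + / - (1)) with (RtoC (- (2))).
  - intros E. apply (f_equal snd) in E. simpl in E. lra.
  - rewrite RtoC_opp. field.
Qed.

Definition residue_num (w u : C) : C := gker w u - Cexp (- w) * gker 0 u.

(** The integrand of [phi] has its only pole in the strip at 1; subtracting a multiple of the
    integrand for the argument 0 removes it. *)
Lemma phi_residue (c : R) (w : C) : 0 < c < 1 ->
  phi (c + 1) w - phi c w = Cexp (- w) * (phi (c + 1) 0 - phi c 0).
Proof.
  intros Hc.
  assert (Hn : forall z, hol (residue_num w) z).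
  { intros z. unfold residue_num.
    apply (hol_minus (gker w) (fun u => Cexp (- w) * gker 0 u)); [apply gker_hol|].
    apply (hol_mult (fun _ => Cexp (- w)) (gker 0)); [apply hol_const|apply gker_hol]. }
  destruct (quotient_primitive strip 1 (residue_num w) two_i_sin
      (Ci * PI * (Cexp (Ci * PI * 1) + Cexp (- (Ci * PI * 1)))) strip_open strip_star) as [F [f [HF Ef]]];
    auto using two_i_sin_hol, strip_nz, two_i_sin_cderiv, two_i_sin_at_1, two_i_sin_derivative_at_1.
  { unfold strip. simpl. lra. }
  { unfold residue_num, gker.
    replace (Ci * PI * 1 ^ 2 - 1 * w) with (- w + (Ci * PI * 1 ^ 2 - 1 * 0)) by ring.
    rewrite Cexp_plus. ring. }
  assert (Hfst : forall p t : R, (fst (p + t * dir_SW)%C - snd (p + t * dir_SW)%C = p)%R).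
  { intros p t. rewrite dir_SW_eq. simpl. ring. }
  assert (Efar : forall p t : R, p <> 1%R \/ t <> 0%R ->
    f (p + t * dir_SW) = residue_num w (p + t * dir_SW) / two_i_sin (p + t * dir_SW)).
  { intros p t Hpt. apply Ef. intros E.
    destruct Hpt as [Hp|Ht].
    - apply Hp. rewrite <- (Hfst p t), E. simpl. ring.
    - apply (f_equal snd) in E. rewrite dir_SW_eq in E. simpl in E. assert (Q := q4_pos).
      nra. }
  assert (Eline : forall p t : R, p <> 1%R -> two_i_sin (p + t * dir_SW) <> 0 ->
    f (p + t * dir_SW) * dir_SW = gker w (p + t * dir_SW) / two_i_sin (p + t * dir_SW) * dir_SW
      - Cexp (- w) * (gker 0 (p + t * dir_SW) / two_i_sin (p + t * dir_SW) * dir_SW)).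
  { intros p t Hp Hs. rewrite Efar by auto. unfold residue_num. field. auto. }
  assert (N1 := fun t => SW_nz01 c t Hc). assert (N2 := fun t => SW_nz12 c t Hc).
  assert (D1 : dom (fun t => f (c + t * dir_SW) * dir_SW)).
  { eapply dom_ext; [intros t; symmetry; apply Eline; [lra|apply N1]|].
    apply dom_minus; [|apply dom_Cmul]; now apply gker_two_i_sin_dom. }
  assert (D2 : dom (fun t => f ((c + 1)%R + t * dir_SW) * dir_SW)).
  { eapply dom_ext; [intros t; symmetry; apply Eline; [lra|apply N2]|].
    apply dom_minus; [|apply dom_Cmul]; now apply gker_two_i_sin_dom. }
  assert (I1 : Int (fun t => f (c + t * dir_SW) * dir_SW) = phi c w - Cexp (- w) * phi c 0).
  { unfold phi. assert (A1 := gker_two_i_sin_dom w c N1). assert (A2 := gker_two_i_sin_dom 0 c N1).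
    rewrite <- (Int_Cmul _ _ A2), <- (Int_minus _ _ A1 (dom_Cmul _ _ A2)).
    apply Int_ext. intros t. apply Eline; [lra|apply N1]. }
  assert (I2 : Int (fun t => f ((c + 1)%R + t * dir_SW) * dir_SW) = phi (c + 1) w - Cexp (- w) * phi (c + 1) 0).
  { unfold phi. assert (A1 := gker_two_i_sin_dom w (c + 1) N2). assert (A2 := gker_two_i_sin_dom 0 (c + 1) N2).
    rewrite <- (Int_Cmul _ _ A2), <- (Int_minus _ _ A1 (dom_Cmul _ _ A2)).
    apply Int_ext. intros t. apply Eline; [lra|apply N2]. }
  assert (I : Int (fun t => f (c + t * dir_SW) * dir_SW) = Int (fun t => f ((c + 1)%R + t * dir_SW) * dir_SW)).
  { destruct (gauss_dom PI (2 * PI * 2 + Cmod w) (2 * Cmod w) PI_RGT_0) as [M1 HM1].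
    destruct (gauss_dom PI (2 * PI * 2 + Cmod 0) (2 * Cmod 0) PI_RGT_0) as [M2 HM2].
    apply (line_shift F f c (c + 1) dir_SW (M1 + Cmod (Cexp (- w)) * M2) 2); auto; [lra| |].
    - intros p t Hp. apply HF. unfold strip. rewrite Hfst. lra.
    - intros p t Hp Ht.
      assert (Ht0 : t <> 0%R) by (intros ->; rewrite Rabs_R0 in Ht; lra).
      rewrite Efar by auto.
      set (u := p + t * dir_SW).
      assert (L : 1 <= Cmod (two_i_sin u)).
      { eapply Rle_trans; [|apply two_i_sin_lower].
        replace (snd u) with (t * snd dir_SW)%R by (unfold u; simpl; ring).
        rewrite Rabs_mult. assert (K := exp_ge_1_plus (PI * (Rabs t * Rabs (snd dir_SW)))).
        assert (P2 := PI2_3_2). assert (Q := dir_SW_snd).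
        assert (1 <= Rabs t * Rabs (snd dir_SW)) by nra. nra. }
      assert (Su : two_i_sin u <> 0) by (apply Cmod_gt_0; lra).
      rewrite Cmod_div by auto.
      assert (Ap : Rabs p <= 2) by (apply Rabs_le; lra).
      apply Rle_trans with (Cmod (residue_num w u)).
      { unfold Rdiv. rewrite <- (Rmult_1_r (Cmod (residue_num w u))) at 2.
        apply Rmult_le_compat_l; [apply Cmod_ge_0|].
        rewrite <- Rinv_1. apply Rinv_le_contravar; lra. }
      unfold residue_num. eapply Rle_trans; [apply Cmod_triangle'|].
      rewrite Cmod_mult.
      assert (B1 := gker_bound w 2 p t Ap). assert (B2 := gker_bound 0 2 p t Ap).
      fold u in B1, B2. specialize (HM1 t). specialize (HM2 t).
      assert (B3 : Cmod (gker 0 u) <= M2 * wt t) by lra.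
      assert (B4 := Rmult_le_compat_l _ _ _ (Cmod_ge_0 (Cexp (- w))) B3). lra. }
  rewrite I1, I2 in I.
  replace (Cexp (- w) * (phi (c + 1) 0 - phi c 0)) with
    (Cexp (- w) * phi (c + 1) 0 - Cexp (- w) * phi c 0) by ring.
  replace (phi (c + 1) w) with ((phi (c + 1) w - Cexp (- w) * phi (c + 1) 0) + Cexp (- w) * phi (c + 1) 0) by ring.
  rewrite <- I. ring.
Qed.

Lemma gauss_line_edom (c : R) (w : C) :
  edom (fun t => Cexp (Ci * PI * (c + t * dir_SW) ^ 2) * dir_SW) (fun t => - (c + t * dir_SW)) w 1.
Proof.
  assert (Cl : cont (fun t => c + t * dir_SW)).
  { intros t. solve_cont. }
  repeat split.
  - apply (cont_line (fun u => Cexp (Ci * PI * u ^ 2))). intros t. apply hol_continuous. auto 8 with hol.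
  - intros t. now apply continuous_Copp.
  - lra.
  - destruct (gauss_dom PI (2 * PI * Rabs c + Cmod w + 1) (Rabs c * Cmod w + Rabs c) PI_RGT_0) as [M HM].
    exists M. intros t. eapply Rle_trans; [|apply HM].
    rewrite Cmod_mult, dir_SW_mod, Rmult_1_r, Cmod_opp.
    set (u := c + t * dir_SW).
    replace (Cmod (Cexp (Ci * PI * u ^ 2)) * exp (1 * Cmod u) * Cmod (Cexp (w * - u)))%R
      with (Cmod (gker w u) * exp (Cmod u))%R.
    2: { unfold gker, Cminus. rewrite Cexp_plus, Cmod_mult, Rmult_1_l.
         replace (w * - u) with (- (u * w)) by ring. ring. }
    apply Rle_trans with (exp (- PI * (t * t) + (2 * PI * Rabs c + Cmod w) * Rabs t + Rabs c * Cmod w) * exp (Rabs c + Rabs t))%R.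
    + apply Rmult_le_compat; try (left; apply exp_pos); try apply Cmod_ge_0.
      * apply gker_bound. lra.
      * apply exp_mono. unfold u. eapply Rle_trans; [apply Cmod_triangle|].
        rewrite Cmod_mult, dir_SW_mod, !Cmod_R. lra.
    + rewrite <- exp_plus. apply exp_mono. lra.
Qed.

Lemma gauss_line_eint (c : R) (w : C) :
  gauss_line c w = eint (fun t => Cexp (Ci * PI * (c + t * dir_SW) ^ 2) * dir_SW) (fun t => - (c + t * dir_SW)) w.
Proof.
  unfold gauss_line, eint. apply Int_ext. intros t. unfold gker, Cminus.
  rewrite Cexp_plus. replace (w * - (c + t * dir_SW)) with (- ((c + t * dir_SW) * w)) by ring. ring.
Qed.

Lemma filterlim_dom0 (g : R -> C) (M : R) : dombd M g ->
  filterlim g (Rbar_locally m_infty) (locally (RtoC 0)) /\ filterlim g (Rbar_locally p_infty) (locally (RtoC 0)).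
Proof.
  intros HM. assert (PM := dombd_pos _ _ HM).
  split; (rewrite filterlim_C by apply Rbar_locally_filter); intros e He;
    destruct (wt_small M e PM He) as [T [HT K]].
  - exists (- T)%R. intros x Hx. replace (g x - 0) with (g x) by ring.
    eapply Rle_lt_trans; [apply HM|]. apply K. rewrite Rabs_left; lra.
  - exists T. intros x Hx. replace (g x - 0) with (g x) by ring.
    eapply Rle_lt_trans; [apply HM|]. apply K. rewrite Rabs_pos_eq; lra.
Qed.

Lemma Int_derive0 (F f : R -> C) (M : R) : cont f -> (forall t, rderiv F t (f t)) -> dombd M F -> Int f = 0.
Proof.
  intros Hc HF HM. destruct (filterlim_dom0 F M HM) as [H1 H2].
  rewrite (Int_derive F f 0 0); auto. ring.
Qed.

(** Integration by parts turns the derivative with respect to w into a multiple of the integral. *)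
Lemma gauss_line_derivative (c : R) (w : C) : cderiv (gauss_line c) w (Ci * w / (2 * PI) * gauss_line c w).
Proof.
  assert (P := PI_RGT_0).
  assert (P0 : RtoC PI <> 0) by (intros E; apply RtoC_inj in E; lra).
  assert (He := gauss_line_edom c w).
  apply cderiv_ext_loc with (eint (fun t => Cexp (Ci * PI * (c + t * dir_SW) ^ 2) * dir_SW) (fun t => - (c + t * dir_SW))).
  { apply filter_forall. intros z. symmetry. apply gauss_line_eint. }
  eapply cderiv_eq; [apply (eint_cderiv _ _ _ 1 He)|].
  set (E1 := eint _ _ w).
  assert (D1 := edom_dom _ _ _ _ He). assert (D2 := edom_dom _ _ _ _ (edom_mul _ _ _ _ He)).
  assert (Z : - (2 * Ci * PI) * E1 - w * gauss_line c w = 0).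
  { rewrite gauss_line_eint. unfold E1, eint.
    rewrite <- (Int_Cmul _ _ D1), <- (Int_Cmul _ _ D2), <- (Int_minus _ _ (dom_Cmul _ _ D2) (dom_Cmul _ _ D1)).
    destruct (gker_dom w c) as [Hc [M HM]].
    apply (Int_derive0 (fun t => gker w (c + t * dir_SW)) _ M).
    - apply (dom_minus _ _ (dom_Cmul (- (2 * Ci * PI)) _ D2) (dom_Cmul w _ D1)).
    - intros t. eapply rderiv_eq.
      + apply (rderiv_comp (gker w)); [|apply rderiv_affine].
        unfold gker. cderive.
      + cbv beta. replace (w * - (c + t * dir_SW)) with (- ((c + t * dir_SW) * w)) by ring.
        unfold Cminus. rewrite Cexp_plus. ring.
    - intros t. specialize (HM t). cbv beta in HM. rewrite Cmod_mult, dir_SW_mod, Rmult_1_r in HM. exact HM. }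
  replace E1 with (- ((- (2 * Ci * PI) * E1 - w * gauss_line c w) + w * gauss_line c w) / (2 * Ci * PI)).
  - rewrite Z. replace (Ci * w / (2 * PI) * gauss_line c w) with (- (Ci * Ci) * w * gauss_line c w / (2 * Ci * PI) * (- (1))).
    + replace (Ci * Ci) with (RtoC (- (1))) by (apply C_eq; simpl; ring). rewrite RtoC_opp. field.
      split; auto. apply Ci_nz.
    + field. split; auto. apply Ci_nz.
  - field. split; auto. apply Ci_nz.
Qed.

Lemma gauss_line_value (c : R) (w : C) : gauss_line c w = Cexp (Ci * w ^ 2 / (4 * PI)) * gauss_line c 0.
Proof.
  assert (P := PI_RGT_0).
  assert (P0 : RtoC PI <> 0) by (intros E; apply RtoC_inj in E; lra).
  assert (K := constant_on_segment (fun w => Cexp (- (Ci * w ^ 2 / (4 * PI))) * gauss_line c w) 0 w).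
  cbv beta in K.
  assert (E : Cexp (- (Ci * w ^ 2 / (4 * PI))) * gauss_line c w = gauss_line c 0).
  { rewrite <- K.
    - replace (- (Ci * 0 ^ 2 / (4 * PI))) with (RtoC 0) by (simpl; field; auto). rewrite Cexp_0. ring.
    - intros t _. set (z := 0 + t * (w - 0)). eapply cderiv_eq.
      + apply cderiv_mult; [|apply gauss_line_derivative].
        cderive.
      + cbv beta. field. auto. }
  rewrite <- E. rewrite Cexp_opp. field. apply Cexp_nz.
Qed.

Definition gauss : C := Int (fun t => RtoC (exp (- PI * (t * t)))).

Lemma PIC_nz : RtoC PI <> 0.
Proof. intros E; apply RtoC_inj in E. assert (P := PI_RGT_0); lra. Qed.

Lemma dir_SW_sqr : dir_SW * dir_SW = Ci.
Proof.
  rewrite dir_SW_eq. assert (Q := q4_sqr). apply C_eq; simpl; nra.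
Qed.

Lemma gker0_diag (t : R) : gker 0 (t * dir_SW) = exp (- PI * (t * t)).
Proof.
  unfold gker. rewrite <- Cexp_real. f_equal.
  replace (Ci * PI * (t * dir_SW) ^ 2 - t * dir_SW * 0) with (Ci * PI * t * t * (dir_SW * dir_SW)) by ring.
  rewrite dir_SW_sqr. apply C_eq; simpl; ring.
Qed.

(** The line is moved to the origin, where the integrand is a real Gaussian. *)
Lemma gauss_line_0 (c : R) : 0 <= c -> gauss_line c 0 = gauss * dir_SW.
Proof.
  intros Hc. destruct (star_primitive (fun _ => True) 0 (gker 0)) as [F HF].
  - intros z _. now apply filter_forall.
  - intros z _ t _. exact I.
  - intros z _. apply hol_continuous, gker_hol.
  - intros z _ _. apply gker_hol.
  - destruct (gauss_dom PI (2 * PI * c + Cmod 0) (c * Cmod 0) PI_RGT_0) as [M HM].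
    unfold gauss_line. rewrite <- (line_shift F (gker 0) 0 c dir_SW M 0); auto.
    + transitivity (dir_SW * gauss); [|ring]. unfold gauss.
      assert (D := gker_dom 0 0).
      assert (D' : dom (fun t => RtoC (exp (- PI * (t * t))))).
      { apply dom_ext with (fun t => / dir_SW * (gker 0 (0 + t * dir_SW) * dir_SW)).
        - intros t. rewrite Cplus_0_l, gker0_diag. field. intros E. assert (X := dir_SW_mod).
          rewrite E, Cmod_0 in X. lra.
        - now apply dom_Cmul. }
      rewrite <- (Int_Cmul _ _ D'). apply Int_ext. intros t.
      rewrite Cplus_0_l, gker0_diag. ring.
    + intros p t Hp _. eapply Rle_trans; [|apply HM]. apply gker_bound. apply Rabs_le; lra.
    + apply gker_dom.
    + apply gker_dom.
Qed.

Lemma gauss_conj : Cconj gauss = gauss.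
Proof.
  unfold gauss. rewrite <- Int_conj.
  - apply Int_ext. intros t. apply C_eq; simpl; ring.
  - apply dom_ext with (fun t => / dir_SW * (gker 0 (0%R + t * dir_SW) * dir_SW)).
    + intros t. rewrite Cplus_0_l, gker0_diag. field. intros E. assert (X := dir_SW_mod).
      rewrite E, Cmod_0 in X. lra.
    + apply dom_Cmul. apply gker_dom.
Qed.

Lemma rotate_SW : Cexp (- (Ci * PI / 4)) * dir_SW = - (1).
Proof. unfold dir_SW, dir_NE. rewrite Cexp_opp. field. apply Cexp_nz. Qed.

(** Two functional equations, under the shift of the argument by a period of the exponential and
    under the translation of the line by one, determine the Mordell integral. *)
Lemma phi_closed (c : R) (w : C) : 0 < c < 1 ->
  phi c w * (Cexp (- w) - 1) = gauss * (Cexp (Ci * w ^ 2 / (4 * PI) - w / 2) - Cexp (- w)).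
Proof.
  intros Hc. assert (P := PIC_nz).
  assert (R := phi_residue c w Hc).
  rewrite !phi_translate, !phi_period_difference in R by auto.
  replace (- 0) with (RtoC 0) in R by ring. rewrite Cexp_0 in R.
  rewrite (gauss_line_value c (w - Ci * PI)), (gauss_line_value c (0 - Ci * PI)), gauss_line_0 in R by lra.
  replace (Ci * (w - Ci * PI) ^ 2 / (4 * PI)) with
    ((Ci * w ^ 2 / (4 * PI) - w / 2) + w + - (Ci * PI / 4)) in R.
  2: { replace (Ci * (w - Ci * PI) ^ 2 / (4 * PI)) with
         (Ci * w ^ 2 / (4 * PI) - Ci * Ci * w / 2 + Ci * Ci * (Ci * PI / 4)) by (field; auto).
       replace (Ci * Ci) with (- RtoC 1) by (apply C_eq; simpl; ring). field; auto. }
  replace (Ci * (0 - Ci * PI) ^ 2 / (4 * PI)) with (- (Ci * PI / 4)) in R.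
  2: { replace (Ci * (0 - Ci * PI) ^ 2 / (4 * PI)) with (Ci * Ci * (Ci * PI / 4)) by (field; auto).
       replace (Ci * Ci) with (- RtoC 1) by (apply C_eq; simpl; ring). ring. }
  rewrite !Cexp_plus in R.
  assert (Rt := rotate_SW). set (E := Cexp (- (Ci * PI / 4))) in *.
  assert (Hd : E * (gauss * dir_SW) = - gauss).
  { replace (E * (gauss * dir_SW)) with (E * dir_SW * gauss) by ring. rewrite Rt. ring. }
  rewrite Hd in R.
  set (A := Cexp (Ci * w ^ 2 / (4 * PI) - w / 2)) in *.
  assert (Nw := Cexp_nz w).
  replace (A * Cexp w * E * (gauss * dir_SW)) with (- (A * Cexp w * gauss)) in R.
  2: { replace (A * Cexp w * E * (gauss * dir_SW)) with (A * Cexp w * (E * (gauss * dir_SW))) by ring.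
       rewrite Hd. ring. }
  rewrite Cexp_opp in *.
  apply Ceq_minus. apply Ceq_minus in R. rewrite <- R. field. auto.
Qed.

(** Mordell's integrand on the line of slope -1, with the denominator 2 i cos (PI u). *)
Definition psi_int (d : R) (w : C) (t : R) : C :=
  Cexp (- (Ci * PI * (d + t * dir_SE) ^ 2) + Ci * PI * (d + t * dir_SE) - (d + t * dir_SE) * w)
    / (2 * Ci * Ccos (PI * (d + t * dir_SE))) * dir_SE.

Lemma Ccos_two_i_sin (u : C) : 2 * Ci * Ccos (PI * u) = two_i_sin (u + 1 / 2).
Proof.
  unfold Ccos, two_i_sin.
  replace (Ci * (PI * u)) with (Ci * PI * u) by ring.
  assert (H : Cexp (Ci * PI / 2) = Ci).
  { assert (E : Ci * PI / 2 = (0, PI / 2)%R) by (apply C_eq; simpl; field).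
    rewrite E. unfold Cexp. apply C_eq; simpl; rewrite exp_0, ?cos_PI2, ?sin_PI2; ring. }
  replace (Ci * PI * (u + 1 / 2)) with (Ci * PI * u + Ci * PI / 2) by field.
  rewrite !Cexp_opp, Cexp_plus, H. assert (N := Cexp_nz (Ci * PI * u)).
  set (e := Cexp (Ci * PI * u)) in *.
  assert (CI : / Ci = - Ci) by (apply C_eq; simpl; field).
  replace (/ (e * Ci)) with (/ e * / Ci) by (field; split; auto; apply Ci_nz).
  rewrite CI. field. auto.
Qed.

Lemma dir_SE_conj : Cconj dir_SE = - dir_SW.
Proof. rewrite dir_SE_eq, dir_SW_eq. apply C_eq; simpl; ring. Qed.

(** Conjugation and the translation by 1/2 carry the line of slope -1 and the cosine to the line
    of slope 1 and the sine. *)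
Lemma psi_int_conj (d : R) (w : C) (t : R) : - (1 / 2) < d < 1 / 2 ->
  psi_int d w t = Cexp (w / 2 - 3 * (Ci * PI / 4)) *
    Cconj ((fun t : R => gker (Cconj (w - 2 * Ci * PI)) ((d + 1 / 2)%R + t * dir_SW)
       / two_i_sin ((d + 1 / 2)%R + t * dir_SW) * dir_SW) (- t)%R).
Proof.
  intros Hd. unfold psi_int. rewrite Ccos_two_i_sin.
  assert (Hn := SW_nz01 (d + 1 / 2) (- t) ltac:(lra)).
  set (u := (d + 1 / 2)%R + (- t)%R * dir_SW) in *.
  assert (Eu : d + t * dir_SE + 1 / 2 = Cconj u).
  { unfold u. rewrite Cplus_conj, Cmult_conj.
    replace (Cconj dir_SW) with (- dir_SE) by (rewrite dir_SE_eq, dir_SW_eq; apply C_eq; simpl; ring).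
    apply C_eq; simpl; field. }
  rewrite Eu. rewrite Cmult_conj, Cdiv_conj, two_i_sin_conj by auto.
  replace (Cconj dir_SW) with (- dir_SE) by (rewrite dir_SE_eq, dir_SW_eq; apply C_eq; simpl; ring).
  unfold gker. rewrite <- Cexp_conj.
  assert (Hn' : two_i_sin (Cconj u) <> 0).
  { intros E. apply Hn. rewrite <- (Cconj_conj (two_i_sin u)), two_i_sin_conj, E. apply C_eq; simpl; ring. }
  assert (Ee : Cexp (- (Ci * PI * (d + t * dir_SE) ^ 2) + Ci * PI * (d + t * dir_SE) - (d + t * dir_SE) * w)
    = Cexp (w / 2 - 3 * (Ci * PI / 4)) * Cexp (Cconj (Ci * PI * u ^ 2 - u * Cconj (w - 2 * Ci * PI)))).
  { rewrite <- Cexp_plus. f_equal.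
    replace (Cconj (Ci * PI * u ^ 2 - u * Cconj (w - 2 * Ci * PI)))
      with (- (Ci * PI * Cconj u ^ 2) - Cconj u * (w - 2 * Ci * PI)).
    - replace (d + t * dir_SE) with (Cconj u - 1 / 2) by (rewrite <- Eu; ring). field.
    - rewrite Cminus_conj, !Cmult_conj, Cconj_conj, Cpow_conj.
      replace (Cconj Ci) with (- Ci) by (apply C_eq; simpl; ring).
      replace (Cconj PI) with (RtoC PI) by (apply C_eq; simpl; ring). ring. }
  rewrite Ee. field. auto.
Qed.

Lemma psi_dom (d : R) (w : C) : - (1 / 2) < d < 1 / 2 -> dom (psi_int d w).
Proof.
  intros Hd. eapply dom_ext; [intros t; symmetry; now apply psi_int_conj|].
  apply dom_Cmul. apply dom_conj.
  apply (dom_reflect (fun t : R => gker (Cconj (w - 2 * Ci * PI)) ((d + 1 / 2)%R + t * dir_SW)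
       / two_i_sin ((d + 1 / 2)%R + t * dir_SW) * dir_SW)).
  apply gker_two_i_sin_dom. intros t. apply SW_nz01. lra.
Qed.

Lemma psi_phi (d : R) (w : C) : - (1 / 2) < d < 1 / 2 ->
  Int (psi_int d w) = Cexp (w / 2 - 3 * (Ci * PI / 4)) * Cconj (phi (d + 1 / 2) (Cconj (w - 2 * Ci * PI))).
Proof.
  intros Hd.
  set (g := fun t : R => gker (Cconj (w - 2 * Ci * PI)) ((d + 1 / 2)%R + t * dir_SW)
       / two_i_sin ((d + 1 / 2)%R + t * dir_SW) * dir_SW).
  assert (Hn : forall t : R, two_i_sin ((d + 1 / 2)%R + t * dir_SW) <> 0) by (intros t; apply SW_nz01; lra).
  assert (Dg : dom g) by exact (gker_two_i_sin_dom _ _ Hn).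
  transitivity (Int (fun t => Cexp (w / 2 - 3 * (Ci * PI / 4)) * Cconj (g (- t)%R))).
  { apply Int_ext. intros t. now apply psi_int_conj. }
  assert (Dr := dom_reflect g Dg).
  rewrite (Int_Cmul _ _ (dom_conj _ Dr)), (Int_conj _ Dr), (Int_reflect g Dg). reflexivity.
Qed.

(** The two Mordell integrals are proportional: their closed forms are exchanged by complex
    conjugation, because the Gaussian integral is real. *)
Lemma mordell (c d : R) (w : C) : 0 < c < 1 -> - (1 / 2) < d < 1 / 2 ->
  Cexp (- w) <> 1 ->
  phi c w = Cexp (- (Ci * PI / 4)) * Cexp (Ci * w ^ 2 / (4 * PI)) * Int (psi_int d w).
Proof.
  intros Hc Hd Hw. assert (P := PIC_nz).
  assert (Hw' : Cexp (- w) - 1 <> 0) by (intros E; apply Hw; now apply Ceq_minus).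
  rewrite psi_phi by auto.
  assert (K1 := phi_closed c w Hc).
  assert (K2 := phi_closed (d + 1 / 2) (Cconj (w - 2 * Ci * PI)) ltac:(lra)).
  apply (f_equal Cconj) in K2. rewrite !Cmult_conj, gauss_conj, !Cminus_conj, <- !Cexp_conj in K2.
  rewrite <- Cminus_conj in K2.
  set (F := Cconj (phi (d + 1 / 2) (Cconj (w - 2 * Ci * PI)))) in *.
  replace (Cconj (- Cconj (w - 2 * Ci * PI))) with (- w + 2 * Ci * PI) in K2
    by (rewrite <- Copp_conj, Cconj_conj; ring).
  replace (Cconj (Ci * Cconj (w - 2 * Ci * PI) ^ 2 / (4 * PI) - Cconj (w - 2 * Ci * PI) / 2))
    with (- (Ci * w ^ 2 / (4 * PI)) + (- w) + (- (w / 2)) + (Ci * PI + Ci * PI)) in K2.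
  2: { rewrite Cminus_conj, !Cdiv_conj, Cmult_conj, Cpow_conj, !Cmult_conj, !Cconj_conj.
       - replace (Cconj Ci) with (- Ci) by (apply C_eq; simpl; ring).
         replace (Cconj PI) with (RtoC PI) by (apply C_eq; simpl; ring).
         replace (Cconj 4) with (RtoC 4) by (apply C_eq; simpl; ring).
         replace (Cconj 2) with (RtoC 2) by (apply C_eq; simpl; ring).
         replace (- Ci * (w - 2 * Ci * PI) ^ 2 / (4 * PI)) with
           (- (Ci * w ^ 2 / (4 * PI)) + Ci * Ci * w - Ci * Ci * (Ci * PI)) by (field; auto).
         replace (Ci * Ci) with (- RtoC 1) by (apply C_eq; simpl; ring). field. auto.
       - intros E. apply RtoC_inj in E. lra.
       - apply Cmult_neq_0; auto. intros E. apply RtoC_inj in E. lra. }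
  replace (Cconj 1) with (RtoC 1) in K2 by (apply C_eq; simpl; ring).
  rewrite !Cexp_plus, Cexp_iPI, Cexp_2iPI in K2.
  replace (Ci * w ^ 2 / (4 * PI) - w / 2) with (Ci * w ^ 2 / (4 * PI) + - (w / 2)) in K1 by ring.
  rewrite Cexp_plus in K1.
  replace (w / 2 - 3 * (Ci * PI / 4)) with (w / 2 + (Ci * PI / 4 + - (Ci * PI))) by field.
  rewrite !Cexp_plus. rewrite !Cexp_opp in *. rewrite Cexp_iPI.
  set (A := Cexp (Ci * w ^ 2 / (4 * PI))) in *.
  assert (NA : A <> 0) by apply Cexp_nz.
  replace (Cexp w) with (Cexp (w / 2) * Cexp (w / 2)) in * by (rewrite <- Cexp_plus; f_equal; field).
  set (h := Cexp (w / 2)) in *. assert (Nh : h <> 0) by apply Cexp_nz.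
  set (E4 := Cexp (Ci * PI / 4)) in *. assert (N4 : E4 <> 0) by apply Cexp_nz.
  set (D := / (h * h) - 1) in *.
  replace (/ (h * h) * 1 - 1) with D in K2 by (unfold D; ring).
  replace (phi c w) with (phi c w * D / D) by (field; auto).
  replace F with (F * D / D) by (field; auto).
  rewrite K1, K2. field. repeat split; auto.
Qed.

(** * The Gamma function *)

(** Euler's integral after the substitution t = e^x, which makes it an integral over the line
    depending exponentially on z. *)
Definition eul (z : C) : C := eint (fun x => Cexp (- Cexp x)) RtoC z.

Lemma cont_RtoC : cont RtoC.
Proof. intros t. apply continuous_RtoC, continuous_id. Qed.

Lemma cont_comp_RtoC (f : C -> C) : (forall z, continuous f z) -> cont (fun t : R => f t).
Proof. intros H t. apply (continuous_comp RtoC f); auto. apply cont_RtoC. Qed.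

Lemma eul_edom (z : C) : 0 < fst z -> edom (fun x => Cexp (- Cexp x)) RtoC z (fst z / 2).
Proof.
  intros Hz. set (d := (fst z / 2)%R). assert (Hd : 0 < d) by (unfold d; lra).
  repeat split; auto.
  - apply (cont_comp_RtoC (fun x => Cexp (- Cexp x))). intros w. apply hol_continuous. auto with hol.
  - apply cont_RtoC.
  - (* e^x lies above its tangent of slope k at ln k *)
    set (k := (4 * d)%R). assert (Hk : 0 < k) by (unfold k; lra).
    destruct (exp_dom d (Rabs (k * ln k - k)) Hd) as [M HM].
    exists M. intros x. eapply Rle_trans; [|apply HM].
    rewrite !Cexp_mod, Cmod_R, <- !exp_plus. apply exp_mono. simpl.
    rewrite cos_0. set (y := exp x).
    replace (fst z) with (2 * d)%R by (unfold d; field).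
    assert (P0 := Rabs_pos (k * ln k - k)).
    assert (P1 := Rle_abs (k * ln k - k)).
    assert (Y0 : 0 < y) by apply exp_pos.
    assert (Y : k * (1 + (x - ln k)) <= y).
    { unfold y. replace x with (ln k + (x - ln k))%R at 2 by ring. rewrite exp_plus, exp_ln by auto.
      apply Rmult_le_compat_l; [lra|apply exp_ge_1_plus]. }
    assert (Q : - y + d * Rabs x + 2 * d * x <= - d * Rabs x + Rabs (k * ln k - k)).
    { destruct (Rle_dec 0 x).
      - rewrite (Rabs_pos_eq x) by auto. unfold k in Y at 1. unfold k in P1 at 1 3. lra.
      - rewrite (Rabs_left x) by lra. lra. }
    lra.
Qed.

Lemma eul_dom (z : C) : 0 < fst z -> dom (fun x => Cexp (- Cexp x) * Cexp (z * x)).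
Proof. intros H. now apply (edom_dom _ _ _ _ (eul_edom z H)). Qed.

Lemma eul_succ (z : C) : 0 < fst z -> eul (z + 1) = z * eul z.
Proof.
  intros Hz.
  assert (D1 := eul_dom z Hz).
  assert (D2 := eul_dom (z + 1) ltac:(simpl; lra)).
  assert (Z : z * eul z - eul (z + 1) = 0).
  { unfold eul, eint. rewrite <- (Int_Cmul _ _ D1), <- (Int_minus _ _ (dom_Cmul _ _ D1) D2).
    destruct D1 as [Hc [M HM]].
    apply (Int_derive0 (fun x : R => Cexp (- Cexp x) * Cexp (z * x)) _ M); auto.
    - apply (dom_minus _ _ (dom_Cmul z _ (eul_dom z Hz)) D2).
    - intros t. eapply rderiv_eq.
      + apply (rderiv_comp (fun x => Cexp (- Cexp x) * Cexp (z * x)) RtoC); [|apply rderiv_RtoC].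
        cderive.
      + replace ((z + 1) * t) with (z * t + t) by ring. rewrite Cexp_plus. ring. }
  symmetry. now apply Ceq_minus.
Qed.

Lemma eul_conj (z : C) : 0 < fst z -> eul (Cconj z) = Cconj (eul z).
Proof.
  intros Hz. unfold eul, eint. rewrite <- (Int_conj _ (eul_dom z Hz)).
  apply Int_ext. intros t. rewrite Cmult_conj, <- !Cexp_conj, Copp_conj, Cmult_conj, <- Cexp_conj.
  now replace (Cconj t) with (RtoC t) by (apply C_eq; simpl; ring).
Qed.

Lemma eul_hol (z : C) : 0 < fst z -> hol eul z.
Proof. intros Hz. exact (eint_hol _ _ _ _ (eul_edom z Hz)). Qed.

Lemma Int_limits (g : R -> C) : dom g -> exists lm lp : C,
  filterlim (fun t => RIntC g 0 t) (Rbar_locally m_infty) (locally lm) /\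
  filterlim (fun t => RIntC g 0 t) (Rbar_locally p_infty) (locally lp) /\ Int g = lp - lm.
Proof.
  intros Hg. destruct (primitive_limit_m g Hg) as [lm Hm]. destruct (primitive_limit_p g Hg) as [lp Hp].
  exists lm, lp. repeat split; auto.
  apply (Int_derive (fun t => RIntC g 0 t)); auto; [apply Hg|].
  intros t. apply RIntC_primitive, Hg.
Qed.

Lemma Euler_int_eul (z : C) : 0 < fst z -> Euler_int z = eul z.
Proof.
  intros Hz. assert (Hg := eul_dom z Hz). unfold eul, eint.
  set (g := fun x : R => Cexp (- Cexp x) * Cexp (z * x)) in *.
  destruct (Int_limits g Hg) as [lm [lp [Hm [Hp E]]]]. rewrite E.
  unfold Euler_int, CRInt_gen. apply (@is_RInt_gen_unique C_R_CompleteNormedModule (at_right 0) (Rbar_locally p_infty) _ _).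
  apply (is_RIntC_gen_derive (fun t => RIntC g 0 (ln t))); try apply Rbar_locally_filter.
  - apply within_filter. apply locally_filter.
  - apply (Filter_prod _ _ _ (fun a => (0 < a)) (fun b => (0 < b))).
    + unfold at_right, within. apply filter_forall. auto.
    + exists 0%R. auto.
    + intros a b Ha Hb t Ht. simpl in Ht.
      assert (Pt : 0 < t).
      { eapply Rlt_le_trans; [|apply Ht]. now apply Rmin_glb_lt. }
      split.
      * apply (rderiv_eq _ _ (@scal R_AbsRing C_R_NormedModule (/ t)%R (g (ln t)))).
        -- apply (@is_derive_comp R_AbsRing C_R_NormedModule (fun t => RIntC g 0 t) ln t).
           ++ apply RIntC_primitive, Hg.
           ++ apply is_derive_Reals. now apply derivable_pt_lim_ln.
        -- rewrite scal_R_Cmult. unfold g.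
           rewrite Cexp_real, exp_ln by auto. unfold Cpower. rewrite Clog_real by auto.
           replace ((z - 1) * ln t) with (z * ln t + - ln t) by ring.
           rewrite Cexp_plus, (Cexp_opp (ln t)), Cexp_real, exp_ln by auto.
           rewrite RtoC_inv by lra. ring.
      * apply (continuous_comp RtoC (fun t => Cpower t (z - 1) * Cexp (- t))); [apply cont_RtoC|].
        apply hol_continuous. apply hol_mult; [|auto with hol].
        apply hol_Cpower; [apply hol_id|]. now apply slit_pos.
  - apply (filterlim_comp _ _ _ ln (fun t => RIntC g 0 t) _ (Rbar_locally m_infty)); auto.
    apply is_lim_ln_0.
  - apply (filterlim_comp _ _ _ ln (fun t => RIntC g 0 t) _ (Rbar_locally p_infty)); auto.
    apply is_lim_ln_p.
Qed.

Lemma rising_hol (n : nat) (z : C) : hol (fun w => rising w n) z.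
Proof. induction n; simpl; auto with hol. Qed.

Lemma rising_shift (n : nat) (z : C) : rising z (S n) = z * rising (z + 1) n.
Proof.
  induction n.
  - simpl. rewrite Cplus_0_r. ring.
  - change (rising z (S (S n))) with (rising z (S n) * (z + INR (S n))). rewrite IHn.
    change (rising (z + 1) (S n)) with (rising (z + 1) n * (z + 1 + INR n)).
    rewrite S_INR, RtoC_plus. ring.
Qed.

Lemma rising_zero (n : nat) (z : C) : rising z n = 0 -> exists k : nat, (k < n)%nat /\ z = - INR k.
Proof.
  induction n; simpl; intros H.
  - exfalso. apply (f_equal fst) in H. simpl in H. lra.
  - destruct (Ceq_dec (rising z n) 0) as [E|N].
    + destruct (IHn E) as [k [Hk Ek]]. exists k. split; [lia|exact Ek].
    + exists n. split; [lia|].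
      destruct (Ceq_dec (z + INR n) 0) as [E2|N2].
      * replace z with (z + INR n - INR n) by ring. rewrite E2. ring.
      * exfalso. now apply (Cmult_neq_0 _ _ N N2).
Qed.

Lemma rising_conj (n : nat) (z : C) : rising (Cconj z) n = Cconj (rising z n).
Proof.
  induction n; simpl; [apply C_eq; simpl; ring|]. rewrite Cmult_conj, IHn. f_equal.
  apply C_eq; simpl; ring.
Qed.

Lemma INR_C_neq (a b : nat) : a <> b -> - INR a + INR b <> 0.
Proof.
  intros H E. rewrite <- RtoC_opp, <- RtoC_plus in E. apply RtoC_inj in E. apply H.
  apply INR_eq. lra.
Qed.

(** A rising factorial has only simple zeros; this is why the poles of Gamma are simple. *)
Lemma rising_simple (n k : nat) : (k < n)%nat -> exists h : C -> C,
  (forall w, rising w n = (w + INR k) * h w) /\ (forall w, hol h w) /\ h (- INR k) <> 0.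
Proof.
  induction n; intros Hk; [lia|].
  destruct (Nat.eq_dec k n) as [->|Hn].
  - exists (fun w => rising w n). split; [|split].
    + intros w. simpl. ring.
    + intros w. apply rising_hol.
    + intros E. destruct (rising_zero _ _ E) as [j [Hj Ej]].
      apply (INR_C_neq n j); [lia|]. rewrite Ej. ring.
  - destruct (IHn ltac:(lia)) as [h [H1 [H2 H3]]].
    exists (fun w => h w * (w + INR n)). split; [|split].
    + intros w. simpl. rewrite H1. ring.
    + intros w. auto with hol.
    + apply Cmult_neq_0; auto. now apply INR_C_neq.
Qed.

Lemma eul_rising_step (z : C) (m n : nat) : (m <= n)%nat -> 0 < fst z + INR m -> rising z n <> 0 ->
  eul (z + INR n) / rising z n = eul (z + INR m) / rising z m /\ rising z m <> 0.
Proof.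
  intros Hmn Hm. induction n.
  - intros Hn. replace m with O by lia. auto.
  - intros Hn. destruct (Nat.eq_dec m (S n)) as [->|Hne]; [now split|].
    assert (H1 : rising z n <> 0) by (intros E; apply Hn; simpl; rewrite E; ring).
    assert (H2 : z + INR n <> 0) by (intros E; apply Hn; simpl; rewrite E; ring).
    destruct (IHn ltac:(lia) H1) as [E1 E2]. split; [|exact E2]. rewrite <- E1.
    rewrite S_INR, RtoC_plus. replace (z + (INR n + 1)) with (z + INR n + 1) by ring.
    assert (INR m <= INR n) by (apply le_INR; lia).
    rewrite eul_succ by (simpl; lra). simpl. field. auto.
Qed.

Lemma Gamma_shift_pos (z : C) : 0 < fst z + INR (Gamma_shift z).
Proof.
  unfold Gamma_shift. destruct (archimed (- fst z)) as [H _].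
  destruct (Z.lt_ge_cases (up (- fst z)) 0) as [L|L].
  - assert (IZR (up (- fst z)) < 0) by (apply IZR_lt; exact L).
    replace (Z.to_nat (up (- fst z))) with O by lia. simpl. lra.
  - rewrite INR_IZR_INZ, Z2Nat.id by auto. lra.
Qed.

Lemma rising_nz_extend (z : C) (m n : nat) : (m <= n)%nat -> 0 < fst z + INR m ->
  rising z m <> 0 -> rising z n <> 0.
Proof.
  intros Hmn Hm Hr E. destruct (rising_zero _ _ E) as [k [Hk Ek]].
  destruct (le_lt_dec m k) as [L|L].
  - assert (INR m <= INR k) by (now apply le_INR). apply (f_equal fst) in Ek. simpl in Ek. lra.
  - apply Hr. destruct (rising_simple m k L) as [h [H1 _]]. rewrite H1, Ek. ring.
Qed.

(** The functional equation makes the value independent of the number of shifts. *)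
Lemma Gamma_formula (z : C) (n : nat) : 0 < fst z + INR n -> rising z n <> 0 ->
  Gamma z = eul (z + INR n) / rising z n.
Proof.
  intros Hn Hr. unfold Gamma. assert (Hs := Gamma_shift_pos z). set (m := Gamma_shift z) in *.
  rewrite Euler_int_eul by (simpl; lra).
  destruct (le_lt_dec m n) as [L|L].
  - symmetry. now apply eul_rising_step.
  - apply eul_rising_step; auto; [lia|]. apply (rising_nz_extend z n m); auto. lia.
Qed.

Lemma not_pole_rising (z : C) (n : nat) : ~ Gamma_pole z -> rising z n <> 0.
Proof. intros H E. destruct (rising_zero _ _ E) as [k [_ Ek]]. apply H. now exists k. Qed.

Lemma Gamma_succ (z : C) : ~ Gamma_pole z -> Gamma (z + 1) = z * Gamma z.
Proof.
  intros Hz. assert (Hs := Gamma_shift_pos z). set (m := Gamma_shift z) in *.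
  assert (H0 : z <> 0) by (intros E; apply Hz; exists O; rewrite E; simpl; ring).
  assert (Hr := not_pole_rising z (S m) Hz).
  rewrite (Gamma_formula z (S m)) by (auto; rewrite S_INR; lra).
  rewrite rising_shift in Hr |- *.
  assert (Hr2 : rising (z + 1) m <> 0) by (intros E; apply Hr; rewrite E; ring).
  rewrite (Gamma_formula (z + 1) m); auto.
  - rewrite S_INR, RtoC_plus. replace (z + (INR m + 1)) with (z + 1 + INR m) by ring. field. auto.
  - simpl. lra.
Qed.

Lemma Gamma_eul (z : C) : 0 < fst z -> Gamma z = eul z.
Proof.
  intros H. rewrite (Gamma_formula z 0); simpl; try lra.
  - replace (z + 0%R) with z by ring. field.
  - intros E. apply (f_equal fst) in E. simpl in E. lra.
Qed.

Lemma locally_fst_gt (z : C) (a : R) : a < fst z -> locally z (fun w : C => (a < fst w)).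
Proof.
  intros H. apply locally_Ceps. exists (fst z - a)%R. split; [lra|].
  intros w Hw. assert (K := fst_le_Cmod (w - z)). simpl in K.
  assert (K2 := Rle_abs (- (fst w + - fst z))). rewrite Rabs_Ropp in K2. lra.
Qed.

Lemma eul_shift_hol (n : nat) (z : C) : 0 < fst z + INR n -> hol (fun w => eul (w + INR n)) z.
Proof.
  intros H. apply (hol_comp eul (fun w => w + INR n)); auto with hol.
  apply eul_hol. simpl. lra.
Qed.

Lemma hol_locally_nz (h : C -> C) (z : C) : hol h z -> h z <> 0 -> locally z (fun w => h w <> 0).
Proof. intros H Hz. apply (hol_continuous h z H (fun y : C => y <> 0)). now apply locally_neq. Qed.

Lemma Cplus_neq_0 (a b : C) : a <> - b -> a + b <> 0.
Proof. intros H E. apply H. replace a with (a + b - b) by ring. rewrite E. ring. Qed.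

Lemma Gamma_at_pole (k : nat) : exists g : C -> C, hol g (- INR k) /\ locally' (- INR k)
  (fun w => Gamma w = g w / (w - - INR k)).
Proof.
  destruct (rising_simple (S k) k ltac:(lia)) as [h [H1 [H2 H3]]].
  assert (Hk : 0 < fst (- INR k)%C + INR (S k)) by (rewrite S_INR; simpl; lra).
  exists (fun w => eul (w + INR (S k)) / h w). split.
  - apply (hol_div (fun w => eul (w + INR (S k))) h); auto. now apply eul_shift_hol.
  - assert (A := hol_locally_nz h _ (H2 _) H3).
    assert (B := locally_fst_gt (- INR k) (- INR (S k)) ltac:(lra)).
    unfold locally', within. generalize (filter_and _ _ A B). apply filter_imp.
    intros w [W1 W2] W3.
    assert (W4 := Cplus_neq_0 _ _ W3).
    rewrite (Gamma_formula w (S k)).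
    + rewrite H1. field. repeat split; auto.
      intros E. apply W4. rewrite <- E. ring.
    + lra.
    + rewrite H1. now apply Cmult_neq_0.
Qed.

Lemma Gamma_hol (z : C) : ~ Gamma_pole z -> hol Gamma z.
Proof.
  intros Hz. assert (Hs := Gamma_shift_pos z). set (m := Gamma_shift z) in *.
  assert (Hr := not_pole_rising z m Hz).
  apply hol_ext_loc with (fun w => eul (w + INR m) / rising w m).
  - assert (A := hol_locally_nz (fun w => rising w m) _ (rising_hol m z) Hr).
    assert (B := locally_fst_gt z (- INR m) ltac:(lra)).
    generalize (filter_and _ _ A B). apply filter_imp. intros w [W1 W2].
    symmetry. apply Gamma_formula; auto. lra.
  - apply (hol_div (fun w => eul (w + INR m)) (fun w => rising w m)); auto.
    + now apply eul_shift_hol.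
    + apply rising_hol.
Qed.

Definition mero (f : C -> C) (z : C) : Prop := exists (n : nat) (g : C -> C),
  hol g z /\ locally' z (fun w : C => f w = g w / (w - z) ^ n).

Lemma Gamma_mero (z : C) : mero Gamma z.
Proof.
  destruct (classic (Gamma_pole z)) as [[k ->]|Hn].
  - destruct (Gamma_at_pole k) as [g [H1 H2]]. exists 1%nat, g. split; auto.
    revert H2. apply filter_imp. intros w Hw. rewrite Hw. simpl. now rewrite Cmult_1_r.
  - exists 0%nat, Gamma. split; [now apply Gamma_hol|].
    apply filter_forall. intros w. simpl. field.
Qed.

Lemma mero_meromorphic (f : C -> C) : (forall z, mero f z) -> meromorphic f.
Proof.
  intros H z. destruct (H z) as [n [g [H1 H2]]]. exists n, g. split; auto.
  now apply hol_holomorphic_near.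
Qed.

Lemma mero_ext (f g : C -> C) (z : C) : locally' z (fun w => f w = g w) -> mero f z -> mero g z.
Proof.
  intros E [n [h [H1 H2]]]. exists n, h. split; auto.
  generalize (filter_and _ _ E H2). apply filter_imp. intros w [W1 W2]. now rewrite <- W1.
Qed.

Lemma mero_mult_hol (f g : C -> C) (z : C) : mero f z -> hol g z -> mero (fun w => f w * g w) z.
Proof.
  intros [n [h [H1 H2]]] Hg. exists n, (fun w => h w * g w). split; auto with hol.
  revert H2. apply filter_imp. intros w Hw. rewrite Hw. unfold Cdiv. ring.
Qed.

Lemma mero_affine (f : C -> C) (a b z : C) : a <> 0 -> mero f (a * z + b) -> mero (fun w => f (a * w + b)) z.
Proof.
  intros Ha [n [h [H1 H2]]]. exists n, (fun w => h (a * w + b) / a ^ n). split.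
  - apply (hol_mult (fun w => h (a * w + b)) (fun _ => / a ^ n)); [|auto with hol].
    apply (hol_comp h (fun w => a * w + b)); auto with hol.
  - rewrite locally'_C in H2 |- *. destruct H2 as [d [Hd K]].
    assert (Pa := proj1 (Cmod_gt_0 a) Ha).
    exists (d / Cmod a)%R. split; [now apply Rdiv_lt_0_compat|].
    intros w Hw Hn.
    assert (Hn' : w - z <> 0) by (intros E; apply Hn; now apply Ceq_minus).
    rewrite K.
    + replace (a * w + b - (a * z + b)) with (a * (w - z)) by ring. rewrite Cpow_mult_l.
      field. split; now apply Cpow_nz.
    + replace (a * w + b - (a * z + b)) with (a * (w - z)) by ring. rewrite Cmod_mult.
      apply Rlt_le_trans with (Cmod a * (d / Cmod a))%R; [now apply Rmult_lt_compat_l|].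
      right. field. lra.
    + intros E. apply Hn. apply Ceq_minus.
      destruct (Ceq_dec (w - z) 0); auto. exfalso. apply (Cmult_neq_0 _ _ Ha Hn').
      replace (a * (w - z)) with (a * w + b - (a * z + b)) by ring. rewrite E. ring.
Qed.

Lemma cderiv_reflect (f : C -> C) (z l : C) : cderiv f (Cconj z) l ->
  cderiv (fun w => Cconj (f (Cconj w))) z (Cconj l).
Proof.
  rewrite !cderiv_iff. intros H e He. destruct (H e He) as [d [Hd K]]. exists d. split; auto.
  intros h Hh. rewrite <- (Cmod_conj h) in Hh. specialize (K (Cconj h) Hh).
  rewrite Cmod_conj in K. rewrite Cplus_conj.
  replace (Cconj (f (Cconj z + Cconj h)) - Cconj (f (Cconj z)) - h * Cconj l)
    with (Cconj (f (Cconj z + Cconj h) - f (Cconj z) - Cconj h * l)).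
  - now rewrite Cmod_conj.
  - now rewrite !Cminus_conj, Cmult_conj, Cconj_conj.
Qed.

Lemma locally_conj (z : C) (P : C -> Prop) : locally (Cconj z) P -> locally z (fun w => P (Cconj w)).
Proof.
  rewrite !locally_Ceps. intros [d [Hd K]]. exists d. split; auto. intros w Hw. apply K.
  now rewrite <- Cminus_conj, Cmod_conj.
Qed.

Lemma hol_reflect (f : C -> C) (z : C) : hol f (Cconj z) -> hol (fun w => Cconj (f (Cconj w))) z.
Proof.
  intros [f' [H1 H2]]. exists (fun w => Cconj (f' (Cconj w))). split.
  - apply locally_conj in H1. revert H1. apply filter_imp. intros w. apply cderiv_reflect.
  - apply continuous_Cconj. apply (continuous_comp Cconj f'); auto.
    apply (continuous_Cconj (fun w : C => w)), continuous_id.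
Qed.

Lemma mero_reflect (f : C -> C) (z : C) : mero f (Cconj z) -> mero (fun w => Cconj (f (Cconj w))) z.
Proof.
  intros [n [h [H1 H2]]]. exists n, (fun w => Cconj (h (Cconj w))). split; [now apply hol_reflect|].
  unfold locally', within in *. apply locally_conj in H2. revert H2. apply filter_imp.
  intros w Hw Hn. rewrite Hw.
  - rewrite Cdiv_conj.
    + now rewrite Cpow_conj, Cminus_conj, !Cconj_conj.
    + apply Cpow_nz. intros E. apply Hn. apply Ceq_minus.
      rewrite <- (Cconj_conj (w - z)), Cminus_conj, E. apply C_eq; simpl; ring.
  - intros E. apply Hn. now rewrite <- (Cconj_conj w), E, Cconj_conj.
Qed.

(** * Hankel's integral along a parabola *)

(** The vertical line Re p = rho.  Its image under w = p^2 is the parabola that replaces Hankel's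
    loop; on it all integrands become integrands over the line. *)
Definition vl (rho y : R) : C := rho + y * Ci.

Lemma vl_fst rho y : fst (vl rho y) = rho.
Proof. unfold vl; simpl; ring. Qed.

Lemma vl_snd rho y : snd (vl rho y) = y.
Proof. unfold vl; simpl; ring. Qed.

Lemma vl_slit rho y : 0 < rho -> slit (vl rho y).
Proof. intros H. apply slit_pos. now rewrite vl_fst. Qed.

Lemma continuous_vl {U : UniformSpace} rho (f : U -> R) (x : U) :
  continuous f x -> continuous (fun y => vl rho (f y)) x.
Proof. intros H. unfold vl. solve_cont. Qed.

#[export] Hint Extern 1 (continuous (fun x => vl ?r (@?f x)) _) =>
  apply (continuous_vl r f); solve_cont : cont.

Lemma vl_cont rho : cont (vl rho).
Proof. intros t. apply (continuous_vl rho (fun y => y)), continuous_id. Qed.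

Lemma vl_comp (f : C -> C) rho : (forall y : R, continuous f (vl rho y)) -> cont (fun y => f (vl rho y)).
Proof. intros H t. apply (continuous_comp (vl rho) f); auto. apply vl_cont. Qed.

Lemma vl_rderiv rho t : rderiv (vl rho) t Ci.
Proof. apply rderiv_affine. Qed.

Lemma vl_mod_sqr rho y : (Cmod (vl rho y) * Cmod (vl rho y) = rho * rho + y * y)%R.
Proof. rewrite Cmod_sqr, vl_fst, vl_snd. reflexivity. Qed.

Lemma vl_mod_le rho y : 0 < rho -> rho <= Cmod (vl rho y) <= rho + Rabs y.
Proof.
  intros H. split.
  - rewrite <- (vl_fst rho y) at 1. eapply Rle_trans; [|apply fst_le_Cmod]. apply Rle_abs.
  - eapply Rle_trans; [apply Cmod_le_sum|]. rewrite vl_fst, vl_snd, (Rabs_pos_eq rho); lra.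
Qed.

Lemma vl_conj rho y : vl rho (- y) = Cconj (vl rho y).
Proof. unfold vl. apply C_eq; simpl; ring. Qed.

Lemma ln_le_lin (e x : R) : 0 < e -> 0 < x -> ln x <= e * x - ln e.
Proof.
  intros He Hx. assert (K := exp_ge_1_plus (ln (e * x))).
  assert (P : 0 < e * x) by now apply Rmult_lt_0_compat.
  rewrite exp_ln in K by auto. rewrite ln_mult in K by auto. lra.
Qed.

Lemma Cexp_mod_le (z : C) : Cmod (Cexp z) <= exp (Cmod z).
Proof.
  rewrite Cexp_mod. apply exp_mono. eapply Rle_trans; [apply Rle_abs|apply fst_le_Cmod].
Qed.

Lemma Cpower_mod_le (z a : C) : Cmod (Cpower z a) <= exp (Cmod a * Cmod (Clog z)).
Proof. unfold Cpower. rewrite <- Cmod_mult. apply Cexp_mod_le. Qed.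

Lemma log_growth (rho A : R) : 0 < rho -> 0 <= A -> exists K, 0 < K /\
  forall y, exp (A * Cmod (Clog (vl rho y))) <= K * exp (Rabs y).
Proof.
  intros Hr HA.
  (* in [ln_le_lin], A e <= 1 leaves the growth e^|y| *)
  set (e := (/ (A + 1))%R). assert (He : 0 < e) by (apply Rinv_0_lt_compat; lra).
  assert (Ae : A * e <= 1).
  { unfold e. apply (Rmult_le_reg_r (A + 1)); [lra|]. rewrite Rmult_assoc, Rinv_l; lra. }
  set (B := (e * rho + Rabs (ln e) + 2 * Rabs (ln rho) + PI)%R).
  exists (exp (A * B)). split; [apply exp_pos|]. intros y.
  rewrite <- exp_plus. apply exp_mono.
  assert (M := vl_mod_le rho y Hr). set (p := vl rho y) in *.
  assert (L1 := ln_le_lin e (Cmod p) He ltac:(lra)).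
  assert (L2 : ln rho <= ln (Cmod p)).
  { destruct (proj1 M) as [M1|M1]; [left; now apply ln_increasing|right; now rewrite <- M1]. }
  assert (L3 : Cmod (Clog p) <= Rabs (ln (Cmod p)) + PI).
  { eapply Rle_trans; [apply Cmod_le_sum|]. simpl. apply Rplus_le_compat_l.
    assert (G := Carg_bound p). apply Rabs_le; lra. }
  assert (L4 : Rabs (ln (Cmod p)) <= e * (rho + Rabs y) + Rabs (ln e) + 2 * Rabs (ln rho)).
  { assert (R1 := Rle_abs (ln e)). assert (R2 := Rle_abs (- ln e)). rewrite Rabs_Ropp in R2.
    assert (R3 := Rle_abs (ln rho)). assert (R4 := Rle_abs (- ln rho)). rewrite Rabs_Ropp in R4.
    assert (e * Cmod p <= e * (rho + Rabs y)) by (apply Rmult_le_compat_l; lra).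
    assert (0 <= e * Cmod p) by (apply Rmult_le_pos; lra).
    assert (R5 := Rabs_pos (ln e)). assert (R6 := Rabs_pos (ln rho)).
    apply Rabs_le. lra. }
  assert (P := Rabs_pos y).
  apply Rle_trans with (A * (B + e * Rabs y))%R; [apply Rmult_le_compat_l; unfold B; lra|].
  nra.
Qed.

(** Powers and logarithms on the vertical line grow far more slowly; this much is already absorbed
    by every Gaussian. *)
Definition grows (k : R -> C) : Prop := cont k /\ exists K, 0 <= K /\ forall y, Cmod (k y) <= K * exp (Rabs y).

Lemma grows_Cmul c k : grows k -> grows (fun y => c * k y).
Proof.
  intros [H [K [K0 HK]]]. split.
  - intros t. apply continuous_Cmult; auto. apply continuous_Cconst.
  - exists (Cmod c * K)%R. split; [apply Rmult_le_pos; auto; apply Cmod_ge_0|].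
    intros y. rewrite Cmod_mult, Rmult_assoc. apply Rmult_le_compat_l; auto. apply Cmod_ge_0.
Qed.

Lemma grows_power rho a : 0 < rho -> grows (fun y => Cpower (vl rho y) a).
Proof.
  intros Hr. split.
  - apply (vl_comp (fun w => Cpower w a)). intros y. apply hol_continuous, hol_Cpower; [apply hol_id|].
    now apply vl_slit.
  - destruct (log_growth rho (Cmod a) Hr (Cmod_ge_0 a)) as [K [K0 HK]].
    exists K. split; [lra|]. intros y. eapply Rle_trans; [apply Cpower_mod_le|apply HK].
Qed.

Lemma Clog_vl_cont rho : 0 < rho -> cont (fun y => Clog (vl rho y)).
Proof. intros Hr. apply (vl_comp Clog). intros y. apply continuous_Clog. now apply vl_slit. Qed.

Lemma grows_log_power rho a : 0 < rho -> grows (fun y => Clog (vl rho y) * Cpower (vl rho y) a).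
Proof.
  intros Hr. split.
  - intros y. apply continuous_Cmult; [now apply Clog_vl_cont|now apply grows_power].
  - destruct (log_growth rho (1 + Cmod a) Hr) as [K [K0 HK]].
    { assert (A := Cmod_ge_0 a). lra. }
    exists K. split; [lra|]. intros y. eapply Rle_trans; [|apply HK].
    rewrite Cmod_mult, Rmult_plus_distr_r, exp_plus.
    apply Rmult_le_compat; try apply Cmod_ge_0; [|apply Cpower_mod_le].
    rewrite Rmult_1_l. assert (E := exp_ge_1_plus (Cmod (Clog (vl rho y)))). lra.
Qed.

Lemma vl_exp_bound rho v y : (Cmod (Cexp (v * (vl rho y * vl rho y))) =
  exp (- fst v * (y * y) - 2 * rho * snd v * y + fst v * (rho * rho)))%R.
Proof. rewrite Cexp_mod. f_equal. unfold vl. simpl. ring. Qed.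

Lemma grows_gauss_edom (rho : R) (k : R -> C) (v : C) : grows k -> 0 < fst v ->
  edom k (fun y => vl rho y * vl rho y) v (fst v / 2).
Proof.
  intros [Hk [K [K0 HK]]] Hv. repeat split; auto; try lra.
  - intros y. solve_cont.
  - destruct (gauss_dom (fst v / 2) (2 * Rabs rho * Rabs (snd v) + 1) (3 / 2 * fst v * (rho * rho)) ltac:(lra)) as [M HM].
    exists (K * M)%R. intros y.
    apply Rle_trans with (K * exp (- (fst v / 2) * (y * y) + (2 * Rabs rho * Rabs (snd v) + 1) * Rabs y + 3 / 2 * fst v * (rho * rho)))%R.
    2: { rewrite (Rmult_assoc K M). apply Rmult_le_compat_l; auto. }
    rewrite vl_exp_bound, Cmod_mult, vl_mod_sqr.
    apply Rle_trans with (K * exp (Rabs y) * exp (fst v / 2 * (rho * rho + y * y)) *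
      exp (- fst v * (y * y) - 2 * rho * snd v * y + fst v * (rho * rho)))%R.
    + apply Rmult_le_compat_r; [left; apply exp_pos|]. apply Rmult_le_compat_r; [left; apply exp_pos|]. apply HK.
    + rewrite !Rmult_assoc. apply Rmult_le_compat_l; auto. rewrite <- !exp_plus. apply exp_mono.
      assert (T : - 2 * rho * snd v * y <= 2 * Rabs rho * Rabs (snd v) * Rabs y).
      { eapply Rle_trans; [apply Rle_abs|]. rewrite !Rabs_mult. rewrite (Rabs_left (-2)) by lra. lra. }
      lra.
Qed.

Definition par (rho : R) (k : R -> C) (v : C) : C := Int (fun y => k y * Cexp (v * (vl rho y * vl rho y))).

Lemma par_dom (rho : R) (k : R -> C) (v : C) : grows k -> 0 < fst v -> dom (fun y => k y * Cexp (v * (vl rho y * vl rho y))).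
Proof. intros H Hv. exact (edom_dom _ _ _ _ (grows_gauss_edom rho k v H Hv)). Qed.

Definition Jk (rho : R) (s : C) (y : R) : C := 2 * Ci * Cpower (vl rho y) (2 * s - 1).

(** Hankel's integral of w^(s - 1) e^(v w) along the parabola. *)
Definition J (rho : R) (s v : C) : C := par rho (Jk rho s) v.

Lemma Jk_grows rho s : 0 < rho -> grows (Jk rho s).
Proof. intros H. apply grows_Cmul, grows_power; auto. Qed.

Lemma Jk_succ rho s y : 0 < rho -> Jk rho (s + 1) y = vl rho y * vl rho y * Jk rho s y.
Proof.
  intros Hr. unfold Jk. replace (2 * (s + 1) - 1) with (2 * s - 1 + 1 + 1) by ring.
  rewrite !Cpower_plus, Cpower_1 by now apply vl_slit. ring.
Qed.

Lemma J_cderiv (rho : R) (s v : C) : 0 < rho -> 0 < fst v -> cderiv (J rho s) v (J rho (s + 1) v).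
Proof.
  intros Hr Hv. eapply cderiv_eq.
  - apply (eint_cderiv (Jk rho s) (fun y => vl rho y * vl rho y) v (fst v / 2)).
    apply grows_gauss_edom; auto. now apply Jk_grows.
  - unfold J, par, eint. apply Int_ext. intros y. rewrite Jk_succ by auto. ring.
Qed.

(** The integral of the derivative of p^(2 s) e^(v p^2) vanishes. *)
Lemma J_parts (rho : R) (s v : C) : 0 < rho -> 0 < fst v -> s * J rho s v + v * J rho (s + 1) v = 0.
Proof.
  intros Hr Hv.
  assert (D1 := par_dom rho (Jk rho s) v (Jk_grows rho s Hr) Hv).
  assert (D2 := par_dom rho (Jk rho (s + 1)) v (Jk_grows rho (s + 1) Hr) Hv).
  unfold J, par. rewrite <- (Int_Cmul _ _ D1), <- (Int_Cmul _ _ D2),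
    <- (Int_plus _ _ (dom_Cmul _ _ D1) (dom_Cmul _ _ D2)).
  assert (D0 := par_dom rho _ v (grows_power rho (2 * s) Hr) Hv).
  destruct D0 as [_ [M HM]].
  apply (Int_derive0 (fun y => Cpower (vl rho y) (2 * s) * Cexp (v * (vl rho y * vl rho y))) _ M); auto.
  - apply (dom_plus _ _ (dom_Cmul s _ D1) (dom_Cmul v _ D2)).
  - intros y. assert (Hs := vl_slit rho y Hr). eapply rderiv_eq.
    + apply (rderiv_comp (fun w => Cpower w (2 * s) * Cexp (v * (w * w)))); [|apply vl_rderiv].
      apply cderiv_mult; [now apply cderiv_Cpower|].
      cderive.
    + rewrite Jk_succ by auto. unfold Jk. set (p := vl rho y) in *.
      replace (2 * s) with (2 * s - 1 + 1) at 3 by ring.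
      rewrite (Cpower_plus p (2 * s - 1) 1), Cpower_1 by auto. ring.
Qed.

Lemma J_succ_1 (rho : R) (s : C) : 0 < rho -> J rho (s + 1) 1 = - s * J rho s 1.
Proof.
  intros Hr. assert (H := J_parts rho s 1 Hr ltac:(simpl; lra)).
  replace (J rho (s + 1) 1) with (s * J rho s 1 + 1 * J rho (s + 1) 1 - s * J rho s 1) by ring.
  rewrite H. ring.
Qed.

(** Both sides satisfy v f'(v) = - s f(v) on the right half-plane and agree at 1. *)
Lemma J_power (rho : R) (s v : C) : 0 < rho -> 0 < fst v -> J rho s v = Cpower v (- s) * J rho s 1.
Proof.
  intros Hr Hv.
  assert (E : Cpower 1 s * J rho s 1 = Cpower v s * J rho s v).
  { apply (constant_on_segment (fun v => Cpower v s * J rho s v)). intros t Ht.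
    set (u := 1 + t * (v - 1)).
    assert (Hu : 0 < fst u) by (unfold u; simpl; nra).
    assert (Hs := slit_pos u Hu).
    eapply cderiv_eq; [apply cderiv_mult; [now apply cderiv_Cpower|now apply J_cderiv]|].
    assert (P := J_parts rho s u Hr Hu).
    assert (X : Cpower u s = Cpower u (s - 1) * u).
    { replace s with (s - 1 + 1) at 1 by ring. now rewrite Cpower_plus, Cpower_1. }
    cbv beta. rewrite X.
    replace (s * Cpower u (s - 1) * J rho s u + Cpower u (s - 1) * u * J rho (s + 1) u)
      with (Cpower u (s - 1) * (s * J rho s u + u * J rho (s + 1) u)) by ring.
    rewrite P. ring. }
  rewrite Cpower_1_l in E. rewrite Cpower_opp.
  replace (J rho s 1) with (1 * J rho s 1) by ring. rewrite E. field. apply Cpower_nz.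
Qed.

(** * Hankel's formula for the Gamma function *)

Lemma exp_exp_dom (a : R) : 0 < a -> exists M, forall x, exp (x - a * exp x) <= M * wt x.
Proof.
  intros Ha. set (k := (2 / a)%R). assert (Hk : 0 < k) by (apply Rdiv_lt_0_compat; lra).
  destruct (exp_dom 1 (2 * Rabs (ln k - 1)) Rlt_0_1) as [M HM].
  exists M. intros x. eapply Rle_trans; [|apply HM]. apply exp_mono.
  assert (Y0 := exp_pos x).
  assert (Y : k * (1 + (x - ln k)) <= exp x).
  { replace x with (ln k + (x - ln k))%R at 2 by ring. rewrite exp_plus, exp_ln by auto.
    apply Rmult_le_compat_l; [lra|apply exp_ge_1_plus]. }
  apply (Rmult_le_compat_l a) in Y; [|lra].
  replace (a * (k * (1 + (x - ln k))))%R with (2 * (1 + (x - ln k)))%R in Y by (unfold k; field; lra).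
  assert (P0 := Rabs_pos (ln k - 1)). assert (P1 := Rle_abs (ln k - 1)).
  assert (P2 : 0 < a * exp x) by now apply Rmult_lt_0_compat.
  destruct (Rle_dec 0 x).
  - rewrite (Rabs_pos_eq x) by auto. lra.
  - rewrite (Rabs_left x) by lra. lra.
Qed.

Lemma power_decay rho (s : C) : 0 < rho < 1 -> fst s <= - (1 / 2) ->
  exists M, 0 <= M /\ forall y, Cmod (Cpower (vl rho y) (2 * s - 1)) <= M * wt y.
Proof.
  intros Hr Hs.
  set (q := Rpower rho (2 * fst s + 1)).
  exists (exp (2 * Rabs (snd s) * PI) * (q * / (rho * rho)))%R.
  assert (Pq : 0 < q) by apply exp_pos.
  assert (Pr : 0 < / (rho * rho)) by (apply Rinv_0_lt_compat; nra).
  split.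
  { apply Rmult_le_pos; [left; apply exp_pos|]. apply Rmult_le_pos; lra. }
  intros y. rewrite Cpower_mod. assert (M := vl_mod_le rho y ltac:(lra)). set (p := vl rho y) in *.
  assert (Sq := vl_mod_sqr rho y). fold p in Sq.
  assert (E : (fst (2 * s - 1)%C = (2 * fst s + 1) + - (2))%R) by (simpl; ring).
  assert (E2 : snd (2 * s - 1)%C = (2 * snd s)%R) by (simpl; ring).
  rewrite E, E2.
  assert (B1 : exp ((2 * fst s + 1) * ln (Cmod p)) <= q).
  { unfold q, Rpower. apply exp_mono.
    assert (L2 : ln rho <= ln (Cmod p)).
    { destruct (proj1 M) as [M1|M1]; [left; apply ln_increasing; lra|right; now rewrite <- M1]. }
    nra. }
  assert (B2 : exp (- (2) * ln (Cmod p)) <= / (rho * rho) * wt y).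
  { replace (- (2) * ln (Cmod p))%R with (- (ln (Cmod p) + ln (Cmod p)))%R by ring.
    rewrite exp_Ropp, exp_plus, exp_ln, Sq by lra. unfold wt. rewrite <- Rinv_mult.
    assert (rho * rho <= 1) by nra. assert (0 <= y * y) by nra.
    apply Rinv_le_contravar; nra. }
  assert (B3 : exp (- (2 * snd s * Carg p)) <= exp (2 * Rabs (snd s) * PI)).
  { apply exp_mono. eapply Rle_trans; [apply Rle_abs|]. rewrite Rabs_Ropp, !Rabs_mult.
    rewrite (Rabs_pos_eq 2) by lra. assert (G := Carg_bound p).
    apply Rmult_le_compat_l; [assert (G2 := Rabs_pos (snd s)); lra|]. apply Rabs_le; lra. }
  replace ((2 * fst s + 1 + - (2)) * ln (Cmod p) - 2 * snd s * Carg p)%R with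
    (- (2 * snd s * Carg p) + ((2 * fst s + 1) * ln (Cmod p) + - (2) * ln (Cmod p)))%R by ring.
  rewrite !exp_plus.
  assert (X1 : exp ((2 * fst s + 1) * ln (Cmod p)) * exp (- (2) * ln (Cmod p)) <= q * (/ (rho * rho) * wt y)).
  { apply Rmult_le_compat; auto; left; apply exp_pos. }
  rewrite (Rmult_assoc (exp (2 * Rabs (snd s) * PI))). rewrite <- (Rmult_assoc q) in X1.
  apply Rmult_le_compat; auto.
  - left; apply exp_pos.
  - apply Rmult_le_pos; left; apply exp_pos.
Qed.

Lemma one_minus_sqr_nz rho y : 0 < rho < 1 -> 0 < fst (1 - vl rho y * vl rho y)%C.
Proof. intros H. unfold vl. simpl. nra. Qed.

(** This is the integral of e^(-q t) over (0, oo), with t = e^x. *)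
Lemma inner_exp_integral (q : C) : 0 < fst q ->
  Int (fun x : R => Cexp (x - Cexp x * q)) = / q.
Proof.
  intros Hq. assert (Hq0 : q <> 0).
  { intros E. rewrite E in Hq. simpl in Hq. lra. }
  assert (Pq := proj1 (Cmod_gt_0 q) Hq0).
  replace (/ q) with (0 - - / q) by ring.
  apply (Int_derive (fun x : R => - (Cexp (- (Cexp x * q)) / q))).
  - apply (cont_comp_RtoC (fun x => Cexp (x - Cexp x * q))). intros z. apply hol_continuous. auto 8 with hol.
  - intros t. eapply rderiv_eq.
    + apply (rderiv_comp (fun x => - (Cexp (- (Cexp x * q)) / q)) RtoC); [|apply rderiv_RtoC].
      cderive.
    + unfold Cminus. rewrite Cexp_plus. field. auto.
  - rewrite filterlim_C by apply Rbar_locally_filter. intros e He.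
    set (d := (Rmin (/ Cmod q) (e / 12))%R).
    assert (Hd : 0 < d) by (apply Rmin_glb_lt; [now apply Rinv_0_lt_compat|lra]).
    exists (ln d). intros x Hx.
    assert (X : exp x < d) by (rewrite <- (exp_ln d) by auto; now apply exp_increasing).
    assert (D1 := Rmin_l (/ Cmod q) (e / 12)). assert (D2 := Rmin_r (/ Cmod q) (e / 12)). fold d in D1, D2.
    replace (- (Cexp (- (Cexp x * q)) / q) - - / q) with (- ((Cexp (- (Cexp x * q)) - 1) / q)) by (field; auto).
    rewrite Cmod_opp, Cmod_div by auto.
    assert (T := Cexp_taylor1 (- (Cexp x * q))).
    assert (Em : Cmod (- (Cexp x * q)) = (exp x * Cmod q)%R).
    { rewrite Cmod_opp, Cmod_mult, Cexp_real, Cmod_R, Rabs_pos_eq; auto. left; apply exp_pos. }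
    rewrite Em in T. assert (Px := exp_pos x).
    assert (B : exp x * Cmod q <= 1).
    { apply Rle_trans with (/ Cmod q * Cmod q)%R; [apply Rmult_le_compat_r; lra|]. rewrite Rinv_l; lra. }
    assert (B2 : exp (exp x * Cmod q) <= 3).
    { apply Rle_trans with (exp 1); [now apply exp_mono|apply exp_le_3]. }
    apply (Rmult_lt_reg_r (Cmod q)); auto. unfold Rdiv. rewrite Rmult_assoc, Rinv_l, Rmult_1_r by lra.
    assert (B3 : exp x * Cmod q * exp (exp x * Cmod q) <= exp x * Cmod q * 3).
    { apply Rmult_le_compat_l; auto. apply Rmult_le_pos; lra. }
    assert (B4 : exp x * Cmod q < e / 12 * Cmod q) by (apply Rmult_lt_compat_r; lra).
    assert (0 < e * Cmod q) by now apply Rmult_lt_0_compat. lra.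
  - rewrite filterlim_C by apply Rbar_locally_filter. intros e He.
    set (w := (Rabs (ln (e * Cmod q)) / fst q + 1)%R).
    assert (W0 : 0 < w).
    { unfold w. assert (0 <= Rabs (ln (e * Cmod q)) / fst q); [|lra].
      apply Rmult_le_pos; [apply Rabs_pos|left; now apply Rinv_0_lt_compat]. }
    exists (ln w). intros x Hx.
    assert (X : w < exp x) by (rewrite <- (exp_ln w) by auto; now apply exp_increasing).
    replace (- (Cexp (- (Cexp x * q)) / q) - 0) with (- (Cexp (- (Cexp x * q)) / q)) by ring.
    rewrite Cmod_opp, Cmod_div by auto.
    apply (Rmult_lt_reg_r (Cmod q)); auto. unfold Rdiv. rewrite Rmult_assoc, Rinv_l, Rmult_1_r by lra.
    rewrite <- (exp_ln (e * Cmod q)) by now apply Rmult_lt_0_compat.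
    rewrite Cexp_mod. apply exp_increasing. rewrite Cexp_real. simpl.
    assert (L := Rle_abs (- ln (e * Cmod q))). rewrite Rabs_Ropp in L.
    assert (fst q * w < fst q * exp x) by (apply Rmult_lt_compat_l; auto).
    assert (Ew : (fst q * w = Rabs (ln (e * Cmod q)) + fst q)%R) by (unfold w; field; lra).
    lra.
Qed.

(** What remains of Hankel's integrand after integration against e^(-t): the exponential
    e^(t p^2) becomes 1 / (1 - p^2). *)
Definition rational_kernel (rho : R) (s : C) (y : R) : C :=
  2 * Ci * Cpower (vl rho y) (2 * s - 1) / (1 - vl rho y * vl rho y).

(** Euler's integral of t^(- s) e^(- t), with t^(- s) J(s, 1) = J(s, t) inserted and the order of
    integration exchanged. *)
Lemma Gamma_J_rational rho (s : C) : 0 < rho < 1 -> fst s <= - (1 / 2) ->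
  Gamma (1 - s) * J rho s 1 = Int (rational_kernel rho s) /\ dom (rational_kernel rho s).
Proof.
  intros Hr Hs.
  rewrite Gamma_eul by (simpl; lra).
  set (f := fun x y : R => Cexp (x - Cexp x * (1 - vl rho y * vl rho y)) * (2 * Ci * Cpower (vl rho y) (2 * s - 1))).
  assert (Df : dom2 f).
  { split.
    - intros x y. unfold f. apply continuous_Cmult.
      + solve_cont.
      + apply (continuous_comp (fun p : R * R => snd p) (fun y => 2 * Ci * Cpower (vl rho y) (2 * s - 1))).
        * apply continuous_snd.
        * apply (Jk_grows rho s). lra.
    - destruct (exp_exp_dom (1 - rho * rho)) as [M1 HM1]; [nra|].
      destruct (power_decay rho s Hr Hs) as [M2 [P2 HM2]].
      exists (M1 * (2 * M2))%R. intros x y. unfold f.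
      rewrite Cmod_mult.
      replace (M1 * (2 * M2) * wt x * wt y)%R with ((M1 * wt x) * (2 * (M2 * wt y)))%R by ring.
      apply Rmult_le_compat; try apply Cmod_ge_0.
      + eapply Rle_trans; [|apply HM1]. rewrite Cexp_mod. apply exp_mono.
        rewrite Cexp_real. unfold vl. simpl. assert (E := exp_pos x). nra.
      + rewrite !Cmod_mult, Cmod_Ci, Cmod_R, Rabs_pos_eq by lra. specialize (HM2 y). lra. }
  assert (E1 : eul (1 - s) * J rho s 1 = Int (fun x => Int (f x))).
  { unfold eul, eint. rewrite Cmult_comm.
    rewrite <- (Int_Cmul _ _ (eul_dom (1 - s) ltac:(simpl; lra))).
    apply Int_ext. intros x.
    assert (Ex : Cpower (Cexp x) (- s) = Cexp (- s * x)).
    { unfold Cpower. rewrite Clog_Cexp; auto. simpl. assert (P := PI_RGT_0). lra. }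
    assert (P := J_power rho s (Cexp x) ltac:(lra)).
    rewrite Cexp_real in P at 1. specialize (P (exp_pos x)). rewrite Ex in P.
    replace ((1 - s) * x) with (- s * x + x) by ring.
    rewrite Cexp_plus.
    replace (J rho s 1 * (Cexp (- Cexp x) * (Cexp (- s * x) * Cexp x)))
      with (Cexp (- Cexp x) * Cexp x * (Cexp (- s * x) * J rho s 1)) by ring.
    rewrite <- P. unfold J, par.
    rewrite <- Int_Cmul.
    - apply Int_ext. intros y. unfold f, Jk. set (p := vl rho y).
      replace (x - Cexp x * (1 - p * p)) with (- Cexp x + (x + Cexp x * (p * p))) by ring.
      rewrite !Cexp_plus. ring.
    - apply par_dom; [apply Jk_grows; lra|]. rewrite Cexp_real. apply exp_pos. }
  assert (E2 : forall y, Int (fun x => f x y) = rational_kernel rho s y).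
  { intros y. unfold f, rational_kernel. assert (Q := one_minus_sqr_nz rho y Hr).
    set (q := 1 - vl rho y * vl rho y) in *.
    transitivity ((2 * Ci * Cpower (vl rho y) (2 * s - 1)) * Int (fun x : R => Cexp (x - Cexp x * q))).
    - rewrite <- Int_Cmul.
      + apply Int_ext. intros x. ring.
      + split.
        * apply (cont_comp_RtoC (fun x => Cexp (x - Cexp x * q))). intros z. apply hol_continuous. auto 8 with hol.
        * destruct (exp_exp_dom (fst q) Q) as [M HM]. exists M. intros x. eapply Rle_trans; [|apply HM].
          rewrite Cexp_mod, Cexp_real. right. f_equal. simpl. ring.
    - rewrite inner_exp_integral by auto. reflexivity. }
  split.
  - rewrite E1, (Int_fubini f Df). now apply Int_ext.
  - apply (dom_ext (fun y => Int (fun x => f x y))); auto.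
    apply (dom2_Int (fun y x => f x y)). now apply dom2_swap.
Qed.

Lemma rderiv_of_real (f : R -> R) (t l : R) :
  is_derive f t l -> rderiv (fun y => RtoC (f y)) t (RtoC l).
Proof.
  intros D. apply (rderiv_eq _ _ (@scal R_AbsRing C_R_NormedModule l (RtoC 1))).
  - apply (@is_derive_comp R_AbsRing C_R_NormedModule RtoC f); [apply rderiv_RtoC|exact D].
  - rewrite scal_R_Cmult. apply Cmult_1_r.
Qed.

Lemma poisson_kernel (a : R) : 0 < a ->
  dom (fun y => RtoC (a / (a * a + y * y))) /\ Int (fun y => RtoC (a / (a * a + y * y))) = PI.
Proof.
  intros Ha.
  assert (Hc : cont (fun y => RtoC (a / (a * a + y * y)))).
  { intros y. apply continuous_RtoC. apply (@ex_derive_continuous R_AbsRing R_NormedModule).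
    auto_derive. nra. }
  split.
  - split; auto. exists (Rmax a (/ a)). intros y. rewrite Cmod_R, Rabs_pos_eq.
    2: { left. apply Rdiv_lt_0_compat; nra. }
    assert (M1 := Rmax_l a (/ a)). assert (M2 := Rmax_r a (/ a)). set (m := Rmax a (/ a)) in *.
    unfold wt. apply (Rmult_le_reg_r (1 + y * y)); [nra|]. rewrite (Rmult_assoc m), Rinv_l, Rmult_1_r by nra.
    apply (Rmult_le_reg_r (a * a + y * y)); [nra|].
    replace (a / (a * a + y * y) * (1 + y * y) * (a * a + y * y))%R with (a * (1 + y * y))%R by (field; nra).
    assert (A1 : a <= m * (a * a)).
    { apply Rle_trans with (/ a * (a * a))%R; [right; field; lra|]. apply Rmult_le_compat_r; nra. }
    assert (0 <= y * y) by nra. nra.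
  - replace (RtoC PI) with (RtoC (PI / 2) - RtoC (- (PI / 2))) by (rewrite <- RtoC_minus; f_equal; field).
    apply (Int_derive (fun y => RtoC (atan (y / a)))); auto.
    + intros t. apply (rderiv_of_real (fun y => atan (y / a))).
      auto_derive; auto. unfold Rsqr. field. split; nra.
    + rewrite filterlim_C by apply Rbar_locally_filter. intros e He.
      destruct (atan_m_infty e He) as [m Hm]. exists (a * m)%R. intros y Hy.
      rewrite <- RtoC_minus, Cmod_R. assert (B := atan_bound (y / a)).
      assert (Hy2 : y / a < m).
      { apply (Rmult_lt_reg_r a); auto. unfold Rdiv. rewrite Rmult_assoc, Rinv_l, Rmult_1_r by lra. lra. }
      specialize (Hm _ Hy2). apply Rabs_def1; lra.
    + rewrite filterlim_C by apply Rbar_locally_filter. intros e He.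
      destruct (atan_p_infty e He) as [m Hm]. exists (a * m)%R. intros y Hy.
      rewrite <- RtoC_minus, Cmod_R. assert (B := atan_bound (y / a)).
      assert (Hy2 : m < y / a).
      { apply (Rmult_lt_reg_r a); auto. unfold Rdiv. rewrite Rmult_assoc, Rinv_l, Rmult_1_r by lra. lra. }
      specialize (Hm _ Hy2). apply Rabs_def1; lra.
Qed.

Definition right_half (z : C) : Prop := (0 < fst z).

Lemma right_half_open : opens right_half.
Proof. intros z Hz. now apply locally_fst_gt. Qed.

Lemma right_half_star : star right_half 1.
Proof. intros z Hz t Ht. unfold right_half in *. simpl. nra. Qed.

Lemma one_minus_sqr_factor (p : C) : right_half p -> p <> 1 -> 1 - p * p <> 0.
Proof.
  intros Hp H1. replace (1 - p * p) with ((1 - p) * (1 + p)) by ring. apply Cmult_neq_0.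
  - intros E. apply H1. symmetry. now apply Ceq_minus.
  - intros E. apply (f_equal fst) in E. simpl in E. unfold right_half in Hp. lra.
Qed.

Lemma power_bounded (w a : C) : 1 <= Cmod w -> fst a <= 0 ->
  Cmod (Cpower w a) <= exp (Rabs (snd a) * PI).
Proof.
  intros Hw Ha. rewrite Cpower_mod. apply exp_mono.
  assert (L : 0 <= ln (Cmod w)).
  { rewrite <- ln_1. destruct Hw as [Hw|Hw]; [left; apply ln_increasing; lra|right; now rewrite <- Hw]. }
  assert (B : - (snd a * Carg w) <= Rabs (snd a) * PI).
  { eapply Rle_trans; [apply Rle_abs|]. rewrite Rabs_Ropp, Rabs_mult.
    apply Rmult_le_compat_l; [apply Rabs_pos|]. assert (G := Carg_bound w). apply Rabs_le; lra. }
  nra.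
Qed.

(** In the right half-plane the integrand has its only pole at 1, with a residue that does not
    depend on [s].  Subtracting the function [h] below, which has the same residue and is a Poisson
    kernel on the line of integration, leaves an integrand whose path can be moved to infinity. *)
Lemma rational_const rho (s : C) : 0 < rho <= 1 / 2 -> fst s <= - (1 / 2) ->
  Int (rational_kernel rho s) = 2 * PI * Ci.
Proof.
  intros Hr Hs.
  assert (D1 := proj2 (Gamma_J_rational rho s ltac:(lra) Hs)).
  set (a := (1 - rho)%R). set (b := (1 - 2 * rho)%R).
  destruct (poisson_kernel a ltac:(unfold a; lra)) as [Dm Im].
  set (m := fun y => RtoC (a / (a * a + y * y))) in *.
  set (h := fun p => / (1 - p) + / (p + b)).
  set (num := fun p => 2 * Cpower p (2 * s - 1) - (1 + p) - (1 - p * p) / (p + b)).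
  assert (Nb : forall p, right_half p -> p + b <> 0).
  { intros p Hp E. apply (f_equal fst) in E. simpl in E. unfold right_half, b in *. lra. }
  assert (Hnum : forall p, right_half p -> hol num p).
  { intros p Hp. assert (Sp := slit_pos p Hp). unfold num.
    apply (hol_minus (fun p => 2 * Cpower p (2 * s - 1) - (1 + p)) (fun p => (1 - p * p) / (p + b)));
      [auto 8 with hol|]. apply (hol_div (fun p => 1 - p * p) (fun p => p + b)); auto with hol. }
  destruct (quotient_primitive right_half 1 num (fun p => 1 - p * p) (- (1 + 1)) right_half_open right_half_star)
    as [F [f [HF Enum]]]; auto using one_minus_sqr_factor with hol.
  { unfold right_half. simpl. lra. }
  { eapply cderiv_eq; [cderive|]. cbv beta. ring. }
  { intros E. apply (f_equal fst) in E. simpl in E. lra. }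
  { unfold num. rewrite Cpower_1_l. field. apply Nb. unfold right_half; simpl; lra. }
  { ring. }
  assert (Ef : forall p : C, right_half p -> p <> 1 -> f p = 2 * Cpower p (2 * s - 1) / (1 - p * p) - h p).
  { intros p Hp Hp1. rewrite Enum by auto. unfold num, h.
    assert (N := one_minus_sqr_factor p Hp Hp1). assert (N2 := Nb p Hp).
    assert (N3 : 1 - p <> 0) by (intros E; apply Hp1; symmetry; now apply Ceq_minus).
    replace (1 - p * p) with ((1 - p) * (1 + p)) in N |- * by ring. field. repeat split; auto.
    intros E. apply N. rewrite E. ring. }
  assert (El : forall y, rational_kernel rho s y - 2 * Ci * m y = f (vl rho y) * Ci).
  { intros y. rewrite Ef.
    - assert (Eh : h (vl rho y) = 2 * m y); [|rewrite Eh; unfold rational_kernel, Cdiv; ring].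
      assert (P : 0 < a * a + y * y) by (unfold a; nra).
      unfold h, m. replace (1 - vl rho y) with (a - y * Ci) by (unfold vl, a; apply C_eq; simpl; ring).
      replace (vl rho y + b) with (a + y * Ci) by (unfold vl, a, b; apply C_eq; simpl; ring).
      apply C_eq; simpl; field; repeat split; unfold a; nra.
    - unfold right_half. rewrite vl_fst. lra.
    - intros E. apply (f_equal fst) in E. rewrite vl_fst in E. simpl in E. lra. }
  assert (Dc := dom_Cmul (2 * Ci) _ Dm).
  assert (Df : dom (fun y : R => f (rho + y * Ci) * Ci)).
  { apply (dom_ext _ _ El). now apply dom_minus. }
  cut (Int (fun y : R => f (rho + y * Ci) * Ci) = 0).
  { change (Int (fun y : R => f (vl rho y) * Ci) = 0 -> Int (rational_kernel rho s) = 2 * PI * Ci).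
    intros E. rewrite <- (Int_ext _ _ El), (Int_minus _ _ D1 Dc), (Int_Cmul _ _ Dm), Im in E.
    apply Ceq_minus. rewrite <- E. ring. }
  set (I := Int _).
  set (K := (2 * exp (Rabs (snd (2 * s - 1)%C) * PI) + 2)%R).
  assert (Kp := exp_pos (Rabs (snd (2 * s - 1)%C) * PI)).
  assert (K0 : 0 < K) by (unfold K; lra).
  assert (Bf : forall (T : R) w, 2 <= T -> right_half w -> T <= Cmod w -> Cmod (f w) <= 2 * K / (T * T)).
  { intros T w HT Hw HTw.
    assert (Hw1 : w <> 1) by (intros E; rewrite E, Cmod_1 in HTw; lra).
    assert (N := one_minus_sqr_factor w Hw Hw1). assert (N2 := Nb w Hw).
    assert (N3 : 1 - w <> 0) by (intros E; apply Hw1; symmetry; now apply Ceq_minus).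
    rewrite Ef by auto. eapply Rle_trans; [apply Cmod_triangle'|].
    replace (h w) with ((1 + b) / ((1 - w) * (w + b))) by (unfold h; field; auto).
    rewrite !Cmod_div, !Cmod_mult by auto using Cmult_neq_0.
    replace (1 + b) with (RtoC (1 + b)) by (now rewrite RtoC_plus).
    rewrite !Cmod_R, !Rabs_pos_eq by (unfold b; lra).
    assert (L1 : T * T / 2 <= Cmod (1 - w * w)%C).
    { assert (Q := Cmod_triangle_rev (- (w * w)) 1). rewrite Cmod_opp, Cmod_mult, Cmod_1 in Q.
      replace (- (w * w) + 1) with (1 - w * w) in Q by ring. nra. }
    assert (L2 : T / 2 <= Cmod (1 - w)%C).
    { assert (Q := Cmod_triangle_rev (- w) 1). rewrite Cmod_opp, Cmod_1 in Q.
      replace (- w + 1) with (1 - w) in Q by ring. lra. }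
    assert (L3 : T <= Cmod (w + b)%C).
    { eapply Rle_trans; [exact HTw|]. apply Rsqr_incr_0_var; [|apply Cmod_ge_0]. unfold Rsqr.
      rewrite !Cmod_sqr. simpl. unfold right_half, b in *. nra. }
    replace (2 * K / (T * T))%R with (2 * exp (Rabs (snd (2 * s - 1)%C) * PI) * / (T * T / 2) + 2 * / (T / 2 * T))%R
      by (unfold K; field; lra).
    apply Rplus_le_compat; (apply Rmult_le_compat; [|left; apply Rinv_0_lt_compat| |apply Rinv_le_contravar]);
      try (unfold b; nra).
    - apply Rmult_le_pos; [lra|apply Cmod_ge_0].
    - apply Rmult_le_compat_l; [lra|]. apply power_bounded; [lra|simpl; lra].
    - apply Rmult_lt_0_compat; lra.
    - apply Rmult_le_compat; lra. }
  apply Cmod_eq_0. apply Rle_antisym; [|apply Cmod_ge_0]. apply le_epsilon. intros e He.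
  destruct (Int_approx _ (e / 2) Df ltac:(lra)) as [T1 [T1p H1]]. fold I in H1.
  set (T := (T1 + 2 + 32 * K / e)%R).
  assert (Q : 0 < 32 * K / e) by (apply Rdiv_lt_0_compat; lra).
  assert (HT2 : 2 <= T) by (unfold T; lra).
  specialize (H1 T ltac:(unfold T; lra)).
  assert (HFl : forall t : R, cderiv F (rho + t * Ci) (f (rho + t * Ci))).
  { intros t. apply HF. unfold right_half. simpl. lra. }
  rewrite (RIntC_line F f rho Ci (- T) T (proj1 Df) HFl) in H1.
  set (P1 := rho + T * Ci) in *. set (P4 := rho + (- T)%R * Ci) in *.
  set (P2 := T + T * Ci). set (P3 := T + (- T)%R * Ci).
  assert (Seg : forall z1 z2 L, (Cmod (z2 - z1)%C <= L) ->
    (forall t : R, 0 <= t <= 1 -> right_half (z1 + t * (z2 - z1)) /\ T <= Cmod (z1 + t * (z2 - z1))%C) ->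
    Cmod (F z2 - F z1)%C <= 4 * L * K / (T * T)).
  { intros z1 z2 L HL Hz. eapply Rle_trans.
    - apply (segment_bound F f z1 z2 (2 * K / (T * T))). intros t Ht. destruct (Hz t Ht) as [Z1 Z2].
      split; [now apply HF|now apply Bf].
    - assert (Y : 0 <= 2 * K / (T * T)) by (left; apply Rdiv_lt_0_compat; nra).
      assert (X := Rmult_le_compat_r _ _ _ Y HL).
      replace (4 * L * K / (T * T))%R with (2 * (L * (2 * K / (T * T))))%R by (field; lra). lra. }
  assert (S1 : Cmod (F P2 - F P1)%C <= 4 * T * K / (T * T)).
  { apply Seg.
    - unfold P2, P1. replace (T + T * Ci - (rho + T * Ci)) with (RtoC (T - rho)) by (rewrite RtoC_minus; ring).
      rewrite Cmod_R, Rabs_pos_eq; lra.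
    - intros t Ht. split.
      + unfold right_half, P1, P2. simpl. nra.
      + eapply Rle_trans; [|apply im_le_Cmod]. unfold P1, P2. simpl.
        eapply Rle_trans; [|apply Rle_abs]. right. ring. }
  assert (S2 : Cmod (F P3 - F P2)%C <= 4 * (2 * T) * K / (T * T)).
  { apply Seg.
    - unfold P3, P2. replace (T + (- T)%R * Ci - (T + T * Ci)) with (- (RtoC (2 * T) * Ci))
        by (rewrite RtoC_mult, RtoC_opp; ring).
      rewrite Cmod_opp, Cmod_mult, Cmod_Ci, Cmod_R, Rabs_pos_eq; lra.
    - intros t Ht. split.
      + unfold right_half, P3, P2. simpl. nra.
      + eapply Rle_trans; [|apply fst_le_Cmod]. unfold P3, P2. simpl.
        eapply Rle_trans; [|apply Rle_abs]. right. ring. }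
  assert (S3 : Cmod (F P3 - F P4)%C <= 4 * T * K / (T * T)).
  { apply Seg.
    - unfold P3, P4. replace (T + (- T)%R * Ci - (rho + (- T)%R * Ci)) with (RtoC (T - rho)) by (rewrite RtoC_minus; ring).
      rewrite Cmod_R, Rabs_pos_eq; lra.
    - intros t Ht. split.
      + unfold right_half, P3, P4. simpl. nra.
      + eapply Rle_trans; [|apply im_le_Cmod]. unfold P3, P4. simpl.
        rewrite <- Rabs_Ropp. eapply Rle_trans; [|apply Rle_abs]. right. ring. }
  assert (Tot : 16 * (T * K / (T * T)) <= e / 2).
  { replace (16 * (T * K / (T * T)))%R with (16 * K / T)%R by (field; lra).
    apply (Rmult_le_reg_r T); [lra|]. unfold Rdiv at 1. rewrite Rmult_assoc, Rinv_l by lra.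
    apply Rle_trans with (e / 2 * (32 * K / e))%R; [right; field; lra|].
    apply Rmult_le_compat_l; unfold T; lra. }
  replace (4 * T * K / (T * T))%R with (4 * (T * K / (T * T)))%R in S1, S3 by (field; lra).
  replace (4 * (2 * T) * K / (T * T))%R with (8 * (T * K / (T * T)))%R in S2 by (field; lra).
  replace I with ((I - (F P1 - F P4)) - ((F P2 - F P1) + (F P3 - F P2) - (F P3 - F P4))) by ring.
  eapply Rle_trans; [apply Cmod_triangle'|].
  assert (X1 := Cmod_triangle' ((F P2 - F P1) + (F P3 - F P2)) (F P3 - F P4)).
  assert (X2 := Cmod_triangle (F P2 - F P1) (F P3 - F P2)). lra.
Qed.

Lemma not_pole_succ (z : C) : ~ Gamma_pole z -> ~ Gamma_pole (z + 1).
Proof.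
  intros H [m E]. apply H. exists (S m). rewrite S_INR, RtoC_plus.
  replace z with (z + 1 - 1) by ring. rewrite E. ring.
Qed.

Theorem hankel_gamma rho (s : C) : 0 < rho <= 1 / 2 -> ~ Gamma_pole (1 - s) ->
  Gamma (1 - s) * J rho s 1 = 2 * PI * Ci.
Proof.
  intros Hr.
  assert (Ind : forall n (s : C), (fst s <= - (1 / 2) + INR n) -> ~ Gamma_pole (1 - s) ->
    Gamma (1 - s) * J rho s 1 = 2 * PI * Ci).
  { induction n; intros u Hu Hp.
    - simpl in Hu. rewrite (proj1 (Gamma_J_rational rho u ltac:(lra) ltac:(lra))).
      apply rational_const; auto. lra.
    - rewrite S_INR in Hu.
      assert (Hp' : ~ Gamma_pole (1 - (u - 1))).
      { replace (1 - (u - 1)) with (1 - u + 1) by ring. now apply not_pole_succ. }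
      assert (K := IHn (u - 1) ltac:(simpl; lra) Hp').
      replace (1 - (u - 1)) with (1 - u + 1) in K by ring. rewrite Gamma_succ in K by auto.
      rewrite <- K. replace (J rho u 1) with (J rho (u - 1 + 1) 1) by (f_equal; ring).
      rewrite J_succ_1 by lra. ring. }
  destruct (nfloor_ex (Rmax 0 (fst s + 1 / 2))) as [n Hn]; [apply Rmax_l|].
  apply (Ind (S n)). rewrite S_INR. assert (M := Rmax_r 0 (fst s + 1 / 2)). lra.
Qed.

Lemma J_nat rho (n : nat) : 0 < rho -> J rho (INR (S n)) 1 = 0.
Proof.
  intros Hr. induction n.
  - replace (RtoC (INR 1)) with (0 + 1) by (simpl; ring). rewrite J_succ_1 by auto. ring.
  - rewrite (S_INR (S n)), RtoC_plus, J_succ_1, IHn by auto. ring.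
Qed.

(** * The parabolic cylinder function on a parabola *)

(** Along the negative real axis the real part of w^2 wins over the linear term. *)
Definition gdecay (f : C -> C) (A B : R) : Prop := forall w, 1 <= Cmod w ->
  Cmod (f w) <= exp (- (fst w * fst w - snd w * snd w) / 2 + A * Cmod w + B).

Definition point (t x : R) : C := t + x * Ci.

Lemma point_fst t x : fst (point t x) = t.
Proof. unfold point; simpl; ring. Qed.

Lemma point_snd t x : snd (point t x) = x.
Proof. unfold point; simpl; ring. Qed.

Lemma vl_sqr rho y : vl rho y * vl rho y = point (rho * rho - y * y) (2 * rho * y).
Proof. unfold vl, point. apply C_eq; simpl; ring. Qed.

(** Far to the left the vertical segments joining the parabola to its chord, or to a horizontal
    line, contribute nothing. *)
Lemma vertical_far (f : C -> C) (A B r rho : R) : gdecay f A B -> 0 <= A -> 0 < rho < 1 -> 0 <= r ->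
  exists M, forall (F : C -> C) (y x1 x2 : R), 2 <= Rabs y ->
    Rabs x1 <= r + 2 * Rabs y -> Rabs x2 <= r + 2 * Rabs y ->
    (forall x, Rmin x1 x2 <= x <= Rmax x1 x2 ->
       cderiv F (point (rho * rho - y * y) x) (f (point (rho * rho - y * y) x)))%R ->
    Cmod (F (point (rho * rho - y * y) x2) - F (point (rho * rho - y * y) x1))%C <= M * wt y.
Proof.
  intros Hf HA Hr H0.
  (* y^4 dominates through (y^2 - c)^2 >= 0; c collects the coefficients of y^2 *)
  set (c := (6 + A)%R).
  destruct (gauss_dom 1 (2 * A + 8) (c * c / 2 + r * r + A + A * r + B + 4 * r) Rlt_0_1) as [M HM].
  exists M. intros F y x1 x2 Hy Hx1 Hx2 HF. eapply Rle_trans; [|apply HM].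
  set (t := (rho * rho - y * y)%R) in *. set (X := (r + 2 * Rabs y)%R) in *.
  assert (Eyy : (Rabs y * Rabs y = y * y)%R) by (rewrite <- Rabs_mult; apply Rabs_pos_eq; nra).
  assert (Yp := Rabs_pos y).
  assert (Rr : rho * rho <= 1) by nra.
  assert (Y4 : 4 <= y * y) by (rewrite <- Eyy; nra).
  assert (Ht : (Rabs t = y * y - rho * rho)%R) by (unfold t; rewrite Rabs_left; nra).
  set (Z := (- (t * t - X * X) / 2 + A * (Rabs t + X) + B)%R).
  assert (S : Cmod (F (point t x2) - F (point t x1))%C <= 2 * (Cmod (point t x2 - point t x1)%C * exp Z)).
  { apply (segment_bound F f). intros u Hu.
    replace (point t x1 + u * (point t x2 - point t x1)) with (point t (x1 + u * (x2 - x1)))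
      by (unfold point; rewrite RtoC_plus, RtoC_mult, RtoC_minus; ring).
    set (x := (x1 + u * (x2 - x1))%R).
    assert (Hxr : Rmin x1 x2 <= x <= Rmax x1 x2).
    { unfold x, Rmin, Rmax. destruct Rle_dec; nra. }
    assert (HxX : Rabs x <= X).
    { apply Rabs_le_between in Hx1. apply Rabs_le_between in Hx2. apply Rabs_le.
      unfold Rmin, Rmax in Hxr. destruct Rle_dec; lra. }
    split; [now apply HF|].
    assert (Hm : Rabs t <= Cmod (point t x) <= Rabs t + X).
    { split.
      - rewrite <- (point_fst t x) at 1. apply fst_le_Cmod.
      - eapply Rle_trans; [apply Cmod_le_sum|]. rewrite point_fst, point_snd. lra. }
    eapply Rle_trans; [apply Hf; lra|]. apply exp_mono. rewrite point_fst, point_snd. unfold Z.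
    assert (x * x <= X * X).
    { replace (x * x)%R with (Rabs x * Rabs x)%R by (rewrite <- Rabs_mult; apply Rabs_pos_eq; nra).
      assert (P := Rabs_pos x). apply Rmult_le_compat; lra. }
    assert (A * Cmod (point t x) <= A * (Rabs t + X)) by (apply Rmult_le_compat_l; lra).
    lra. }
  eapply Rle_trans; [exact S|].
  replace (point t x2 - point t x1) with (RtoC (x2 - x1) * Ci) by (unfold point; rewrite RtoC_minus; ring).
  rewrite Cmod_mult, Cmod_Ci, Rmult_1_r, Cmod_R.
  assert (LX : Rabs (x2 - x1) <= 2 * X).
  { unfold Rminus. eapply Rle_trans; [apply Rabs_triang|]. rewrite Rabs_Ropp. lra. }
  assert (X0 : 0 <= X) by (unfold X; lra).
  apply Rle_trans with (exp (4 * X) * exp Z)%R.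
  - assert (E4 := exp_ge_1_plus (4 * X)). assert (Ez := exp_pos Z).
    rewrite <- Rmult_assoc. apply Rmult_le_compat_r; lra.
  - rewrite <- exp_plus. apply exp_mono. unfold Z. rewrite Ht.
    assert (T2 : t * t >= y * y * (y * y) - 2 * (y * y)) by (unfold t; nra).
    assert (XX : X * X <= 2 * (r * r) + 8 * (y * y)).
    { unfold X. rewrite <- Eyy. assert (0 <= (r - 2 * Rabs y) * (r - 2 * Rabs y)) by apply Rle_0_sqr. nra. }
    assert (SQ : 0 <= (y * y - c) * (y * y - c)) by apply Rle_0_sqr.
    assert (A * (y * y - rho * rho + X) <= A * (y * y + X)) by (apply Rmult_le_compat_l; nra).
    unfold X in *. unfold c in *. nra.
Qed.

Section Deformation.

Variables (f F : C -> C) (A B r rho : R).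

Hypothesis Hdec : gdecay f A B.

Hypothesis HA : 0 <= A.

Hypothesis Hr : 0 < r.

Hypothesis Hrho : 0 < rho < 1.

Hypothesis HF : forall w, slit w -> cderiv F w (f w).

Hypothesis Hc : forall w, slit w -> continuous f w.

Let g (y : R) : C := f (vl rho y * vl rho y) * (2 * vl rho y * Ci).

Hypothesis Hg : dom g.

Lemma slit_vl_sqr y : slit (vl rho y * vl rho y).
Proof.
  rewrite vl_sqr. destruct (Req_dec y 0) as [->|N].
  - apply slit_pos. rewrite point_fst. nra.
  - apply slit_im. rewrite point_snd. intros E. apply N. nra.
Qed.

Lemma parabola_primitive y : rderiv (fun y => F (vl rho y * vl rho y)) y (g y).
Proof.
  eapply rderiv_eq.
  - apply (rderiv_comp (fun p => F (p * p))); [|apply vl_rderiv].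
    apply (cderiv_comp F (fun p => p * p)); [apply HF, slit_vl_sqr|].
    cderive.
  - unfold g. ring.
Qed.

Lemma RIntC_parabola y : RIntC g 0 y = F (vl rho y * vl rho y) - F (vl rho 0 * vl rho 0).
Proof.
  apply is_RIntC_unique.
  apply (is_RIntC_derive (fun y => F (vl rho y * vl rho y))). intros t _.
  split; [apply parabola_primitive|apply Hg].
Qed.

Lemma hline_limit (sg : R) (l : C) : (sg = 1 \/ sg = - (1))%R ->
  filterlim (fun y => F (vl rho (sg * y) * vl rho (sg * y))) (Rbar_locally p_infty) (locally l) ->
  filterlim (fun t => F (point t (sg * r))) (Rbar_locally m_infty) (locally l).
Proof.
  intros Hsg Hl. rewrite filterlim_C in Hl |- * by apply Rbar_locally_filter. intros e He.
  destruct (Hl (e / 2)%R ltac:(lra)) as [N1 HN1].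
  destruct (vertical_far f A B r rho Hdec HA Hrho ltac:(lra)) as [M HM].
  destruct (wt_small (Rabs M) (e / 2) (Rabs_pos M) ltac:(lra)) as [N2 [N2p HN2]].
  set (N := (Rabs N1 + N2 + 2)%R). assert (NP := Rabs_pos N1). assert (NA := Rle_abs N1).
  exists (- (N * N))%R. intros t Ht.
  set (y := sqrt (rho * rho - t)).
  assert (Pt : 0 <= rho * rho - t) by nra.
  assert (Ey : (y * y = rho * rho - t)%R) by (unfold y; now rewrite sqrt_sqrt).
  assert (Hy0 : 0 <= y) by apply sqrt_pos.
  assert (HyN : N < y) by (apply Rnot_le_lt; intros L; assert (y * y <= N * N) by nra; nra).
  set (ys := (sg * y)%R).
  assert (Eys : (ys * ys = y * y)%R) by (unfold ys; destruct Hsg as [-> | ->]; ring).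
  assert (Ays : Rabs ys = y).
  { unfold ys. destruct Hsg as [-> | ->].
    - rewrite Rmult_1_l. now apply Rabs_pos_eq.
    - replace (- (1) * y)%R with (- y)%R by ring. rewrite Rabs_Ropp. now apply Rabs_pos_eq. }
  specialize (HN1 y ltac:(unfold N in HyN; lra)). fold ys in HN1.
  rewrite vl_sqr in HN1.
  assert (Et : (rho * rho - ys * ys = t)%R) by lra.
  specialize (HM F ys (2 * rho * ys)%R (sg * r)%R).
  rewrite Et in HM, HN1.
  assert (K : Cmod (F (point t (sg * r)) - F (point t (2 * rho * ys)))%C <= M * wt ys).
  { apply HM.
    - rewrite Ays. unfold N in HyN. lra.
    - rewrite Rabs_mult, Ays, Rabs_pos_eq; nra.
    - rewrite Rabs_mult. replace (Rabs sg) with 1%R.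
      + rewrite (Rabs_pos_eq r), Ays; lra.
      + destruct Hsg as [-> | ->]; [now rewrite Rabs_R1|]. rewrite Rabs_Ropp. now rewrite Rabs_R1.
    - intros x Hx. apply HF. apply slit_im. rewrite point_snd.
      assert (Y1 : 2 <= y) by (unfold N in HyN; lra).
      unfold ys in Hx. unfold Rmin, Rmax in Hx.
      destruct Hsg as [-> | ->]; destruct Rle_dec; nra. }
  specialize (HN2 ys ltac:(rewrite Ays; unfold N in HyN; lra)).
  assert (MW : M * wt ys <= Rabs M * wt ys).
  { apply Rmult_le_compat_r; [left; apply wt_pos|apply Rle_abs]. }
  replace (F (point t (sg * r)) - l) with
    ((F (point t (sg * r)) - F (point t (2 * rho * ys))) + (F (point t (2 * rho * ys)) - l)) by ring.
  eapply Rle_lt_trans; [apply Cmod_triangle|]. lra.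
Qed.

Lemma hline_integral (x : R) (l : C) : x <> 0%R ->
  filterlim (fun t => F (point t x)) (Rbar_locally m_infty) (locally l) ->
  CRInt_gen (fun t : R => f (point t x)) (Rbar_locally m_infty) (at_point 0%R) = F (point 0 x) - l.
Proof.
  intros Hx Hl. apply (@is_RInt_gen_unique C_R_CompleteNormedModule (Rbar_locally m_infty) (at_point 0%R) _ _).
  assert (Hs : forall t, slit (point t x)) by (intros t; apply slit_im; now rewrite point_snd).
  assert (Dp : forall t, rderiv (fun t => point t x) t (RtoC 1)).
  { intros t. apply (rderiv_eq _ _ (RtoC 1 * RtoC 1)); [|ring]. unfold point.
    apply (rderiv_comp (fun z => z + x * Ci) RtoC t 1 1).
    - eapply cderiv_eq; [cderive|]. ring.
    - apply rderiv_RtoC. }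
  apply (is_RIntC_gen_derive (fun t => F (point t x))); auto.
  - apply Rbar_locally_filter.
  - apply at_point_filter.
  - apply filter_forall. intros ab t _. split.
    + eapply rderiv_eq; [apply (rderiv_comp F); [apply HF, Hs|apply Dp]|]. ring.
    + apply (continuous_comp (fun t => point t x) f); [|apply Hc, Hs].
      apply continuous_Cplus; [|apply continuous_Cconst]. apply continuous_RtoC, continuous_id.
  - intros P HP. unfold filtermap, at_point. now apply locally_singleton.
Qed.

(** The half-lines, the arc and the parabola are all evaluated by one primitive F on the cut plane,
    whose limits along the half-lines and along the arms of the parabola agree. *)
Lemma hankel_parabola : hankel_int r f = Int g.
Proof.
  destruct (Int_limits g Hg) as [lm [lp [Lm [Lp E]]]].
  set (F0 := F (vl rho 0 * vl rho 0)) in *.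
  assert (Gp : filterlim (fun y => F (vl rho (1 * y) * vl rho (1 * y))) (Rbar_locally p_infty) (locally (lp + F0))).
  { rewrite filterlim_C in Lp |- * by apply Rbar_locally_filter. intros e He.
    generalize (Lp e He). apply filter_imp. intros y Hy. rewrite RIntC_parabola in Hy. fold F0 in Hy.
    rewrite Rmult_1_l. now replace (F (vl rho y * vl rho y) - (lp + F0)) with
      (F (vl rho y * vl rho y) - F0 - lp) by ring. }
  assert (Gm : filterlim (fun y => F (vl rho (- (1) * y) * vl rho (- (1) * y))) (Rbar_locally p_infty) (locally (lm + F0))).
  { rewrite filterlim_C in Lm |- * by apply Rbar_locally_filter. intros e He.
    destruct (Lm e He) as [N HN]. exists (- N)%R. intros y Hy.
    specialize (HN (- (1) * y)%R ltac:(lra)). rewrite RIntC_parabola in HN. fold F0 in HN.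
    now replace (F (vl rho (- (1) * y) * vl rho (- (1) * y)) - (lm + F0)) with
      (F (vl rho (- (1) * y) * vl rho (- (1) * y)) - F0 - lm) by ring. }
  apply (hline_limit 1) in Gp; [|now left].
  apply (hline_limit (- (1))) in Gm; [|now right].
  unfold hankel_int.
  rewrite (functional_extensionality (fun t : R => f (t - Ci * r)) (fun t => f (point t (- (1) * r)))).
  2: { intros t. f_equal. unfold point. rewrite RtoC_mult, RtoC_opp. ring. }
  rewrite (functional_extensionality (fun t : R => f (t + Ci * r)) (fun t => f (point t (1 * r)))).
  2: { intros t. f_equal. unfold point. rewrite RtoC_mult. ring. }
  assert (Nm : (- (1) * r)%R <> 0%R) by lra. assert (Np : (1 * r)%R <> 0%R) by lra.
  rewrite (hline_integral _ _ Nm Gm), (hline_integral _ _ Np Gp).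
  assert (Arc : @RInt C_R_CompleteNormedModule
      (fun th : R => f (r * Cexp (Ci * th)) * (Ci * r * Cexp (Ci * th))) (- PI / 2)%R (PI / 2)%R
      = F (point 0 (1 * r)) - F (point 0 (- (1) * r))).
  { apply is_RIntC_unique.
    replace (F (point 0 (1 * r)) - F (point 0 (- (1) * r))) with
      (F (r * Cexp (Ci * (PI / 2)%R)) - F (r * Cexp (Ci * (- PI / 2)%R))).
    - apply (is_RIntC_derive (fun th : R => F (r * Cexp (Ci * th)))).
      intros t Ht. rewrite Rmin_left, Rmax_right in Ht by (assert (P := PI_RGT_0); lra).
      assert (Hs : slit (r * Cexp (Ci * t))).
      { replace (r * Cexp (Ci * t)) with (Cexp (ln r + Ci * t)).
        - apply Cexp_slit. simpl. assert (P := PI_RGT_0). lra.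
        - rewrite Cexp_plus, Cexp_real, exp_ln; auto. }
      split.
      + eapply rderiv_eq.
        * apply (rderiv_comp (fun z => F (r * Cexp (Ci * z))) RtoC); [|apply rderiv_RtoC].
          apply (cderiv_comp F (fun z => r * Cexp (Ci * z))); [now apply HF|].
          cderive.
        * ring.
      + apply (continuous_comp RtoC (fun z => f (r * Cexp (Ci * z)) * (Ci * r * Cexp (Ci * z)))); [apply cont_RtoC|].
        apply continuous_Cmult; [|apply hol_continuous; auto with hol].
        apply (continuous_comp (fun z => r * Cexp (Ci * z)) f); [apply hol_continuous; auto with hol|now apply Hc].
    - f_equal; [f_equal|f_equal; f_equal]; unfold point, Cexp; apply C_eq; simpl;
        replace (0 * (PI / 2) - 1 * 0)%R with 0%R by ring;
        replace (0 * (- PI / 2) - 1 * 0)%R with 0%R by ring;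
        replace (0 * 0 + 1 * (PI / 2))%R with (PI / 2)%R by ring;
        replace (0 * 0 + 1 * (- PI / 2))%R with (- (PI / 2))%R by field;
        rewrite exp_0, ?cos_neg, ?sin_neg, ?cos_PI2, ?sin_PI2; ring. }
  rewrite Arc, E. ring.
Qed.

End Deformation.

(** An entire integrand gives nothing: the two ends of the parabola can be joined. *)
Lemma parabola_entire (f : C -> C) (A B rho : R) : gdecay f A B -> 0 <= A -> 0 < rho < 1 ->
  (forall w, hol f w) -> dom (fun y => f (vl rho y * vl rho y) * (2 * vl rho y * Ci)) ->
  Int (fun y => f (vl rho y * vl rho y) * (2 * vl rho y * Ci)) = 0.
Proof.
  intros Hdec HA Hrho Hh Hd.
  destruct (star_primitive (fun _ => True) 0 f) as [F HF]; auto.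
  { intros z _. now apply filter_forall. }
  { intros z _ t _. exact I. }
  { intros z _. now apply hol_continuous. }
  apply Cmod_eq_0. apply Rle_antisym; [|apply Cmod_ge_0]. apply le_epsilon. intros e He.
  destruct (Int_approx _ (e / 2) Hd ltac:(lra)) as [T1 [T1p H1]].
  destruct (vertical_far f A B 0 rho Hdec HA Hrho ltac:(lra)) as [M HM].
  destruct (wt_small (Rabs M) (e / 2) (Rabs_pos M) ltac:(lra)) as [N2 [N2p HN2]].
  set (T := (T1 + N2 + 2)%R). specialize (H1 T ltac:(unfold T; lra)).
  assert (ET : RIntC (fun y => f (vl rho y * vl rho y) * (2 * vl rho y * Ci)) (- T) T
    = F (vl rho T * vl rho T) - F (vl rho (- T) * vl rho (- T))).
  { apply is_RIntC_unique.
    apply (is_RIntC_derive (fun y => F (vl rho y * vl rho y))). intros t _.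
    split; [|apply Hd]. eapply rderiv_eq.
    - apply (rderiv_comp (fun p => F (p * p))); [|apply vl_rderiv].
      apply (cderiv_comp F (fun p => p * p)); [now apply HF|].
      cderive.
    - cbv beta. ring. }
  rewrite ET, !vl_sqr in H1.
  replace (- T * - T)%R with (T * T)%R in H1 by ring.
  assert (AT : Rabs T = T) by (apply Rabs_pos_eq; unfold T; lra).
  assert (K := HM F T (2 * rho * - T)%R (2 * rho * T)%R).
  specialize (HN2 T ltac:(rewrite AT; unfold T; lra)).
  assert (K' : Cmod (F (point (rho * rho - T * T) (2 * rho * T)) - F (point (rho * rho - T * T) (2 * rho * - T)))%C <= M * wt T).
  { apply K.
    - rewrite AT. unfold T; lra.
    - rewrite Rabs_mult, Rabs_Ropp, AT, Rabs_pos_eq by lra. assert (0 < T) by (unfold T; lra). nra.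
    - rewrite Rabs_mult, AT, Rabs_pos_eq by lra. assert (0 < T) by (unfold T; lra). nra.
    - intros x _. now apply HF. }
  assert (MW : M * wt T <= Rabs M * wt T).
  { apply Rmult_le_compat_r; [left; apply wt_pos|apply Rle_abs]. }
  set (I := Int _) in *. set (D := F _ - F _) in *.
  replace I with ((I - D) + D) by ring.
  eapply Rle_trans; [apply Cmod_triangle|]. lra.
Qed.

Definition qexp (z w : C) : C := Cexp (- (w ^ 2 / 2) + z * w).

Lemma qexp_hol z w : hol (qexp z) w.
Proof.
  unfold qexp. apply hol_Cexp. apply hol_plus; [|auto with hol]. apply hol_opp.
  apply (hol_mult (fun w => w ^ 2) (fun _ => / 2)); auto with hol.
Qed.

Lemma qexp_bound z w : Cmod (qexp z w) <= exp (- (fst w * fst w - snd w * snd w) / 2 + Cmod z * Cmod w).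
Proof.
  unfold qexp. rewrite Cexp_mod. apply exp_mono. rewrite <- Cmod_mult.
  assert (K := fst_le_Cmod (z * w)). assert (K2 := Rle_abs (fst (z * w)%C)).
  replace (fst (- (w ^ 2 / 2) + z * w)) with (- (fst w * fst w - snd w * snd w) / 2 + fst (z * w)%C)%R.
  - lra.
  - simpl. field.
Qed.

Lemma gdecay_power (z a : C) :
  gdecay (fun w => qexp z w * Cpower w a) (Cmod z + Cmod a) (Cmod a * PI).
Proof.
  intros w Hw. rewrite Cmod_mult.
  apply Rle_trans with (exp (- (fst w * fst w - snd w * snd w) / 2 + Cmod z * Cmod w) * exp (Cmod a * (Cmod w + PI)))%R.
  - apply Rmult_le_compat; try apply Cmod_ge_0; [apply qexp_bound|].
    eapply Rle_trans; [apply Cpower_mod_le|]. apply exp_mono.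
    apply Rmult_le_compat_l; [apply Cmod_ge_0|].
    eapply Rle_trans; [apply Cmod_le_sum|]. simpl.
    assert (L : 0 <= ln (Cmod w)).
    { rewrite <- ln_1. destruct Hw as [Hw|Hw]; [left; apply ln_increasing; lra|right; now rewrite <- Hw]. }
    assert (L2 := ln_le_lin 1 (Cmod w) Rlt_0_1 ltac:(lra)). rewrite ln_1 in L2.
    rewrite Rabs_pos_eq by auto. assert (G := Carg_bound w).
    assert (Rabs (Carg w) <= PI) by (apply Rabs_le; lra). lra.
  - rewrite <- exp_plus. apply exp_mono. lra.
Qed.

Lemma pow_le_exp (x : R) (n : nat) : 0 <= x -> x ^ n <= exp (INR n * x).
Proof.
  intros H. induction n.
  - simpl. rewrite Rmult_0_l, exp_0. lra.
  - rewrite S_INR, Rmult_plus_distr_r, exp_plus, Rmult_comm. simpl.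
    assert (E := exp_ge_1_plus (1 * x)). rewrite (Rmult_comm x), Rmult_comm.
    apply Rmult_le_compat; auto; [now apply pow_le|lra].
Qed.

Lemma gdecay_pow (z : C) (n : nat) : gdecay (fun w => qexp z w * w ^ n) (Cmod z + INR n) 0.
Proof.
  intros w Hw. rewrite Cmod_mult, Cmod_pow.
  apply Rle_trans with (exp (- (fst w * fst w - snd w * snd w) / 2 + Cmod z * Cmod w) * exp (INR n * Cmod w))%R.
  - apply Rmult_le_compat; [apply Cmod_ge_0|apply pow_le, Cmod_ge_0|apply qexp_bound|].
    apply pow_le_exp, Cmod_ge_0.
  - rewrite <- exp_plus. apply exp_mono. lra.
Qed.

Definition absorbs (E : R -> C) : Prop := cont E /\ forall k, grows k -> dom (fun y => k y * E y).

Lemma absorbs_gauss rho (v : C) : 0 < fst v -> absorbs (fun y => Cexp (v * (vl rho y * vl rho y))).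
Proof.
  intros Hv. split.
  - apply (vl_comp (fun p => Cexp (v * (p * p)))). intros y. apply hol_continuous. auto 8 with hol.
  - intros k Hk. now apply par_dom.
Qed.

Lemma absorbs_quartic rho z : 0 < rho < 1 -> absorbs (fun y => qexp z (vl rho y * vl rho y)).
Proof.
  intros Hr.
  assert (Hc : cont (fun y => qexp z (vl rho y * vl rho y))).
  { apply (vl_comp (fun p => qexp z (p * p))). intros y. apply hol_continuous.
    apply (hol_comp (qexp z) (fun p => p * p)); auto with hol. apply qexp_hol. }
  split; auto. intros k [Hk [K [K0 HK]]].
  set (c := (6 + Cmod z)%R).
  destruct (gauss_dom 1 1 (c * c / 2 + Cmod z) Rlt_0_1) as [M HM].
  apply (dom_of_bound _ K (fun y => exp (- (1) * (y * y) + 1 * Rabs y + (c * c / 2 + Cmod z)))); auto.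
  - intros t. now apply continuous_Cmult.
  - intros y. rewrite Cmod_mult.
    apply Rle_trans with (K * exp (Rabs y) * exp (- (y * y) + (c * c / 2 + Cmod z)))%R.
    + apply Rmult_le_compat; auto; try apply Cmod_ge_0.
      eapply Rle_trans; [apply qexp_bound|]. apply exp_mono.
      rewrite Cmod_mult, vl_mod_sqr, vl_sqr, point_fst, point_snd.
      assert (Zp := Cmod_ge_0 z). assert (Rr : rho * rho <= 1) by nra.
      assert (Y0 : 0 <= y * y) by nra.
      assert (SQ : 0 <= (y * y - c) * (y * y - c)) by apply Rle_0_sqr.
      assert (Cmod z * (rho * rho + y * y) <= Cmod z * (1 + y * y)) by (apply Rmult_le_compat_l; lra).
      assert (T : (rho * rho - y * y) * (rho * rho - y * y) >= y * y * (y * y) - 2 * (y * y)) by nra.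
      assert (T2 : 2 * rho * y * (2 * rho * y) <= 4 * (y * y)).
      { replace (2 * rho * y * (2 * rho * y))%R with (4 * (rho * rho) * (y * y))%R by ring. nra. }
      unfold c in *. nra.
    + rewrite Rmult_assoc, <- exp_plus. apply Rmult_le_compat_l; auto. apply exp_mono. lra.
  - exists M. exact HM.
Qed.

(** The factor E is e^(v w) for the power function and e^(-w^2/2 + z w) for the parabolic cylinder
    function, where w = p^2. *)
Definition kint (rho : R) (E : R -> C) (s : C) : C := Int (fun y => Jk rho s y * E y).

Lemma grows_exp_log rho A : 0 < rho -> 0 <= A -> grows (fun y => RtoC (exp (A * Cmod (Clog (vl rho y))))).
Proof.
  intros Hr HA. destruct (log_growth rho A Hr HA) as [K [K0 HK]]. split.
  - intros y. apply continuous_RtoC.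
    apply (continuous_real_fun (fun x => exp (A * x)) (fun y => Cmod (Clog (vl rho y)))).
    + auto_derive. auto.
    + apply continuous_Cmod. now apply Clog_vl_cont.
  - exists K. split; [lra|]. intros y. rewrite Cmod_R, Rabs_pos_eq by (left; apply exp_pos). apply HK.
Qed.

Lemma kint_edom rho E s : 0 < rho -> absorbs E ->
  edom (fun y => 2 * Ci * Cpower (vl rho y) (- (1)) * E y) (fun y => 2 * Clog (vl rho y)) s 1.
Proof.
  intros Hr [HEc HE]. repeat split; try lra.
  - intros y. apply continuous_Cmult; auto. apply (grows_Cmul (2 * Ci) _ (grows_power rho (- (1)) Hr)).
  - intros y. apply continuous_Cmult; [apply continuous_Cconst|now apply Clog_vl_cont].
  - set (A := (1 + 2 + 2 * Cmod s)%R).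
    assert (HA : 0 <= A) by (unfold A; assert (Q := Cmod_ge_0 s); lra).
    destruct (HE _ (grows_exp_log rho A Hr HA)) as [_ [M HM]].
    exists (2 * M)%R. intros y. specialize (HM y). cbv beta in HM. rewrite Cmod_mult in HM.
    rewrite Cmod_R, Rabs_pos_eq in HM by (left; apply exp_pos).
    rewrite !Cmod_mult, Cmod_Ci, Cmod_R, (Rabs_pos_eq 2) by lra.
    set (l := Cmod (Clog (vl rho y))) in *.
    assert (B1 : Cmod (Cpower (vl rho y) (- (1))) <= exp (1 * l)).
    { eapply Rle_trans; [apply Cpower_mod_le|]. rewrite Cmod_opp, Cmod_1. apply Rle_refl. }
    assert (B2 : Cmod (Cexp (s * (2 * Clog (vl rho y)))) <= exp (2 * Cmod s * l)).
    { eapply Rle_trans; [apply Cexp_mod_le|]. rewrite !Cmod_mult, Cmod_R, Rabs_pos_eq by lra.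
      apply exp_mono. fold l. lra. }
    assert (E0 := Cmod_ge_0 (E y)).
    replace (A * l)%R with (1 * l + 1 * (2 * l) + 2 * Cmod s * l)%R in HM by (unfold A; ring).
    rewrite !exp_plus in HM.
    apply Rle_trans with (2 * (exp (1 * l) * exp (1 * (2 * l)) * exp (2 * Cmod s * l) * Cmod (E y)))%R; [|lra].
    assert (X := Rmult_le_compat _ _ _ _ (Cmod_ge_0 _) (Cmod_ge_0 _) B1 B2).
    assert (Y : 0 <= exp (1 * (2 * l)) * Cmod (E y)) by (apply Rmult_le_pos; [left; apply exp_pos|auto]).
    apply (Rmult_le_compat_r _ _ _ Y) in X. lra.
Qed.

Lemma kint_integrand rho s y : Cpower (vl rho y) (- (1)) * Cexp (s * (2 * Clog (vl rho y))) = Cpower (vl rho y) (2 * s - 1).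
Proof. unfold Cpower. rewrite <- Cexp_plus. f_equal. ring. Qed.

Lemma kint_eint rho E s : kint rho E s = eint (fun y => 2 * Ci * Cpower (vl rho y) (- (1)) * E y) (fun y => 2 * Clog (vl rho y)) s.
Proof.
  unfold kint, eint, Jk. apply Int_ext. intros y. rewrite <- kint_integrand. ring.
Qed.

Lemma kint_fun rho E : kint rho E = eint (fun y => 2 * Ci * Cpower (vl rho y) (- (1)) * E y) (fun y => 2 * Clog (vl rho y)).
Proof. apply functional_extensionality. intros s. apply kint_eint. Qed.

(** The derivative of [Jk] with respect to s. *)
Definition dJk (rho : R) (s : C) (y : R) : C := 4 * Ci * (Clog (vl rho y) * Cpower (vl rho y) (2 * s - 1)).

Lemma kint_cderiv rho E s : 0 < rho -> absorbs E ->
  cderiv (kint rho E) s (Int (fun y => dJk rho s y * E y)).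
Proof.
  intros Hr HE. rewrite kint_fun. eapply cderiv_eq.
  - apply (eint_cderiv _ _ s 1). now apply kint_edom.
  - unfold eint, dJk. apply Int_ext. intros y. rewrite <- kint_integrand. ring.
Qed.

Lemma kint_hol rho E s : 0 < rho -> absorbs E -> hol (kint rho E) s.
Proof. intros Hr HE. rewrite kint_fun. apply (eint_hol _ _ s 1). now apply kint_edom. Qed.

(** Where a pole of Gamma meets a zero of the contour integral, the product is a quotient of this
    kind, and its value is the derivative of the integral. *)
Lemma kint_quotient rho E (s0 : C) : 0 < rho -> absorbs E -> kint rho E s0 = 0 ->
  exists Q : C -> C, Q s0 = Int (fun y => dJk rho s0 y * E y) /\
    (forall s, s <> s0 -> Q s = kint rho E s / (s - s0)) /\ forall s, exists l, cderiv Q s l.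
Proof.
  intros Hr HE H0.
  set (D := Int (fun y => dJk rho s0 y * E y)).
  exists (fun s => if Ceq_dec s s0 then D else kint rho E s / (s - s0)).
  assert (Q0 : (if Ceq_dec s0 s0 then D else kint rho E s0 / (s0 - s0)) = D) by (now destruct (Ceq_dec s0 s0)).
  assert (Q1 : forall s, s <> s0 -> (if Ceq_dec s s0 then D else kint rho E s / (s - s0)) = kint rho E s / (s - s0))
    by (intros s Hs; destruct (Ceq_dec s s0); [contradiction|reflexivity]).
  split; [exact Q0|]. split; [exact Q1|]. intros s.
  destruct (Ceq_dec s s0) as [->|Hs].
  - assert (C1 := kint_cderiv rho E s0 Hr HE). assert (Ed := kint_edom rho E s0 Hr HE).
    set (k := fun y => 2 * Ci * Cpower (vl rho y) (- (1)) * E y) in Ed.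
    set (L := fun y => 2 * Clog (vl rho y)) in Ed.
    rewrite kint_fun in *. fold k L in C1, H0, Q1 |- *.
    eexists. apply (eint_quotient_cderiv k L s0 1 _ Ed H0); [|exact Q1].
    destruct (Ceq_dec s0 s0) as [_|X]; [|now elim X].
    apply (cderiv_unique _ _ _ _ C1). now apply (eint_cderiv k L s0 1).
  - assert (Hs' : s - s0 <> 0) by (intros X; apply Hs; now apply Ceq_minus).
    destruct (hol_cderiv (fun s => kint rho E s / (s - s0)) s) as [l Hl].
    + apply hol_div; auto with hol. now apply kint_hol.
    + exists l. apply (cderiv_ext_loc (fun s => kint rho E s / (s - s0))); auto.
      generalize (locally_neq s s0 Hs). apply filter_imp. intros w Hw. symmetry. now apply Q1.
Qed.

Lemma punctured_unique (f g : C -> C) (z : C) : continuous f z -> continuous g z ->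
  locally' z (fun w => f w = g w) -> f z = g z.
Proof.
  intros Hf Hg H. apply C_eq_eps. intros e He.
  rewrite continuous_C_iff in Hf, Hg. rewrite locally'_C in H.
  destruct (Hf (e / 2)%R ltac:(lra)) as [d1 [D1 H1]]. destruct (Hg (e / 2)%R ltac:(lra)) as [d2 [D2 H2]].
  destruct H as [d3 [D3 H3]].
  set (m := (Rmin d1 (Rmin d2 d3) / 2)%R).
  assert (M1 := Rmin_l d1 (Rmin d2 d3)). assert (M2 := Rmin_r d1 (Rmin d2 d3)).
  assert (M3 := Rmin_l d2 d3). assert (M4 := Rmin_r d2 d3).
  assert (Mp : 0 < Rmin d1 (Rmin d2 d3)) by (repeat apply Rmin_glb_lt; auto).
  assert (Em : Cmod (z + m - z) = m).
  { replace (z + m - z) with (RtoC m) by ring. rewrite Cmod_R. apply Rabs_pos_eq. unfold m; lra. }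
  specialize (H1 (z + m) ltac:(rewrite Em; unfold m; lra)).
  specialize (H2 (z + m) ltac:(rewrite Em; unfold m; lra)).
  rewrite H3 in H1.
  - replace (f z - g z) with ((g (z + m) - g z) - (g (z + m) - f z)) by ring.
    eapply Rle_trans; [apply Cmod_triangle'|]. lra.
  - rewrite Em; unfold m; lra.
  - intros X. rewrite X in Em. replace (z - z) with (RtoC 0) in Em by ring. rewrite Cmod_0 in Em. unfold m in Em. lra.
Qed.

Lemma slit_open : opens slit.
Proof. intros z. apply locally_slit. Qed.

Lemma slit_star : star slit 1.
Proof.
  intros z Hz t Ht. destruct (slit_iff z Hz) as [H|H].
  - apply slit_pos. simpl. nra.
  - destruct (Req_dec t 0) as [->|Ht0].
    + apply slit_pos. simpl. lra.
    + apply slit_im. simpl. intros E. apply H. nra.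
Qed.

Lemma Clog_sqr (p : C) : 0 < fst p -> Clog (p * p) = 2 * Clog p.
Proof.
  intros H. assert (G := Carg_half p H).
  rewrite Clog_mult; try (now apply slit_pos); [ring|]. lra.
Qed.

Lemma vl_sqr_power rho s y : 0 < rho ->
  Cpower (vl rho y * vl rho y) (s - 1) * (2 * vl rho y * Ci) = Jk rho s y.
Proof.
  intros Hr. unfold Jk. assert (Hs := vl_slit rho y Hr).
  replace (2 * s - 1) with (2 * (s - 1) + 1) by ring. rewrite Cpower_plus, Cpower_1 by auto.
  unfold Cpower at 1. rewrite Clog_sqr by now rewrite vl_fst.
  replace ((s - 1) * (2 * Clog (vl rho y))) with (2 * (s - 1) * Clog (vl rho y)) by ring.
  fold (Cpower (vl rho y) (2 * (s - 1))). ring.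
Qed.

Lemma pcfU_contour_kint (r rho : R) (b z : C) : 0 < r -> 0 < rho < 1 ->
  pcfU_contour r b z = Gamma (1 / 2 - b) / (2 * PI * Ci) * Cexp (- (z ^ 2 / 4))
    * kint rho (fun y => qexp z (vl rho y * vl rho y)) (b + 1 / 2).
Proof.
  intros Hr Hrho. unfold pcfU_contour. f_equal.
  assert (Hh : forall w, slit w -> hol (fun w => qexp z w * Cpower w (b - 1 / 2)) w).
  { intros w Hw. apply (hol_mult (qexp z) (fun w => Cpower w (b - 1 / 2))); [apply qexp_hol|].
    apply hol_Cpower; auto with hol. }
  destruct (star_primitive slit 1 (fun w => qexp z w * Cpower w (b - 1 / 2)) slit_open slit_star) as [F HF].
  { intros w Hw. now apply hol_continuous, Hh. }
  { intros w Hw _. now apply Hh. }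
  assert (Eg : forall y, qexp z (vl rho y * vl rho y) * Cpower (vl rho y * vl rho y) (b - 1 / 2) * (2 * vl rho y * Ci)
     = Jk rho (b + 1 / 2) y * qexp z (vl rho y * vl rho y)).
  { intros y. rewrite <- vl_sqr_power by lra. replace (b + 1 / 2 - 1) with (b - 1 / 2) by field. ring. }
  change (hankel_int r (fun w => qexp z w * Cpower w (b - 1 / 2))
    = kint rho (fun y => qexp z (vl rho y * vl rho y)) (b + 1 / 2)).
  rewrite (hankel_parabola _ F _ _ r rho (gdecay_power z (b - 1 / 2))); auto.
  - apply Int_ext. exact Eg.
  - apply Rplus_le_le_0_compat; apply Cmod_ge_0.
  - intros w Hw. now apply hol_continuous, Hh.
  - eapply dom_ext; [intros y; symmetry; apply Eg|].
    apply (absorbs_quartic rho z Hrho). apply Jk_grows. lra.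
Qed.

(** For these exponents the power is a polynomial and the integrand is entire. *)
Lemma kint_nat_zero (rho : R) (n : nat) (z : C) : 0 < rho < 1 ->
  kint rho (fun y => qexp z (vl rho y * vl rho y)) (INR (S n)) = 0.
Proof.
  intros Hr.
  assert (Eg : forall y, qexp z (vl rho y * vl rho y) * (vl rho y * vl rho y) ^ n * (2 * vl rho y * Ci)
     = Jk rho (INR (S n)) y * qexp z (vl rho y * vl rho y)).
  { intros y. rewrite <- vl_sqr_power by lra.
    replace (INR (S n) - 1) with (RtoC (INR n)) by (rewrite S_INR, RtoC_plus; ring).
    rewrite Cpower_nat; [ring|]. apply (slit_vl_sqr rho Hr). }
  unfold kint. rewrite <- (Int_ext _ _ Eg).
  apply (parabola_entire (fun w => qexp z w * w ^ n) _ _ rho (gdecay_pow z n)); auto.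
  - apply Rplus_le_le_0_compat; [apply Cmod_ge_0|apply pos_INR].
  - intros w. apply (hol_mult (qexp z) (fun w => w ^ n)); [apply qexp_hol|auto with hol].
  - eapply dom_ext; [intros y; symmetry; apply Eg|].
    apply (absorbs_quartic rho z Hr). apply Jk_grows. lra.
Qed.

Lemma twopii_nz : 2 * PI * Ci <> 0.
Proof.
  repeat apply Cmult_neq_0; [|apply PIC_nz|apply Ci_nz]. intros E. apply RtoC_inj in E. lra.
Qed.

Lemma Gamma_reflected_pole (n : nat) : exists A : C -> C, hol A (INR (S n)) /\
  locally' (RtoC (INR (S n))) (fun u => Gamma (1 - u) = A u / (u - INR (S n))).
Proof.
  destruct (Gamma_at_pole n) as [g [G1 G2]].
  assert (E : 1 - INR (S n) = - INR n) by (rewrite S_INR, RtoC_plus; ring).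
  exists (fun u => - g (1 - u)). split.
  - apply hol_opp. apply (hol_comp g (fun u => 1 - u)); auto with hol. now rewrite E.
  - rewrite locally'_C in G2 |- *. destruct G2 as [d [Hd K]]. exists d. split; auto.
    intros u Hu Hus.
    assert (Hx : u - INR (S n) <> 0) by (intros X; apply Hus; now apply Ceq_minus).
    rewrite K.
    + replace (1 - u - - INR n) with (- (u - INR (S n))) by (rewrite <- E; ring). field. auto.
    + rewrite <- E. replace (1 - u - (1 - INR (S n))) with (- (u - INR (S n))) by ring. now rewrite Cmod_opp.
    + rewrite <- E. intros X. apply Hus. replace u with (1 - (1 - u)) by ring. rewrite X. ring.
Qed.

Lemma not_pole_near (n : nat) : locally' (RtoC (INR (S n))) (fun u => ~ Gamma_pole (1 - u)).
Proof.
  rewrite locally'_C. exists 1%R. split; [lra|]. intros u Hu Hus [m Hm]. apply Hus.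
  assert (Eu : u = INR (S m)) by (rewrite S_INR, RtoC_plus; replace u with (1 - (1 - u)) by ring; rewrite Hm; ring).
  rewrite Eu, <- RtoC_minus, Cmod_R, !S_INR in Hu. rewrite Eu. apply Rabs_def2 in Hu.
  replace m with n; auto.
  destruct (Nat.lt_trichotomy m n) as [L|[L|L]]; auto; exfalso.
  - assert (INR m + 1 <= INR n) by (rewrite <- S_INR; apply le_INR; lia). lra.
  - assert (INR n + 1 <= INR m) by (rewrite <- S_INR; apply le_INR; lia). lra.
Qed.

(** At the exceptional parameters the pole of the Gamma factor is cancelled by a zero of the
    contour integral. *)
Lemma pcfU_pole (r rho : R) (n : nat) (z : C) (A : C -> C) : 0 < r -> 0 < rho < 1 ->
  hol A (INR (S n)) ->
  locally' (RtoC (INR (S n))) (fun u => Gamma (1 - u) = A u / (u - INR (S n))) ->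
  exists G, continues_across (fun b => pcfU_contour r b z) (INR (S n) - 1 / 2) G /\
    pcfU r (INR (S n) - 1 / 2) z = G (INR (S n) - 1 / 2) /\
    G (INR (S n) - 1 / 2) = A (INR (S n)) / (2 * PI * Ci) * Cexp (- (z ^ 2 / 4))
      * Int (fun y => dJk rho (INR (S n)) y * qexp z (vl rho y * vl rho y)).
Proof.
  intros Hr Hrho HA Gnear. assert (H2 := twopii_nz). assert (rp : 0 < rho) by lra.
  set (E := fun y => qexp z (vl rho y * vl rho y)).
  assert (HE : absorbs E) by now apply absorbs_quartic.
  assert (K0 : kint rho E (INR (S n)) = 0) by (now apply kint_nat_zero).
  destruct (kint_quotient rho E _ rp HE K0) as [Q [Q0 [Q1 Q2]]].
  set (s := RtoC (INR (S n))) in *.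
  set (G := fun b => A (b + 1 / 2) / (2 * PI * Ci) * Cexp (- (z ^ 2 / 4)) * Q (b + 1 / 2)).
  set (a := s - 1 / 2). assert (Ea : a + 1 / 2 = s) by (unfold a; field).
  assert (Gder : locally a (fun b => exists l, cderiv G b l)).
  { assert (Hb : hol (fun b => A (b + 1 / 2) / (2 * PI * Ci) * Cexp (- (z ^ 2 / 4))) a).
    { apply (hol_mult (fun b => A (b + 1 / 2) / (2 * PI * Ci)) (fun _ => Cexp (- (z ^ 2 / 4)))); auto with hol.
      apply (hol_mult (fun b => A (b + 1 / 2)) (fun _ => / (2 * PI * Ci))); auto with hol.
      apply (hol_comp A (fun b => b + 1 / 2)); auto with hol. now rewrite Ea. }
    destruct Hb as [f' [Hf' _]]. revert Hf'. apply filter_imp. intros b Hb.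
    destruct (Q2 (b + 1 / 2)) as [l Hl]. eexists. apply cderiv_mult; [exact Hb|].
    apply (cderiv_comp Q (fun b => b + 1 / 2)); [exact Hl|].
    cderive. }
  assert (Gc : continues_across (fun b => pcfU_contour r b z) a G).
  { split.
    - unfold holomorphic_near. revert Gder. apply filter_imp. intros b [l Hl]. exists l. now apply cderiv_ex_derive.
    - rewrite locally'_C in Gnear |- *. destruct Gnear as [d [Hd K]]. exists d. split; auto.
      intros b Hb Hba.
      assert (Hbs : b + 1 / 2 <> s) by (intros X; apply Hba; unfold a; rewrite <- X; field).
      rewrite (pcfU_contour_kint r rho b z Hr Hrho). unfold G. rewrite (Q1 _ Hbs).
      replace (1 / 2 - b) with (1 - (b + 1 / 2)) by field. rewrite K; auto.
      + fold E. unfold Cdiv. ring.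
      + rewrite <- Ea. now replace (b + 1 / 2 - (a + 1 / 2)) with (b - a) by field. }
  exists G. split; [exact Gc|]. split.
  - unfold pcfU. destruct excluded_middle_informative as [_|X].
    2: { exfalso. apply X. exists n. unfold a, s. rewrite S_INR, RtoC_plus. field. }
    unfold analytic_value.
    assert (Sp := epsilon_spec (inhabits (fun b => pcfU_contour r b z))
      (continues_across (fun b => pcfU_contour r b z) a) (ex_intro _ G Gc)).
    fold a. set (G' := epsilon _ _) in *.
    destruct Sp as [S1 S2], Gc as [S3 S4]. apply punctured_unique.
    + apply ex_derive_continuous_C. now apply locally_singleton in S1.
    + apply ex_derive_continuous_C. now apply locally_singleton in S3.
    + generalize (filter_and _ _ S2 S4). apply filter_imp. intros w [W1 W2]. now rewrite W1, W2.
  - unfold G. now rewrite Ea, Q0.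
Qed.

(** One kernel represents both the powers and the parabolic cylinder function: apart from the factor
    e^(- w^2 / 2), the loop integral for U is Hankel's.  At a positive integer s the kernel is the
    derivative [dJk] times the residue factor of Gamma (1 - s). *)
Theorem common_kernel (r rho : R) (s : C) : 0 < r -> 0 < rho <= 1 / 2 ->
  exists k : R -> C, grows k /\
    (forall v, 0 < fst v -> Cpower v (- s) = Int (fun y => k y * Cexp (v * (vl rho y * vl rho y)))) /\
    (forall z, pcfU r (s - 1 / 2) z =
       Cexp (- (z ^ 2 / 4)) * Int (fun y => k y * qexp z (vl rho y * vl rho y))).
Proof.
  intros Hr Hrho2. assert (H2 := twopii_nz). assert (rp : 0 < rho) by lra. assert (Hrho : 0 < rho < 1) by lra.
  destruct (classic (Gamma_pole (1 - s))) as [[n Hn]|Hp].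
  - assert (Es : s = INR (S n)) by (rewrite S_INR, RtoC_plus; replace s with (1 - (1 - s)) by ring; rewrite Hn; ring).
    destruct (Gamma_reflected_pole n) as [A [HA Gnear]].
    rewrite <- Es in *.
    exists (fun y => A s / (2 * PI * Ci) * dJk rho s y).
    assert (GJ : grows (dJk rho s)) by (apply grows_Cmul, grows_log_power; auto).
    split; [now apply grows_Cmul|]. split.
    + intros v Hv. set (E := fun y => Cexp (v * (vl rho y * vl rho y))).
      assert (HE : absorbs E) by now apply absorbs_gauss.
      assert (K0 : kint rho E s = 0).
      { change (kint rho E s) with (J rho s v). rewrite J_power by auto. rewrite Es, J_nat by auto. ring. }
      destruct (kint_quotient rho E s rp HE K0) as [Q [Q0 [Q1 Q2]]].
      transitivity (A s / (2 * PI * Ci) * Q s).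
      2: { rewrite Q0. rewrite <- (Int_Cmul _ (fun y => dJk rho s y * E y)) by now apply HE.
           apply Int_ext. intros y. unfold E. ring. }
      apply (punctured_unique (fun u => Cpower v (- u)) (fun u => A u / (2 * PI * Ci) * Q u)).
      * apply hol_continuous. auto with hol.
      * apply continuous_Cmult.
        -- apply (hol_continuous (fun u => A u / (2 * PI * Ci))).
           apply (hol_mult A (fun _ => / (2 * PI * Ci))); auto with hol.
        -- destruct (Q2 s) as [l Hl]. eapply cderiv_continuous; eauto.
      * assert (Np := not_pole_near n). rewrite <- Es in Np.
        generalize (filter_and _ _ Gnear Np). unfold locally', within. apply filter_imp.
        intros u Hu Hus. destruct (Hu Hus) as [U1 U2].
        assert (HJ := hankel_gamma rho u Hrho2 U2).
        rewrite (Q1 u Hus). change (kint rho E u) with (J rho u v). rewrite J_power by auto.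
        assert (Us : u - s <> 0) by (intros X; apply Hus; now apply Ceq_minus).
        replace (A u / (2 * PI * Ci) * (Cpower v (- u) * J rho u 1 / (u - s)))
          with (Cpower v (- u) * ((A u / (u - s)) * J rho u 1) / (2 * PI * Ci)) by (field; repeat split; auto using PIC_nz, Ci_nz).
        rewrite <- U1, HJ. field. split; auto using PIC_nz, Ci_nz.
    + intros z. rewrite Es in *.
      destruct (pcfU_pole r rho n z A Hr Hrho HA Gnear) as [G [_ [G1 G2]]]. rewrite G1, G2.
      replace (A (INR (S n)) / (2 * PI * Ci) * Cexp (- (z ^ 2 / 4)) * Int (fun y => dJk rho (INR (S n)) y * qexp z (vl rho y * vl rho y)))
        with (Cexp (- (z ^ 2 / 4)) * (A (INR (S n)) / (2 * PI * Ci) * Int (fun y => dJk rho (INR (S n)) y * qexp z (vl rho y * vl rho y)))) by ring.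
      assert (D := proj2 (absorbs_quartic rho z Hrho) _ GJ).
      rewrite <- (Int_Cmul _ _ D).
      f_equal. apply Int_ext. intros y. ring.
  - exists (fun y => Gamma (1 - s) / (2 * PI * Ci) * Jk rho s y).
    assert (GJ := Jk_grows rho s rp).
    split; [now apply grows_Cmul|]. split.
    + intros v Hv. assert (HJ := hankel_gamma rho s Hrho2 Hp).
      assert (P := J_power rho s v rp Hv).
      transitivity (Gamma (1 - s) / (2 * PI * Ci) * J rho s v).
      * rewrite P. replace (Gamma (1 - s) / (2 * PI * Ci) * (Cpower v (- s) * J rho s 1))
          with (Cpower v (- s) * (Gamma (1 - s) * J rho s 1) / (2 * PI * Ci)) by (unfold Cdiv; ring).
        rewrite HJ. field. split; auto using PIC_nz, Ci_nz.
      * unfold J, par. rewrite <- Int_Cmul by now apply par_dom. apply Int_ext. intros y. ring.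
    + intros z. unfold pcfU. destruct excluded_middle_informative as [X|_].
      { exfalso. apply Hp. now replace (1 - s) with (1 / 2 - (s - 1 / 2)) by field. }
      rewrite (pcfU_contour_kint r rho _ z Hr Hrho).
      replace (s - 1 / 2 + 1 / 2) with s by field. replace (1 / 2 - (s - 1 / 2)) with (1 - s) by field.
      replace (Gamma (1 - s) / (2 * PI * Ci) * Cexp (- (z ^ 2 / 4)) * kint rho (fun y => qexp z (vl rho y * vl rho y)) s)
        with (Cexp (- (z ^ 2 / 4)) * (Gamma (1 - s) / (2 * PI * Ci) * kint rho (fun y => qexp z (vl rho y * vl rho y)) s)) by ring.
      f_equal. unfold kint. rewrite <- Int_Cmul by now apply (absorbs_quartic rho z Hrho).
      apply Int_ext. intros y. ring.
Qed.

Lemma Jk_conj rho (s : C) y : Jk rho (Cconj s) y = - Cconj (Jk rho s (- y)).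
Proof.
  unfold Jk. rewrite !Cmult_conj, <- Cpower_conj, vl_conj, Cconj_conj.
  replace (Cconj (2 * s - 1)) with (2 * Cconj s - 1) by (apply C_eq; simpl; ring).
  replace (Cconj Ci) with (- Ci) by (apply C_eq; simpl; ring).
  replace (Cconj 2) with (RtoC 2) by (apply C_eq; simpl; ring). ring.
Qed.

Lemma qexp_conj z w : qexp (Cconj z) (Cconj w) = Cconj (qexp z w).
Proof.
  unfold qexp. rewrite <- Cexp_conj. f_equal. apply C_eq; simpl; field.
Qed.

Lemma kint_conj (rho : R) (z s : C) : 0 < rho < 1 ->
  kint rho (fun y => qexp (Cconj z) (vl rho y * vl rho y)) (Cconj s) =
  - Cconj (kint rho (fun y => qexp z (vl rho y * vl rho y)) s).
Proof.
  intros Hr. unfold kint.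
  assert (D := proj2 (absorbs_quartic rho z Hr) _ (Jk_grows rho s ltac:(lra))).
  rewrite <- (Int_reflect _ D), <- (Int_conj _ (dom_reflect _ D)).
  replace (- Int _) with (- (1) * Int (fun t => Cconj (Jk rho s (- t) * qexp z (vl rho (- t) * vl rho (- t))))) by ring.
  rewrite <- (Int_Cmul _ _ (dom_conj _ (dom_reflect _ D))).
  apply Int_ext. intros y. rewrite Jk_conj, Cmult_conj, <- qexp_conj, vl_conj, Cmult_conj, Cconj_conj. ring.
Qed.

Lemma Cinv_conj_total (z : C) : Cconj (/ z) = / Cconj z.
Proof.
  destruct (Ceq_dec z 0) as [->|N]; [|now apply Cinv_conj].
  unfold Cinv, Rdiv. apply C_eq; simpl; ring_simplify; auto.
Qed.

Lemma Gamma_conj_total (z : C) : Gamma (Cconj z) = Cconj (Gamma z).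
Proof.
  unfold Gamma. assert (H := Gamma_shift_pos z).
  change (Gamma_shift (Cconj z)) with (Gamma_shift z). set (n := Gamma_shift z) in *.
  rewrite !Euler_int_eul by (simpl; lra).
  unfold Cdiv. rewrite Cmult_conj, Cinv_conj_total, rising_conj. f_equal.
  rewrite <- eul_conj by (simpl; lra). f_equal. apply C_eq; simpl; ring.
Qed.

Lemma pcfU_contour_conj (r : R) (b z : C) : 0 < r ->
  pcfU_contour r (Cconj b) (Cconj z) = Cconj (pcfU_contour r b z).
Proof.
  intros Hr. assert (Hh : 0 < 1 / 2 < 1) by lra. assert (H2 := twopii_nz).
  rewrite !(pcfU_contour_kint r (1 / 2)) by auto.
  replace (Cconj b + 1 / 2) with (Cconj (b + 1 / 2)) by (apply C_eq; simpl; field).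
  rewrite kint_conj by auto. rewrite !Cmult_conj, <- Cexp_conj, Cdiv_conj, <- Gamma_conj_total by auto.
  replace (Cconj (1 / 2 - b)) with (1 / 2 - Cconj b) by (apply C_eq; simpl; field).
  replace (Cconj (- (z ^ 2 / 4))) with (- (Cconj z ^ 2 / 4)) by (apply C_eq; simpl; field).
  replace (Cconj (2 * PI * Ci)) with (- (2 * PI * Ci)) by (apply C_eq; simpl; ring).
  field. split; auto using PIC_nz, Ci_nz.
Qed.

(** At an exceptional parameter both sides are limits of values at which conjugation commutes with
    the contour integral. *)
Lemma pcfU_conj (r : R) (a z : C) : 0 < r -> pcfU r (Cconj a) (Cconj z) = Cconj (pcfU r a z).
Proof.
  intros Hr. assert (Hh : 0 < 1 / 2 < 1) by lra.
  destruct (classic (Gamma_pole (1 / 2 - a))) as [[n Hn]|Hp].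
  - assert (Ea : a = INR (S n) - 1 / 2).
    { rewrite S_INR, RtoC_plus. replace (RtoC (INR n)) with (- (1 / 2 - a)) by (rewrite Hn; ring). field. }
    assert (Er : Cconj a = INR (S n) - 1 / 2) by (rewrite Ea; apply C_eq; simpl; field).
    destruct (Gamma_reflected_pole n) as [A [HA Gnear]].
    destruct (pcfU_pole r (1 / 2) n z A Hr Hh HA Gnear) as [G [[G1 G2] [G3 _]]].
    destruct (pcfU_pole r (1 / 2) n (Cconj z) A Hr Hh HA Gnear) as [G' [[G1' G2'] [G3' _]]].
    rewrite Er. rewrite Ea at 1. rewrite G3, G3', <- Ea.
    apply locally_singleton in G1; apply ex_derive_continuous_C in G1.
    apply locally_singleton in G1'; apply ex_derive_continuous_C in G1'.
    rewrite <- Er in G1, G2. rewrite <- Ea in G1', G2'.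
    assert (Eaa : Cconj a = a) by (rewrite Er; symmetry; exact Ea).
    transitivity (Cconj (G (Cconj a))); [|now rewrite Eaa].
    apply (punctured_unique G' (fun b => Cconj (G (Cconj b))) a); auto.
    + apply continuous_Cconj. apply (continuous_comp Cconj G); auto.
      apply (continuous_Cconj (fun w : C => w)), continuous_id.
    + unfold locally', within in *. apply locally_conj in G2.
      generalize (filter_and _ _ G2 G2'). apply filter_imp. intros b [B1 B2] Hb.
      rewrite (B2 Hb), B1.
      * now rewrite <- pcfU_contour_conj, Cconj_conj.
      * intros X. apply Hb. now rewrite <- (Cconj_conj b), X, Cconj_conj.
  - unfold pcfU. destruct excluded_middle_informative as [[n X]|_].
    { exfalso. apply Hp. exists n. replace (1 / 2 - a) with (Cconj (1 / 2 - Cconj a)) by (apply C_eq; simpl; field).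
      rewrite X. apply C_eq; simpl; ring. }
    destruct excluded_middle_informative as [X|_]; [contradiction|].
    now apply pcfU_contour_conj.
Qed.

(** * The two identities *)

Definition sigma : R := sqrt (2 * PI).

(** The factor in the argument of U; its square is 2 PI i. *)
Definition rot : C := sigma * Cexp (Ci * PI / 4).

Lemma sigma_sqr : (sigma * sigma = 2 * PI)%R.
Proof. unfold sigma. apply sqrt_sqrt. assert (P := PI_RGT_0). lra. Qed.

Lemma sigma_bounds : 2 <= sigma <= 3.
Proof.
  assert (E := sigma_sqr). assert (P := PI2_3_2). assert (P4 := PI_4).
  assert (0 <= sigma) by apply sqrt_pos. split; nra.
Qed.

Lemma rot_eq : rot = (sigma * q4, sigma * q4)%R.
Proof. unfold rot. rewrite Cexp_iPI4. apply C_eq; simpl; ring. Qed.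

Lemma rot_sqr : rot * rot = 2 * PI * Ci.
Proof.
  rewrite rot_eq. assert (E := sigma_sqr). assert (Q := q4_sqr).
  apply C_eq; simpl; [ring|].
  replace (sigma * q4 * (sigma * q4) + sigma * q4 * (sigma * q4))%R with (2 * (sigma * sigma) * (q4 * q4))%R by ring.
  rewrite E, Q. field.
Qed.

Lemma rot_Cexp : rot = Cexp (ln sigma + Ci * PI / 4).
Proof.
  unfold rot. assert (S := sigma_bounds). rewrite Cexp_plus, Cexp_real, exp_ln by lra. reflexivity.
Qed.

(** The arguments of [rot] and of [rot * u] differ by less than PI, so no winding occurs. *)
Lemma power_rotate (s u : C) : 0 < fst (rot * u)%C ->
  Cpower u (- s) = Cexp (s * (ln sigma + Ci * PI / 4)) * Cpower (rot * u) (- s).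
Proof.
  intros Hv. assert (P := PI_RGT_0).
  set (l := ln sigma + Ci * PI / 4) in *.
  assert (L : snd l = (PI / 4)%R) by (unfold l; simpl; field).
  assert (Lo : - PI < snd (- l)%C < PI) by (simpl in *; rewrite L; lra).
  assert (E : u = Cexp (- l) * (rot * u)).
  { rewrite rot_Cexp. fold l. rewrite Cexp_opp. field. apply Cexp_nz. }
  assert (EL : Clog u = - l + Clog (rot * u)).
  { rewrite E at 1. rewrite Clog_mult; [now rewrite Clog_Cexp|now apply Cexp_slit|now apply slit_pos|].
    replace (Carg (Cexp (- l))) with (snd (Clog (Cexp (- l)))) by reflexivity.
    rewrite Clog_Cexp by auto. assert (H := Carg_half _ Hv).
    replace (snd (- l)) with (- (PI / 4))%R by (rewrite <- L; reflexivity). lra. }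
  unfold Cpower. rewrite EL, <- Cexp_plus. f_equal. ring.
Qed.

Lemma dom2_of_bound (f : R -> R -> C) (K : R) (g h : R -> R) : cont2 f -> 0 <= K ->
  (forall t y, Cmod (f t y) <= K * (exp (g t) * exp (h y))) ->
  (exists M, forall t, exp (g t) <= M * wt t) -> (exists M, forall y, exp (h y) <= M * wt y) ->
  dom2 f.
Proof.
  intros Hc HK Hb [M1 H1] [M2 H2]. split; auto. exists (K * (M1 * M2))%R. intros t y.
  eapply Rle_trans; [apply Hb|].
  replace (K * (M1 * M2) * wt t * wt y)%R with (K * ((M1 * wt t) * (M2 * wt y)))%R by ring.
  apply Rmult_le_compat_l; auto.
  apply Rmult_le_compat; auto; left; apply exp_pos.
Qed.

(** The integrand of F with the power replaced by its integral over the parabola. *)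
Definition F_double (c : R) (k : R -> C) (t y : R) : C :=
  k y * (gker (- (rot * (vl (c / 4) y * vl (c / 4) y))) (c + t * dir_SW) / two_i_sin (c + t * dir_SW) * dir_SW).

Lemma rot_SW (c t : R) : rot * (c + t * dir_SW) = (sigma * q4 * c, sigma * (q4 * c - t))%R.
Proof.
  rewrite rot_eq, dir_SW_eq. apply C_eq; simpl; [ring|].
  replace (sigma * (q4 * c - t))%R with (sigma * (q4 * c - 2 * (q4 * q4) * t))%R by (rewrite q4_sqr; field). ring.
Qed.

Lemma F_double_split (c : R) (k : R -> C) (t y : R) :
  F_double c k t y = gker 0 (c + t * dir_SW) / two_i_sin (c + t * dir_SW) * dir_SW *
           (k y * Cexp (rot * (c + t * dir_SW) * (vl (c / 4) y * vl (c / 4) y))).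
Proof.
  unfold F_double, gker. set (u := c + t * dir_SW).
  replace (Ci * PI * u ^ 2 - u * - (rot * (vl (c / 4) y * vl (c / 4) y)))
    with (Ci * PI * u ^ 2 - u * 0 + rot * u * (vl (c / 4) y * vl (c / 4) y)) by ring.
  rewrite Cexp_plus. unfold Cdiv. ring.
Qed.

(** On the line the Gaussian decay in t absorbs the mixed term 2 rho sigma |t| |y|, because
    rho = c / 4 is small against the decay in y. *)
Lemma F_double_dom2 (c : R) (k : R -> C) : 0 < c < 1 -> grows k -> dom2 (F_double c k).
Proof.
  intros Hc Hk. set (rho := (c / 4)%R).
  assert (Hn := fun t => SW_nz01 c t Hc).
  destruct (two_i_sin_line_lower c dir_SW dir_SW_snd eq_refl Hn) as [c0 [C0 L0]].
  destruct Hk as [Hkc [K [K0 HK]]].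
  assert (Sb := sigma_bounds). assert (Q := q4_pos). assert (P := PI_RGT_0). assert (SS := sigma_sqr).
  set (b := (sigma * q4 * c)%R). assert (Hb : c <= b).
  { assert (1 <= sigma * q4) by nra. unfold b. nra. }
  apply (dom2_of_bound (F_double c k) (/ c0 * K)
    (fun t => - (PI / 2) * (t * t) + 2 * PI * c * Rabs t + 0)%R
    (fun y => - (b / 2) * (y * y) + (1 + 2 * rho * b) * Rabs y + b * (rho * rho))%R).
  - intros t y. eapply continuous_Cext; [intros p; symmetry; apply F_double_split|].
    assert (Ct : forall p : R * R, continuous (fun p : R * R => c + fst p * dir_SW) p).
    { intros p. solve_cont. }
    apply continuous_Cmult; [|apply continuous_Cmult].
    + apply continuous_Cmult; [|apply continuous_Cconst].
      apply (continuous_comp (fun p : R * R => c + fst p * dir_SW) (fun u => gker 0 u / two_i_sin u)); auto.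
      apply hol_continuous, hol_div; [apply gker_hol|apply two_i_sin_hol|apply Hn].
    + apply (continuous_comp snd k); [apply continuous_snd|apply Hkc].
    + solve_cont.
  - apply Rmult_le_pos; auto. left; now apply Rinv_0_lt_compat.
  - intros t y. rewrite F_double_split, !Cmod_mult, dir_SW_mod, Rmult_1_r, Cmod_div by auto.
    rewrite vl_exp_bound, rot_SW. cbn [fst snd]. fold b rho.
    assert (G := gker_bound 0 c c t ltac:(rewrite Rabs_pos_eq; lra)). rewrite Cmod_0, Rmult_0_r, !Rplus_0_r in G.
    assert (I : / Cmod (two_i_sin (c + t * dir_SW)) <= / c0) by (apply Rinv_le_contravar; auto).
    apply Rle_trans with (exp (- PI * (t * t) + 2 * PI * c * Rabs t) * / c0 *
      (K * exp (Rabs y) * exp (- b * (y * y) - 2 * rho * (sigma * (q4 * c - t)) * y + b * (rho * rho))))%R.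
    + apply Rmult_le_compat.
      * apply Rmult_le_pos; [apply Cmod_ge_0|]. left. apply Rinv_0_lt_compat. specialize (L0 t). lra.
      * apply Rmult_le_pos; [apply Cmod_ge_0|]. left; apply exp_pos.
      * apply Rmult_le_compat; auto; [apply Cmod_ge_0|]. left. apply Rinv_0_lt_compat. specialize (L0 t). lra.
      * apply Rmult_le_compat_r; auto. left; apply exp_pos.
    + match goal with |- (?A * / c0 * (K * ?B * ?D) <= / c0 * K * (?E * ?F)) =>
        replace (A * / c0 * (K * B * D))%R with (/ c0 * K * (A * B * D))%R by ring end.
      apply Rmult_le_compat_l; [apply Rmult_le_pos; auto; left; now apply Rinv_0_lt_compat|].
      rewrite <- !exp_plus. apply exp_mono.
      assert (Ht : (t * t = Rabs t * Rabs t)%R) by exact (Rsqr_abs _).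
      assert (Hy : (y * y = Rabs y * Rabs y)%R) by exact (Rsqr_abs _).
      assert (X : - 2 * rho * (sigma * (q4 * c - t)) * y <= 2 * rho * b * Rabs y + 2 * rho * sigma * (Rabs t * Rabs y)).
      { replace (- 2 * rho * (sigma * (q4 * c - t)) * y)%R with (2 * rho * b * - y + 2 * rho * sigma * (t * y))%R by (unfold b; ring).
        apply Rplus_le_compat; (apply Rmult_le_compat_l; [unfold rho; repeat apply Rmult_le_pos; lra|]).
        - rewrite <- Rabs_Ropp. apply Rle_abs.
        - rewrite <- Rabs_mult. apply Rle_abs. }
      assert (Y : 2 * rho * sigma * (Rabs t * Rabs y) <= PI / 2 * (Rabs t * Rabs t) + b / 2 * (Rabs y * Rabs y)).
      { assert (Z := Rle_0_sqr (sigma / 2 * Rabs t - 2 * rho * Rabs y)). unfold Rsqr in Z.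
        assert (Z2 : 4 * rho * rho <= b / 2) by (unfold rho; nra).
        assert (Z3 : 4 * rho * rho * (Rabs y * Rabs y) <= b / 2 * (Rabs y * Rabs y)).
        { apply Rmult_le_compat_r; auto. apply Rle_0_sqr. }
        replace (PI / 2)%R with (sigma * sigma / 4)%R by (rewrite SS; field). nra. }
      rewrite Ht, Hy. lra.
  - apply gauss_dom. lra.
  - apply gauss_dom. lra.
Qed.

Lemma rot_SE (d t : R) : rot * (d + t * dir_SE) = (sigma * (q4 * d + t), sigma * q4 * d)%R.
Proof.
  rewrite rot_eq, dir_SE_eq. apply C_eq; simpl; [|ring].
  replace (sigma * (q4 * d + t))%R with (sigma * (q4 * d + 2 * (q4 * q4) * t))%R by (rewrite q4_sqr; field). ring.
Qed.

Definition psi_front (d t : R) : C :=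
  Cexp (- (Ci * PI * (d + t * dir_SE) ^ 2) + Ci * PI * (d + t * dir_SE))
    / (2 * Ci * Ccos (PI * (d + t * dir_SE))) * dir_SE.

(** The integrand that contains U, with U replaced by its integral over the parabola. *)
Definition U_double (c d : R) (k : R -> C) (t y : R) : C :=
  k y * Cexp (- ((vl (c / 4) y * vl (c / 4) y) ^ 2 / 2)) * psi_int d (- (rot * (vl (c / 4) y * vl (c / 4) y))) t.

Lemma U_double_split (c d : R) (k : R -> C) (t y : R) :
  U_double c d k t y = psi_front d t * (k y * qexp (rot * (d + t * dir_SE)) (vl (c / 4) y * vl (c / 4) y)).
Proof.
  unfold U_double, psi_int, psi_front, qexp. set (u := d + t * dir_SE). set (w := vl (c / 4) y * vl (c / 4) y).
  replace (- (Ci * PI * u ^ 2) + Ci * PI * u - u * - (rot * w))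
    with (- (Ci * PI * u ^ 2) + Ci * PI * u + rot * u * w) by ring.
  rewrite !Cexp_plus. unfold Cdiv. ring.
Qed.

(** Completing the square: the Gaussian on the line and the quartic exponential on the parabola
    combine into the exponential of half a negative square. *)
Lemma U_double_square (c d : R) (k : R -> C) (t y : R) :
  U_double c d k t y = Cexp (Ci * PI * (d + t * dir_SE)) / two_i_sin (d + t * dir_SE + 1 / 2) * dir_SE *
    (k y * Cexp (- ((rot * (d + t * dir_SE) - vl (c / 4) y * vl (c / 4) y) ^ 2 / 2))).
Proof.
  rewrite U_double_split. unfold psi_front, qexp. rewrite Ccos_two_i_sin.
  set (u := d + t * dir_SE). set (w := vl (c / 4) y * vl (c / 4) y).
  replace ((rot * u - w) ^ 2) with (rot * rot * (u * u) - 2 * rot * u * w + w * w) by ring. rewrite rot_sqr.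
  replace (- ((2 * PI * Ci * (u * u) - 2 * rot * u * w + w * w) / 2))
    with (- (w ^ 2 / 2) + rot * u * w + - (Ci * PI * u ^ 2)) by field.
  rewrite !Cexp_plus. unfold Cdiv. ring.
Qed.

Lemma SE_nz (d t : R) : - (1 / 2) < d < 1 / 2 -> two_i_sin (d + t * dir_SE + 1 / 2) <> 0.
Proof.
  intros Hd. apply two_i_sin_nz01. rewrite dir_SE_eq. assert (Q := q4_pos).
  destruct (Req_dec t 0) as [->|H]; [left; simpl; lra|right; simpl].
  replace (0 + (t * - q4 + 0 * q4) + _)%R with (- (t * q4))%R by (unfold Rdiv; ring).
  apply Ropp_neq_0_compat, Rmult_integral_contrapositive_currified; lra.
Qed.

Lemma SE_lower (d : R) : - (1 / 2) < d < 1 / 2 ->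
  exists c, 0 < c /\ forall t : R, c * exp (PI * (q4 * Rabs t)) <= Cmod (two_i_sin (d + t * dir_SE + 1 / 2)).
Proof.
  intros Hd. assert (Q := q4_pos).
  assert (E : forall t : R, d + t * dir_SE + 1 / 2 = (d + 1 / 2)%R + t * dir_SE).
  { intros t. apply C_eq; simpl; field. }
  destruct (two_i_sin_line_lower (d + 1 / 2)%R dir_SE) as [c0 [C0 L0]].
  - rewrite dir_SE_eq. simpl. rewrite Rabs_Ropp, Rabs_pos_eq; lra.
  - reflexivity.
  - intros t. rewrite <- E. now apply SE_nz.
  - exists (Rmin (1 / 2) (c0 / 2)). split; [apply Rmin_glb_lt; lra|]. intros t. rewrite E.
    assert (L1 := two_i_sin_lower ((d + 1 / 2)%R + t * dir_SE)). specialize (L0 t).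
    replace (Rabs (snd ((d + 1 / 2)%R + t * dir_SE))) with (q4 * Rabs t)%R in L1.
    2: { rewrite dir_SE_eq. simpl. replace (0 + (t * - q4 + 0 * q4))%R with (- (q4 * t))%R by ring.
         rewrite Rabs_Ropp, Rabs_mult, (Rabs_pos_eq q4); lra. }
    assert (M1 := Rmin_l (1 / 2) (c0 / 2)). assert (M2 := Rmin_r (1 / 2) (c0 / 2)).
    assert (X := exp_pos (PI * (q4 * Rabs t))). set (e := exp (PI * (q4 * Rabs t))) in *.
    destruct (Rle_dec 2 e).
    + apply Rle_trans with (1 / 2 * e)%R; [apply Rmult_le_compat_r|]; lra.
    + apply Rle_trans with (c0 / 2 * e)%R; [apply Rmult_le_compat_r; lra|]. nra.
Qed.

Lemma psi_front_cont (d : R) : - (1 / 2) < d < 1 / 2 -> cont (psi_front d).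
Proof.
  intros Hd. unfold psi_front.
  apply (cont_line (fun u => Cexp (- (Ci * PI * u ^ 2) + Ci * PI * u) / (2 * Ci * Ccos (PI * u)))).
  intros t. apply hol_continuous.
  apply hol_ext_loc with (fun u => Cexp (- (Ci * PI * u ^ 2) + Ci * PI * u) / two_i_sin (u + 1 / 2)).
  - apply filter_forall. intros u. now rewrite Ccos_two_i_sin.
  - apply hol_div; [auto 9 with hol| |now apply SE_nz].
    apply (hol_comp two_i_sin (fun u => u + 1 / 2)); [auto with hol|apply two_i_sin_hol].
Qed.

(** The square in the exponent gives any linear decay in sigma t + y^2, in particular decay in both
    variables for t > 0; for t < 0 the decay of e^(i PI u) / cos (PI u), which is e^(- 2 PI q4 |t|),
    wins against sigma because 2 PI q4 > sqrt (2 PI). *)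
Lemma U_double_dom2 (c d : R) (k : R -> C) : 0 < c < 1 -> - (1 / 2) < d < 1 / 2 -> grows k -> dom2 (U_double c d k).
Proof.
  intros Hc Hd [Hkc [K [K0 HK]]]. set (rho := (c / 4)%R).
  destruct (SE_lower d Hd) as [c1 [C1 L1]].
  assert (Sb := sigma_bounds). assert (Q := q4_pos). assert (QQ := q4_sqr).
  assert (P := PI_RGT_0). assert (P3 := PI2_3_2). assert (SS := sigma_sqr).
  set (e := Rmin sigma (2 * PI * q4 - sigma)).
  assert (e1 := Rmin_l sigma (2 * PI * q4 - sigma)). assert (e2 := Rmin_r sigma (2 * PI * q4 - sigma)).
  fold e in e1, e2.
  assert (He : 0 < e).
  { apply Rmin_glb_lt; [lra|].
    assert (sigma < 2 * PI * q4); [|lra].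
    apply Rsqr_incrst_0; [unfold Rsqr|lra|apply Rmult_le_pos; lra].
    replace (2 * PI * q4 * (2 * PI * q4))%R with (4 * (PI * PI) * (q4 * q4))%R by ring. rewrite SS, QQ. nra. }
  set (A := (2 * rho * sigma * q4 * Rabs d + 1)%R).
  set (B := (1 / 2 - sigma * q4 * d + rho * rho + (sigma * q4 * d) * (sigma * q4 * d) / 2)%R).
  apply (dom2_of_bound (U_double c d k) (/ c1 * K)
    (fun t => - e * Rabs t + 0)%R (fun y => - (1 / 2) * (y * y) + A * Rabs y + B)%R).
  - intros t y. eapply continuous_Cext; [intros p; symmetry; apply U_double_split|].
    apply continuous_Cmult; [|apply continuous_Cmult].
    + apply (continuous_comp fst (psi_front d)); [apply continuous_fst|now apply psi_front_cont].
    + apply (continuous_comp snd k); [apply continuous_snd|apply Hkc].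
    + unfold qexp. simpl. unfold Cdiv. solve_cont.
  - apply Rmult_le_pos; auto. left; now apply Rinv_0_lt_compat.
  - intros t y. rewrite U_double_square, !Cmod_mult, dir_SE_mod, Rmult_1_r, Cmod_div by now apply SE_nz.
    specialize (L1 t). rewrite rot_SE, !Cexp_mod.
    set (X := exp (PI * (q4 * Rabs t))) in *. assert (HX : 0 < X) by apply exp_pos.
    assert (I : / Cmod (two_i_sin (d + t * dir_SE + 1 / 2)) <= / c1 * exp (- (PI * (q4 * Rabs t)))).
    { rewrite exp_Ropp. fold X. rewrite <- Rinv_mult. apply Rinv_le_contravar; auto. now apply Rmult_lt_0_compat. }
    set (T := fst (Ci * PI * (d + t * dir_SE))).
    assert (ET : T = (PI * q4 * t)%R) by (unfold T; rewrite dir_SE_eq; simpl; ring).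
    match goal with |- (exp T / _ * (_ * exp ?U) <= _) => set (Y := U) end.
    assert (EY : Y = (- ((sigma * (q4 * d + t) - (rho * rho - y * y)) * (sigma * (q4 * d + t) - (rho * rho - y * y))) / 2
      + (sigma * q4 * d - 2 * rho * y) * (sigma * q4 * d - 2 * rho * y) / 2)%R).
    { unfold Y, vl. fold rho. simpl. field. }
    apply Rle_trans with (exp T * (/ c1 * exp (- (PI * (q4 * Rabs t)))) * (K * exp (Rabs y) * exp Y))%R.
    + apply Rmult_le_compat.
      * apply Rmult_le_pos; [left; apply exp_pos|]. left. apply Rinv_0_lt_compat.
        eapply Rlt_le_trans; [|exact L1]. now apply Rmult_lt_0_compat.
      * apply Rmult_le_pos; [apply Cmod_ge_0|]. left; apply exp_pos.
      * apply Rmult_le_compat_l; auto. left; apply exp_pos.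
      * apply Rmult_le_compat_r; auto. left; apply exp_pos.
    + match goal with |- (?A1 * (/ c1 * ?A2) * (K * ?A3 * ?A4) <= _) =>
        replace (A1 * (/ c1 * A2) * (K * A3 * A4))%R with (/ c1 * K * (A1 * A2 * A3 * A4))%R by ring end.
      apply Rmult_le_compat_l; [apply Rmult_le_pos; auto; left; now apply Rinv_0_lt_compat|].
      rewrite <- !exp_plus. apply exp_mono. rewrite ET, EY.
      set (V := (sigma * (q4 * d + t) - (rho * rho - y * y))%R).
      assert (HV : - (V * V) / 2 <= 1 / 2 - V) by (assert (Z := Rle_0_sqr (V - 1)); unfold Rsqr in Z; lra).
      assert (Ht : PI * q4 * t - PI * (q4 * Rabs t) - sigma * t <= - e * Rabs t).
      { unfold Rabs. destruct Rcase_abs; nra. }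
      assert (Hy : 2 * rho * rho * (y * y) <= 1 / 2 * (y * y)).
      { apply Rmult_le_compat_r; [apply Rle_0_sqr|]. unfold rho. nra. }
      assert (Hdy : - (2 * rho * sigma * q4 * (d * y)) <= 2 * rho * sigma * q4 * (Rabs d * Rabs y)).
      { rewrite Ropp_mult_distr_r. apply Rmult_le_compat_l.
        - unfold rho. repeat apply Rmult_le_pos; lra.
        - rewrite <- Rabs_mult, <- Rabs_Ropp. apply Rle_abs. }
      unfold A, B.
      replace ((sigma * q4 * d - 2 * rho * y) * (sigma * q4 * d - 2 * rho * y) / 2)%R
        with ((sigma * q4 * d) * (sigma * q4 * d) / 2 + 2 * rho * rho * (y * y) + - (2 * rho * sigma * q4 * (d * y)))%R by field.
      unfold V in HV at 3. lra.
  - now apply exp_dom.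
  - apply gauss_dom. lra.
Qed.

(** The points excluded in [mordell] are not met on the parabola: the modulus is 1 only if
    rho^2 - y^2 = 2 rho y, and then the argument is too small for a multiple of 2 PI other than 0. *)
Lemma kernel_exp_neq_1 (rho y : R) : 0 < rho <= 1 / 4 -> Cexp (- - (rot * (vl rho y * vl rho y))) <> 1.
Proof.
  intros Hr E. replace (- - (rot * (vl rho y * vl rho y))) with (rot * (vl rho y * vl rho y)) in E by ring.
  assert (Sb := sigma_bounds). assert (Q := q4_pos). assert (P3 := PI2_3_2).
  assert (Ew : rot * (vl rho y * vl rho y) = (sigma * q4 * (rho * rho - y * y - 2 * rho * y), sigma * q4 * (rho * rho - y * y + 2 * rho * y))%R).
  { rewrite rot_eq. apply C_eq; simpl; ring. }
  set (b := (sigma * q4)%R) in *. assert (Hb : 0 < b < 3) by (unfold b; nra).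
  set (z := rot * (vl rho y * vl rho y)) in *.
  assert (M : fst z = 0%R).
  { assert (M := Cexp_mod z). rewrite E, Cmod_1 in M. rewrite <- exp_0 in M. now apply exp_inv in M. }
  rewrite Ew in M. simpl in M. apply Rmult_integral in M. destruct M as [M|M]; [lra|].
  assert (S : snd z = (b * (4 * (rho * y)))%R) by (rewrite Ew; simpl; f_equal; lra).
  assert (By : Rabs y <= 3 * rho) by (apply Rabs_le; nra).
  assert (Bs : Rabs (snd z) < 3).
  { rewrite S, !Rabs_mult, (Rabs_pos_eq b), (Rabs_pos_eq 4), (Rabs_pos_eq rho) by lra.
    assert (rho * Rabs y <= 1 / 4 * (3 / 4)) by (apply Rmult_le_compat; try lra; apply Rabs_pos).
    assert (0 <= rho * Rabs y) by (apply Rmult_le_pos; [lra|apply Rabs_pos]). nra. }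
  apply Rabs_def2 in Bs.
  assert (L := Clog_Cexp z ltac:(lra)). rewrite E, Clog_real, ln_1 in L by lra.
  rewrite <- L in S. simpl in S. assert (y = 0)%R.
  { apply (Rmult_eq_reg_l (b * (4 * rho))); [lra|]. apply Rgt_not_eq. repeat apply Rmult_lt_0_compat; lra. }
  subst y. nra.
Qed.

Lemma F_integrand_line (c : R) (s : C) (k : R -> C) : 0 < c < 1 -> grows k ->
  (forall v, 0 < fst v -> Cpower v (- s) = Int (fun y => k y * Cexp (v * (vl (c / 4) y * vl (c / 4) y)))) ->
  forall t, line_integrand c dir_SW (F_integrand s) t =
    Cexp (s * (ln sigma + Ci * PI / 4)) * Int (F_double c k t).
Proof.
  intros Hc Hk Hp t.
  assert (Hv : 0 < fst (rot * (c + t * dir_SW))%C).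
  { rewrite rot_SW. simpl. assert (Sb := sigma_bounds). assert (Q := q4_pos). repeat apply Rmult_lt_0_compat; lra. }
  transitivity (Cexp (s * (ln sigma + Ci * PI / 4)) *
    (gker 0 (c + t * dir_SW) / two_i_sin (c + t * dir_SW) * dir_SW * Cpower (rot * (c + t * dir_SW)) (- s))).
  - unfold line_integrand, F_integrand. rewrite power_rotate by auto. unfold gker, two_i_sin.
    replace (Ci * PI * (c + t * dir_SW) ^ 2 - (c + t * dir_SW) * 0) with (Ci * PI * (c + t * dir_SW) ^ 2) by ring.
    unfold Cdiv. ring.
  - rewrite Hp by auto. rewrite <- (Int_Cmul _ _ (par_dom (c / 4) k _ Hk Hv)).
    f_equal. apply Int_ext. intros y. symmetry. apply F_double_split.
Qed.

Lemma U_integrand1_line (r c d : R) (s : C) (k : R -> C) : 0 < c < 1 -> grows k ->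
  (forall z, pcfU r (s - 1 / 2) z = Cexp (- (z ^ 2 / 4)) * Int (fun y => k y * qexp z (vl (c / 4) y * vl (c / 4) y))) ->
  forall t, line_integrand d dir_SE (U_integrand1 r s) t = Int (U_double c d k t).
Proof.
  intros Hc Hk Hp t. unfold line_integrand, U_integrand1.
  replace (sqrt (2 * PI) * Cexp (Ci * PI / 4) * (d + t * dir_SE)) with (rot * (d + t * dir_SE)) by reflexivity.
  rewrite Hp. set (u := d + t * dir_SE).
  transitivity (psi_front d t * Int (fun y => k y * qexp (rot * u) (vl (c / 4) y * vl (c / 4) y))).
  - unfold psi_front. fold u.
    replace ((rot * u) ^ 2) with (rot * rot * u ^ 2) by ring. rewrite rot_sqr.
    replace (- (Ci * PI * u ^ 2) + Ci * PI * u)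
      with (- (Ci * PI * u ^ 2 / 2) + Ci * PI * u + - (2 * PI * Ci * u ^ 2 / 4)) by field.
    rewrite (Cexp_plus (- (Ci * PI * u ^ 2 / 2) + Ci * PI * u)). unfold Cdiv. ring.
  - rewrite <- (Int_Cmul _ _ (proj2 (absorbs_quartic (c / 4) (rot * u) ltac:(lra)) _ Hk)).
    apply Int_ext. intros y. symmetry. apply U_double_split.
Qed.

(** Both integrals are exchanged, and Mordell's relation is applied at each point of the parabola. *)
Lemma line_integrals (r c d : R) (s : C) : 0 < r -> 0 < c < 1 -> - (1 / 2) < d < 1 / 2 ->
  dom (line_integrand c dir_SW (F_integrand s)) /\
  dom (line_integrand d dir_SE (U_integrand1 r s)) /\
  line_int c dir_SW (F_integrand s) =
    Cexp (s * (ln sigma + Ci * PI / 4)) * Cexp (- (Ci * PI / 4)) * line_int d dir_SE (U_integrand1 r s).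
Proof.
  intros Hr Hc Hd.
  destruct (common_kernel r (c / 4) s Hr ltac:(lra)) as [k [Hk [K1 K2]]].
  assert (E1 := F_integrand_line c s k Hc Hk K1).
  assert (E2 := U_integrand1_line r c d s k Hc Hk K2).
  assert (D1 := F_double_dom2 c k Hc Hk). assert (D2 := U_double_dom2 c d k Hc Hd Hk).
  assert (D1' := dom2_Int _ D1). assert (D2' := dom2_Int _ D2).
  split; [|split].
  - apply (dom_ext _ _ (fun t => eq_sym (E1 t))). now apply dom_Cmul.
  - exact (dom_ext _ _ (fun t => eq_sym (E2 t)) D2').
  - change (Int (line_integrand c dir_SW (F_integrand s)) =
      Cexp (s * (ln sigma + Ci * PI / 4)) * Cexp (- (Ci * PI / 4)) * Int (line_integrand d dir_SE (U_integrand1 r s))).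
    rewrite (Int_ext _ _ E1), (Int_ext _ _ E2), (Int_Cmul _ _ D1').
    rewrite (Int_fubini _ D1), (Int_fubini _ D2), <- Cmult_assoc. f_equal.
    rewrite <- (Int_Cmul _ _ (dom2_Int _ (dom2_swap _ D2))).
    apply Int_ext. intros y. unfold F_double, U_double. set (w := vl (c / 4) y * vl (c / 4) y).
    rewrite (Int_Cmul (k y) _ (gker_two_i_sin_dom (- (rot * w)) c (fun t => SW_nz01 c t Hc))).
    rewrite (Int_Cmul (k y * Cexp (- (w ^ 2 / 2))) _ (psi_dom d (- (rot * w)) Hd)).
    change (Int (fun t : R => gker (- (rot * w)) (c + t * dir_SW) / two_i_sin (c + t * dir_SW) * dir_SW)) with (phi c (- (rot * w))).
    rewrite (mordell c d) by (auto; apply kernel_exp_neq_1; lra).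
    replace (Ci * (- (rot * w)) ^ 2 / (4 * PI)) with (- (w ^ 2 / 2)).
    + ring.
    + replace ((- (rot * w)) ^ 2) with (rot * rot * w ^ 2) by ring. rewrite rot_sqr.
      replace (Ci * (2 * PI * Ci * w ^ 2) / (4 * PI)) with (Ci * Ci * w ^ 2 / 2) by (field; apply PIC_nz).
      replace (Ci * Ci) with (- RtoC 1) by (apply C_eq; simpl; ring). field.
Qed.

Lemma ln_sigma : (ln sigma = (ln 2 + ln PI) / 2)%R.
Proof.
  assert (S := sigma_bounds). assert (P := PI_RGT_0).
  rewrite <- ln_mult, <- sigma_sqr, ln_mult by lra. field.
Qed.

Lemma calF_rhs1 (r c d : R) (s : C) : 0 < r -> 0 < c < 1 -> - (1 / 2) < d < 1 / 2 ->
  calF c s = rhs1 r d s.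
Proof.
  intros Hr Hc Hd. destruct (line_integrals r c d s Hr Hc Hd) as [_ [_ E]].
  unfold calF, rhs1. rewrite E. assert (P := PI_RGT_0).
  transitivity (Cpower PI (- (s / 2)) * Cexp (s * (ln sigma + Ci * PI / 4)) * Cexp (- (Ci * PI / 4))
    * Gamma (s / 2) * line_int d dir_SE (U_integrand1 r s)); [ring|].
  transitivity (Cpower 2 (s / 2) * Cexp (- (Ci * PI * (1 - s) / 4))
    * Gamma (s / 2) * line_int d dir_SE (U_integrand1 r s)); [|ring].
  do 2 f_equal. unfold Cpower. rewrite !Clog_real by lra. rewrite <- !Cexp_plus. f_equal.
  rewrite ln_sigma. replace (RtoC ((ln 2 + ln PI) / 2)) with ((ln 2 + ln PI) / 2) by (apply C_eq; simpl; field).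
  field.
Qed.

(** By [pcfU_conj]; the reflection of t appears because conjugation reverses the direction of the
    line. *)
Lemma U_integrand2_line (r d : R) (s : C) (t : R) : 0 < r -> - (1 / 2) < d < 1 / 2 ->
  line_integrand d dir_SW (U_integrand2 r s) t =
  Cconj (line_integrand d dir_SE (U_integrand1 r (1 - Cconj s)) (- t)).
Proof.
  intros Hr Hd. unfold line_integrand, U_integrand1, U_integrand2.
  assert (Hn := SE_nz d (- t) Hd).
  set (v := d + (- t)%R * dir_SE) in *.
  assert (Eu : d + t * dir_SW = Cconj v).
  { unfold v. rewrite dir_SE_eq, dir_SW_eq. apply C_eq; simpl; ring. }
  rewrite Eu, !Ccos_two_i_sin. rewrite !Cmult_conj, Cdiv_conj by auto.
  rewrite dir_SE_conj, two_i_sin_conj, <- pcfU_conj, <- Cexp_conj by auto.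
  assert (Hn' : two_i_sin (Cconj v + 1 / 2) <> 0).
  { intros X. apply Hn. rewrite <- (Cconj_conj (two_i_sin _)), two_i_sin_conj.
    replace (Cconj (v + 1 / 2)) with (Cconj v + 1 / 2) by (apply C_eq; simpl; field).
    rewrite X. apply C_eq; simpl; ring. }
  replace (Cconj (v + 1 / 2)) with (Cconj v + 1 / 2) by (apply C_eq; simpl; field).
  replace (Cconj (1 - Cconj s - 1 / 2)) with (1 / 2 - s) by (apply C_eq; simpl; field).
  replace (Cconj (sqrt (2 * PI)%R * Cexp (Ci * PI / 4) * v)) with (sqrt (2 * PI)%R * Cexp (- (Ci * PI / 4)) * Cconj v).
  2: { rewrite !Cmult_conj, <- Cexp_conj.
       replace (Cconj (Ci * PI / 4)) with (- (Ci * PI / 4)) by (apply C_eq; simpl; field).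
       replace (Cconj (sqrt (2 * PI)%R)) with (RtoC (sqrt (2 * PI)%R)) by (apply C_eq; simpl; ring). ring. }
  replace (Cconj (- (Ci * PI * v ^ 2 / 2) + Ci * PI * v)) with (Ci * PI * Cconj v ^ 2 / 2 - Ci * PI * Cconj v)
    by (apply C_eq; simpl; field).
  field. auto.
Qed.

Lemma rhs2_rhs1 (r d : R) (s : C) : 0 < r -> - (1 / 2) < d < 1 / 2 ->
  dom (line_integrand d dir_SW (U_integrand2 r s)) /\ rhs2 r d s = Cconj (rhs1 r d (1 - Cconj s)).
Proof.
  intros Hr Hd.
  destruct (line_integrals r (1 / 2) d (1 - Cconj s) Hr ltac:(lra) Hd) as [_ [D _]].
  assert (E := fun t => U_integrand2_line r d s t Hr Hd).
  split.
  - apply (dom_ext _ _ (fun t => eq_sym (E t))). now apply dom_conj, dom_reflect.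
  - unfold rhs1, rhs2.
    change (line_int d dir_SW (U_integrand2 r s)) with (Int (line_integrand d dir_SW (U_integrand2 r s))).
    change (line_int d dir_SE (U_integrand1 r (1 - Cconj s))) with (Int (line_integrand d dir_SE (U_integrand1 r (1 - Cconj s)))).
    rewrite (Int_ext _ _ E), (Int_conj _ (dom_reflect _ D)), (Int_reflect _ D).
    rewrite !Cmult_conj, <- Cpower_conj, <- Gamma_conj_total, <- Cexp_conj.
    replace (Cconj 2) with (RtoC 2) by (apply C_eq; simpl; ring).
    replace (Cconj ((1 - Cconj s) / 2)) with ((1 - s) / 2) by (apply C_eq; simpl; field).
    replace (Cconj (- (Ci * PI * (1 - (1 - Cconj s)) / 4))) with (Ci * PI * s / 4) by (apply C_eq; simpl; field).
    reflexivity.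
Qed.

(** The integral depends on s through u^(-s) = e^(- s Clog u), and log |u| is bounded on both sides
    by |t| and constants. *)
Lemma F_line_hol (c : R) (s : C) : 0 < c < 1 -> hol (fun s => line_int c dir_SW (F_integrand s)) s.
Proof.
  intros Hc. assert (Hn := fun t => SW_nz01 c t Hc). assert (P := PI_RGT_0).
  assert (Sl : forall t : R, slit (c + t * dir_SW)).
  { intros t. destruct (SW_off c t) as [E|E]; [apply slit_pos; rewrite <- E; lra|now apply slit_im]. }
  set (k := fun t : R => gker 0 (c + t * dir_SW) / two_i_sin (c + t * dir_SW) * dir_SW).
  set (L := fun t : R => - Clog (c + t * dir_SW)).
  assert (EI : (fun s => line_int c dir_SW (F_integrand s)) = eint k L).
  { apply functional_extensionality. intros z. apply Int_ext. intros t.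
    unfold line_integrand, F_integrand, k, L, gker, two_i_sin, Cpower.
    replace (Ci * PI * (c + t * dir_SW) ^ 2 - (c + t * dir_SW) * 0) with (Ci * PI * (c + t * dir_SW) ^ 2) by ring.
    replace (z * - Clog (c + t * dir_SW)) with (- z * Clog (c + t * dir_SW)) by ring.
    unfold Cdiv. ring. }
  rewrite EI. apply (eint_hol k L s 1).
  destruct (gker_two_i_sin_dom 0 c Hn) as [Kc _]. fold k in Kc.
  split; [exact Kc|]. split.
  { intros t. apply continuous_Copp. apply (continuous_comp (fun t : R => c + t * dir_SW) Clog).
    - solve_cont.
    - now apply continuous_Clog. }
  split; [lra|].
  destruct (two_i_sin_line_lower c dir_SW dir_SW_snd eq_refl Hn) as [c0 [C0 L0]].
  set (A := (1 + Cmod s)%R). assert (HA : 0 < A) by (assert (X := Cmod_ge_0 s); unfold A; lra).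
  set (l0 := (Rabs (ln (c * q4)) + PI)%R).
  destruct (gauss_dom PI (2 * PI * c + A) (A * (c + l0)) P) as [M HM].
  exists (/ c0 * M)%R. intros t. rewrite Rmult_assoc.
  assert (Q := q4_pos). assert (QQ := q4_sqr).
  set (u := c + t * dir_SW).
  assert (Bu : Cmod u <= c + Rabs t).
  { unfold u. eapply Rle_trans; [apply Cmod_triangle|].
    rewrite Cmod_mult, dir_SW_mod, !Cmod_R, (Rabs_pos_eq c); lra. }
  assert (Bl : c * q4 <= Cmod u).
  { apply Rsqr_incr_0_var; [|apply Cmod_ge_0]. unfold Rsqr. rewrite Cmod_sqr. unfold u. rewrite dir_SW_eq. simpl.
    assert (Z := Rle_0_sqr (t - c * q4)). unfold Rsqr in Z. nra. }
  assert (BL : Cmod (L t) <= c + Rabs t + l0).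
  { unfold L. fold u. rewrite Cmod_opp. eapply Rle_trans; [apply Cmod_le_sum|]. simpl.
    assert (G := Carg_bound u). assert (G' : Rabs (Carg u) <= PI) by (apply Rabs_le; lra).
    assert (cq : 0 < c * q4) by nra.
    assert (B1 := ln_le_lin 1 (Cmod u) Rlt_0_1 ltac:(lra)). rewrite ln_1 in B1.
    assert (B2 : ln (c * q4) <= ln (Cmod u)).
    { destruct Bl as [Bl|Bl]; [left; now apply ln_increasing|right; now rewrite Bl]. }
    assert (R1 := Rle_abs (- ln (c * q4))). rewrite Rabs_Ropp in R1. assert (R2 := Rabs_pos (ln (c * q4))).
    assert (R3 := Rabs_pos t).
    assert (Rabs (ln (Cmod u)) <= c + Rabs t + Rabs (ln (c * q4))) by (apply Rabs_le; lra).
    unfold l0. lra. }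
  apply Rle_trans with (/ c0 * exp (- PI * (t * t) + (2 * PI * c + A) * Rabs t + A * (c + l0)))%R.
  2: { rewrite (Rmult_assoc (/ c0) M). apply Rmult_le_compat_l; [left; now apply Rinv_0_lt_compat|apply HM]. }
  unfold k. fold u. rewrite Cmod_mult, dir_SW_mod, Rmult_1_r, Cmod_div by apply Hn.
  assert (G := gker_bound 0 c c t ltac:(rewrite Rabs_pos_eq; lra)). rewrite Cmod_0, Rmult_0_r, !Rplus_0_r in G.
  fold u in G.
  assert (I : / Cmod (two_i_sin u) <= / c0) by (apply Rinv_le_contravar; auto; apply L0).
  assert (Ip : 0 <= / Cmod (two_i_sin u)) by (left; apply Rinv_0_lt_compat; specialize (L0 t); fold u in L0; lra).
  assert (X : exp (1 * Cmod (L t)) * Cmod (Cexp (s * L t)) <= exp (A * (c + Rabs t + l0))).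
  { apply Rle_trans with (exp (1 * Cmod (L t)) * exp (Cmod (s * L t)))%R.
    - apply Rmult_le_compat_l; [left; apply exp_pos|apply Cexp_mod_le].
    - rewrite <- exp_plus, Cmod_mult. apply exp_mono.
      replace (1 * Cmod (L t) + Cmod s * Cmod (L t))%R with (A * Cmod (L t))%R by (unfold A; ring).
      apply Rmult_le_compat_l; lra. }
  apply Rle_trans with ((exp (- PI * (t * t) + 2 * PI * c * Rabs t) * / c0) * exp (A * (c + Rabs t + l0)))%R.
  - apply Rmult_le_compat; auto.
    + apply Rmult_le_pos; auto. apply Cmod_ge_0.
    + apply Rmult_le_pos; [left; apply exp_pos|apply Cmod_ge_0].
    + apply Rmult_le_compat; auto. apply Cmod_ge_0.
  - right. rewrite (Rmult_comm (exp _) (/ c0)), Rmult_assoc, <- exp_plus. do 2 f_equal. ring.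
Qed.

Lemma calF_mero (c : R) (z : C) : 0 < c < 1 -> mero (calF c) z.
Proof.
  intros Hc.
  apply mero_ext with (fun s => Gamma (/ 2 * s + 0) * (Cpower PI (- (s * / 2)) * line_int c dir_SW (F_integrand s))).
  { apply filter_forall. intros s. unfold calF. replace (/ 2 * s + 0) with (s / 2) by (unfold Cdiv; ring).
    unfold Cdiv. ring. }
  apply mero_mult_hol.
  - apply (mero_affine Gamma (/ 2) 0 z); [|apply Gamma_mero].
    intros E. apply (f_equal fst) in E. simpl in E. lra.
  - apply hol_mult; [|now apply F_line_hol]. apply hol_Cpower_r. auto with hol.
Qed.

Theorem mainTheorem1 (r c d : R)
    (hr : (0 < r)%R) (hc : (0 < c < 1)%R) (hd : (- (1 / 2) < d < 1 / 2)%R) :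
  (forall s : C,
     line_int_converges c dir_SW (F_integrand s) /\
     line_int_converges d dir_SE (U_integrand1 r s) /\
     line_int_converges d dir_SW (U_integrand2 r s)) /\
  (meromorphic (calF c) /\
   meromorphic (rhs1 r d) /\
   forall s : C, ~ Gamma_pole (s / 2) -> calF c s = rhs1 r d s) /\
  (meromorphic (fun s : C => Cconj (calF c (1 - Cconj s))) /\
   meromorphic (rhs2 r d) /\
   forall s : C, ~ Gamma_pole ((1 - s) / 2) ->
     Cconj (calF c (1 - Cconj s)) = rhs2 r d s).
Proof.
  assert (E1 := fun s => calF_rhs1 r c d s hr hc hd).
  assert (E2 : forall s, Cconj (calF c (1 - Cconj s)) = rhs2 r d s).
  { intros s. rewrite E1. symmetry. now apply rhs2_rhs1. }
  assert (M1 : meromorphic (calF c)) by (apply mero_meromorphic; intros z; now apply calF_mero).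
  assert (M2 : meromorphic (fun s : C => Cconj (calF c (1 - Cconj s)))).
  { apply mero_meromorphic. intros z.
    apply mero_ext with (fun s => Cconj (calF c (- (1) * Cconj s + 1))).
    { apply filter_forall. intros s. do 2 f_equal. ring. }
    apply (mero_reflect (fun s => calF c (- (1) * s + 1))). apply mero_affine; [|now apply calF_mero].
    intros E. apply (f_equal fst) in E. simpl in E. lra. }
  split; [|split].
  - intros s. destruct (line_integrals r c d s hr hc hd) as [D1 [D2 _]].
    destruct (rhs2_rhs1 r d s hr hd) as [D3 _].
    split; [|split]; eexists; apply Int_correct; assumption.
  - split; [|split]; auto. now rewrite <- (functional_extensionality _ _ E1).
  - split; [|split]; auto. now rewrite <- (functional_extensionality _ _ E2).
Qed.
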